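(* Let $(K,v)$ be a Henselian valued field and let $\theta\in\overline{K}$, of degree $n>1$ over $K$, be tame over $K$, with minimal polynomial $F$. Let $[\alpha_0,\dots,\alpha_{r-1},\alpha_r=\theta]$ be an Okutsu sequence of $\theta$ with $\alpha_0,\dots,\alpha_{r-1}$ separable over $K$, and put $\delta_i=v(\theta-\alpha_i)$ for $0\le i<r$. Let $$v\xrightarrow{\phi_0,\gamma_0}\mu_0\xrightarrow{\phi_1,\gamma_1}\mu_1\to\cdots\xrightarrow{\phi_{r-1},\gamma_{r-1}}\mu_{r-1}\xrightarrow{F,\infty}\mu_r=v_F$$ be a Mac Lane–Vaquié chain of $v_F$, and let $\lambda_0=\gamma_0$, $\lambda_i=\gamma_i-\mu_{i-1}(\phi_i)$ for $0<i<r$ be its secondary slopes. Then $\delta_i=\lambda_0+\cdots+\lambda_i$ for all $0\le i<r$.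
   Context: $(K,v)$ is a Henselian valued field of arbitrary rank; $v$ also denotes its unique extension to a fixed algebraic closure $\overline{K}$; $\Gamma=v(\overline{K}^* )$; $\deg_K\alpha=[K(\alpha):K]$. Tameness: for a finite simple extension $L/K$ the defect $d(L/K)$ is defined by $[L:K]=e(L/K)f(L/K)d(L/K)$; $L/K$ is defectless if $d(L/K)=1$. A separable and defectless $L/K$ is tame if $Lv/Kv$ is separable and $e(L/K)$ is not divisible by $\operatorname{char}(Kv)$. An element $\alpha$ is separable, defectless, tame if $K(\alpha)/K$ is. Okutsu sequence of a defectless $\theta$: a list $[\alpha_0,\dots,\alpha_{r-1},\alpha_r=\theta]$ in $\overline{K}$ with $m_i=\deg_K\alpha_i$, $1=m_0<m_1<\cdots<m_r=n$, such that for all $0\le i<r$ and $\beta\in\overline{K}$: $\deg_K\beta<m_{i+1}\Rightarrow v(\theta-\beta)\le v(\theta-\alpha_i)$; and $\deg_K\beta<m_i\Rightarrow v(\theta-\beta)<v(\theta-\alpha_i)$. Valuations: $v_F:K[x]\to\Gamma\cup\{\infty\}$, $v_F(g)=v(g(\theta))$. All valuations $\mu:K[x]\to\Gamma\cup\{\infty\}$ considered extend $v$ (and may take the value $\infty$ on a nonzero prime ideal); $\mu\le\nu$ means $\mu(f)\le\nu(f)$ for all $f$. The graded algebra of $\mu$ is $\mathcal{G}_\mu=\bigoplus_{\alpha}\{f:\mu(f)\ge\alpha\}/\{f:\mu(f)>\alpha\}$ ($\alpha$ in the value group of $\mu$), and $\operatorname{in}_\mu f$ is the image of $f$ in degree $\mu(f)$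 when $\mu(f)<\infty$ (and $0$ otherwise). A monic $\phi\in K[x]$ is $\mu$-minimal if the ideal $I(\phi)=(\operatorname{in}_\mu\phi)\mathcal{G}_\mu$ contains no $\operatorname{in}_\mu f$ with $f\ne0$, $\deg f<\deg\phi$; $\phi$ is a key polynomial for $\mu$ if it is $\mu$-minimal and $I(\phi)$ is a prime ideal (nonzero). If key polynomials for $\mu$ exist, $\deg(\mu)$ is their minimal degree. Augmentations: (Initial) $v\xrightarrow{\phi_0,\gamma_0}\mu_0$ with $\phi_0$ monic of degree one, $\gamma_0\in\Gamma$, $\mu_0(\sum a_n\phi_0^n)=\min_n\{v(a_n)+n\gamma_0\}$ ($a_n\in K$). (Ordinary) for $\phi$ a key polynomial of $\mu$ and $\gamma>\mu(\phi)$ in $\Gamma\cup\{\infty\}$, $[\mu;\phi,\gamma](\sum a_n\phi^n)=\min_n\{\mu(a_n)+n\gamma\}$ where $\deg a_n<\deg\phi$. (Limit) let $\mathcal{A}=(\rho_j)_{j\in I}$ be a family of valuations indexed by an infinite well-ordered set, with $\rho_i<\rho_j$ for $i<j$, all of the same degree; a polynomial $g$ is $\mathcal{A}$-unstable if $\rho_i(g)<\rho_j(g)$ for all $i<j$; a limit key polynomial for $\mathcal{A}$ is a monic $\mathcal{A}$-unstable polynomial of minimal degree; $\mathcal{A}$ is a continuous family if limit key polynomials exist. Polynomials $a$ of smaller degree have a stable value $\rho_{\mathcal{A}}(a)$ (the eventually constant value of $\rho_i(a)$). For a limit key polynomial $\phi$ and $\gamma\in\Gamma\cup\{\infty\}$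 with $\gamma>\rho_i(\phi)$ for all $i$, $[\mathcal{A};\phi,\gamma](\sum a_n\phi^n)=\min_n\{\rho_{\mathcal{A}}(a_n)+n\gamma\}$, $\deg a_n<\deg\phi$. A Mac Lane–Vaquié (MLV) chain of $v_F$ is a chain $v\xrightarrow{\phi_0,\gamma_0}\mu_0\xrightarrow{\phi_1,\gamma_1}\mu_1\to\cdots\xrightarrow{\phi_{r-1},\gamma_{r-1}}\mu_{r-1}\xrightarrow{F,\infty}\mu_r=v_F$ whose initial step $v\xrightarrow{\phi_0,\gamma_0}\mu_0$ is given by a monic $\phi_0$ of degree one and $\gamma_0\in\Gamma$ through $\mu_0(\sum a_n\phi_0^n)=\min_n\{v(a_n)+n\gamma_0\}$ ($a_n\in K$) and, for $0<i\le r$ (with $\phi_r=F,\gamma_r=\infty$), either $\mu_i=[\mu_{i-1};\phi_i,\gamma_i]$ ordinary, or $\mu_i=[\mathcal{A}_{i-1};\phi_i,\gamma_i]$ limit for a continuous family $\mathcal{A}_{i-1}$ whose first valuation is $\mu_{i-1}$, such that the degrees satisfy $1=\deg\phi_0<\deg\phi_1<\cdots<\deg\phi_r=n$ and $v_F(\phi_i)=\gamma_i$ for $0\le i<r$. All MLV chains of $v_F$ have the same length, which equals the length $r$ of every Okutsu sequence of $\theta$. *)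

(* Defs.v *)
From HB Require Import structures.
From mathcomp Require Import all_boot all_order all_algebra.
From mathcomp Require Import ring_quotient separable finmap.
From mathcomp.multinomials Require Import monalg.

Set Implicit Arguments.
Unset Strict Implicit.
Unset Printing Implicit Defensive.

Import Order.TTheory GRing.Theory Num.Theory.
Local Open Scope ring_scope.

HB.mixin Record POrderedZmodule_isOag G of Num.POrderedZmodule G := {
  oag_total : total (<=%R : rel G);
  oag_leD2r : forall z x y : G, x <= y -> x + z <= y + z
}.

#[short(type="oagType")]
HB.structure Definition OrderedAbelianGroup :=
  {G of Num.POrderedZmodule G & POrderedZmodule_isOag G}.

HB.instance Definition _ (G : oagType) :=
  Order.POrder_isTotal.Build ring_display (OrderedAbelianGroup.sort G)
    (@oag_total G).

Section OagTheory.
Variable G : oagType.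
Implicit Types x y z t : G.

Lemma oag_leD2rE z x y : (x + z <= y + z) = (x <= y).
Proof.
apply/idP/idP; last exact: oag_leD2r.
by move/(@oag_leD2r G (- z)); rewrite !addrK.
Qed.

Lemma oag_ltD2rE z x y : (x + z < y + z) = (x < y).
Proof. by rewrite !ltNge oag_leD2rE. Qed.

Lemma oag_leD x y z t : x <= y -> z <= t -> x + z <= y + t.
Proof.
move=> xy zt; apply: (@le_trans _ _ (y + z)); first by rewrite oag_leD2rE.
by rewrite ![y + _]addrC oag_leD2rE.
Qed.

Lemma oag_ltD x y z t : x <= y -> z < t -> x + z < y + t.
Proof.
move=> xy zt; apply: (@le_lt_trans _ _ (y + z)); first by rewrite oag_leD2rE.
by rewrite ![y + _]addrC oag_ltD2rE.
Qed.

Lemma oag_double_eq0 x : x + x = 0 -> x = 0.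
Proof.
move=> xx; case: (ltgtP x 0) => // x0.
  by have := oag_ltD (ltW x0) x0; rewrite xx addr0 ltxx.
by have := oag_ltD (ltW x0) x0; rewrite xx addr0 ltxx.
Qed.

End OagTheory.

(** [extg G] is G together with infinity, encoded by [None]. *)
Definition extg (G : Type) : Type := option G.
Definition fin (G : Type) (g : G) : extg G := Some g.
Definition infty (G : Type) : extg G := None.
Arguments infty {G}.

(** Junk value 0 at infinity. *)
Definition fin_part (G : zmodType) (x : extg G) : G := odflt 0 x.

Section ExtendedGroup.
Variable G : oagType.
Implicit Types x y z t : extg G.

Definition ext_le x y : bool :=
  match x, y with
  | _, None => true
  | None, Some _ => false
  | Some a, Some b => a <= b
  end.

Definition ext_add x y : extg G :=
  match x, y with
  | Some a, Some b => Some (a + b)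
  | _, _ => None
  end.

HB.instance Definition _ := Choice.copy (extg G) (option G).

Fact ext_le_refl : reflexive ext_le.
Proof. by case=> //= a. Qed.
Fact ext_le_anti : antisymmetric ext_le.
Proof. by move=> [a|] [b|] //= /le_anti ->. Qed.
Fact ext_le_trans : transitive ext_le.
Proof. by move=> [a|] [b|] [c|] //=; apply: le_trans. Qed.
Fact ext_le_total : total ext_le.
Proof. by move=> [a|] [b|] //=; apply: le_total. Qed.

HB.instance Definition _ := Order.Le_isPOrder.Build ring_display (extg G)
  ext_le_refl ext_le_anti ext_le_trans.
HB.instance Definition _ :=
  Order.POrder_isTotal.Build ring_display (extg G) ext_le_total.

Fact ext_addA : associative ext_add.
Proof. by move=> [a|] [b|] [c|] //=; rewrite addrA. Qed.
Fact ext_addC : commutative ext_add.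
Proof. by move=> [a|] [b|] //=; rewrite addrC. Qed.
Fact ext_add0 : left_id (Some 0) ext_add.
Proof. by move=> [a|] //=; rewrite add0r. Qed.

HB.instance Definition _ :=
  GRing.isNmodule.Build (extg G) ext_addA ext_addC ext_add0.

Lemma ext_lex_infty x : x <= infty. Proof. by case: x. Qed.
Lemma ext_lt_infty (a : G) : fin a < infty. Proof. by rewrite lt_def. Qed.
Lemma ext_leE (a b : G) : (fin a <= fin b) = (a <= b). Proof. by []. Qed.
Lemma ext_ltE (a b : G) : (fin a < fin b) = (a < b).
Proof. by rewrite !lt_def ext_leE. Qed.

Lemma ext_leD x y z t : x <= y -> z <= t -> x + z <= y + t.
Proof.
case: x y z t => [a|] [b|] [c|] [d|] // xy zt; exact: oag_leD.
Qed.

Lemma ext_ltD (a b : G) y t :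
  fin a <= y -> fin b < t -> fin (a + b) < y + t.
Proof.
case: y t => [c|] [d|] ac bd; try exact: ext_lt_infty.
by change (fin (a + b) < fin (c + d)); rewrite ext_ltE oag_ltD // -ext_ltE.
Qed.

Lemma ext_addge0 x y : fin 0 <= x -> fin 0 <= y -> fin 0 <= x + y.
Proof.
by case: x y => [a|] [b|] //; move=> x0 y0; rewrite -[X in fin X](addr0 0); apply: oag_leD.
Qed.

End ExtendedGroup.

(** The support may be a nonzero prime ideal, but is zero on a field. *)
Record valuation (R : comNzRingType) (G : oagType) := Valuation {
  val_fun :> R -> extg G;
  val_zero : val_fun 0 = infty;
  val_one : val_fun 1 = fin 0;
  val_mul : forall x y, val_fun (x * y) = val_fun x + val_fun y;
  val_add : forall x y, Order.min (val_fun x) (val_fun y) <= val_fun (x + y)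
}.

Section ValuationTheory.
Variables (R : comNzRingType) (G : oagType) (mu : valuation R G).

Lemma val_opp1 : mu (-1) = fin 0.
Proof.
have : mu (-1) + mu (-1) = fin 0 by rewrite -val_mul mulrNN mulr1 val_one.
case: (mu (-1)) => // a [] /oag_double_eq0 ->; by [].
Qed.

Lemma val_opp x : mu (- x) = mu x.
Proof. by rewrite -mulN1r val_mul val_opp1 add0r. Qed.

Lemma val_leD g x y : g <= mu x -> g <= mu y -> g <= mu (x + y).
Proof.
by move=> gx gy; apply: le_trans (val_add mu x y); rewrite le_min gx gy.
Qed.

Lemma val_ltD g x y : g < mu x -> g < mu y -> g < mu (x + y).
Proof.
by move=> gx gy; apply: lt_le_trans (val_add mu x y); rewrite lt_min gx gy.
Qed.

Lemma val_le_sum (I : Type) (s : seq I) (f : I -> R) g :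
  (forall i, g <= mu (f i)) -> g <= mu (\sum_(i <- s) f i).
Proof.
move=> h; elim/big_ind: _ => //; first by rewrite val_zero ext_lex_infty.
by move=> x y; apply: val_leD.
Qed.

Lemma val_lt_sum (I : Type) (s : seq I) (f : I -> R) (g : G) :
  (forall i, fin g < mu (f i)) -> fin g < mu (\sum_(i <- s) f i).
Proof.
move=> h; elim/big_ind: _ => //; first by rewrite val_zero ext_lt_infty.
by move=> x y; apply: val_ltD.
Qed.

End ValuationTheory.

(** [residue w] is the residue field [vring w / vmax w] of [w]. *)
Section ResidueField.
Variables (E : fieldType) (G : oagType) (w : valuation E G).

Definition in_vring : {pred E} := [pred x | fin 0 <= w x].

Fact in_vring_subring : subring_closed in_vring.
Proof.
split=> [|x y|x y]; rewrite !inE.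
- by rewrite val_one.
- by move=> x0 y0; apply: val_leD => //; rewrite val_opp.
- by move=> x0 y0; rewrite val_mul; apply: ext_addge0.
Qed.
HB.instance Definition _ := GRing.isSubringClosed.Build E in_vring in_vring_subring.

Record vring := VRing { vring_val : E; _ : vring_val \in in_vring }.
HB.instance Definition _ := [isSub for vring_val].
HB.instance Definition _ := [Choice of vring by <:].
HB.instance Definition _ := [SubChoice_isSubComNzRing of vring by <:].

Definition vmax : {pred vring} := [pred x | fin 0 < w (vring_val x)].

Fact vmax_ideal : idealr_closed vmax.
Proof.
split; rewrite ?inE ?[vring_val _]rmorph0 ?[vring_val _]rmorph1.
- by rewrite val_zero ext_lt_infty.
- by rewrite val_one ltxx.
move=> a u v; rewrite !inE => u0 v0.
have -> : vring_val (a * u + v) = vring_val a * vring_val u + vring_val v by [].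
apply: val_ltD => //; rewrite val_mul.
have a0 : fin 0 <= w (vring_val a) by case: (a).
by rewrite -[X in fin X](addr0 0) ext_ltD.
Qed.
HB.instance Definition _ := isIdealr.Build vring vmax vmax_ideal.

Definition residue : Type := {ideal_quot vmax}.
HB.instance Definition _ := GRing.ComNzRing.on residue.

(** The residue class, 0 outside the valuation ring. *)
Definition res (x : E) : residue := \pi_({ideal_quot vmax})%qT (insubd (0 : vring) x).

Definition residue_inv (y : residue) : residue :=
  if y == 0 then 0 else res (vring_val (repr y))^-1.

Fact residue_mulVf y : y != 0 -> residue_inv y * y = 1.
Proof.
move=> y0; rewrite /residue_inv (negPf y0).
have ypi : y = \pi_({ideal_quot vmax})%qT (repr y) by rewrite reprK.
set u := repr y in ypi *.
have u0 : u \notin vmax.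
  apply: contraNN y0 => um; rewrite ypi -[0](rmorph0 \pi_({ideal_quot vmax})%qT).
  by rewrite -Quotient.idealrBE subr0.
have wu0 : w (vring_val u) = fin 0.
  by apply/eqP; rewrite eq_le leNgt [~~ _]u0 /=; case: (u).
have un0 : vring_val u != 0.
  by apply/eqP => e; move: wu0; rewrite e val_zero.
have wV : w (vring_val u)^-1 = fin 0.
  have := val_mul w (vring_val u)^-1 (vring_val u).
  by rewrite mulVf // val_one wu0 addr0.
rewrite ypi /res -rmorphM -[1](rmorph1 \pi_({ideal_quot vmax})%qT).
congr (\pi_({ideal_quot vmax})%qT _); apply: val_inj.
have -> : val (insubd (0 : vring) (vring_val u)^-1 * u) =
  val (insubd (0 : vring) (vring_val u)^-1) * vring_val u by [].
by rewrite insubdK ?mulVf // inE wV.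
Qed.

Fact residue_inv0 : residue_inv 0 = 0.
Proof. by rewrite /residue_inv eqxx. Qed.

HB.instance Definition _ :=
  GRing.ComNzRing_isField.Build residue residue_mulVf residue_inv0.

End ResidueField.

(** The group algebra of G over R, built by hand: [monalg] only provides a product on [{malg R[M]}] for monoids M in which
    1 is the only unit, hence not for groups. *)
Section GroupAlgebra.
Variables (G : oagType) (R : comNzRingType).

Definition galg : Type := {malg R[G]}.
HB.instance Definition _ := GRing.Zmodule.on galg.

Implicit Types x y z : galg.

Local Notation "'U' c k" := (@mkmalgU G R k c) (at level 10, c at level 9, k at level 9).

Definition galg_one : galg := U 1 0.
Definition galg_mul x y : galg :=
  \sum_(g <- msupp x) \sum_(h <- msupp y) U (x@_g * y@_h) (g + h).

Lemma galg_mulw (d1 d2 : {fset G}) x y :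
  (msupp x `<=` d1)%fset -> (msupp y `<=` d2)%fset ->
  galg_mul x y = \sum_(g <- d1) \sum_(h <- d2) U (x@_g * y@_h) (g + h).
Proof.
move=> le1 le2; rewrite /galg_mul (big_fset_incl _ le1) /=.
  apply/eq_bigr=> g _; apply/big_fset_incl => // k _ /mcoeff_outdom ->.
  by rewrite mulr0 monalgU0.
move=> k _ /mcoeff_outdom xk.
by rewrite big1 // => h _; rewrite xk mul0r monalgU0.
Qed.

Fact galg_mulC : commutative galg_mul.
Proof.
move=> x y; rewrite /galg_mul exchange_big /=; apply: eq_bigr => h _.
by apply: eq_bigr => g _; rewrite mulrC addrC.
Qed.

Fact galg_mulDl : left_distributive galg_mul +%R.
Proof.
move=> x y z.
rewrite (galg_mulw (msuppD_le x y) (fsubset_refl (msupp z))).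
rewrite (galg_mulw (fsubsetUl _ (msupp y)) (fsubset_refl (msupp z))).
rewrite (galg_mulw (fsubsetUr (msupp x) _) (fsubset_refl (msupp z))).
rewrite -big_split /=; apply: eq_bigr => g _.
rewrite -big_split /=; apply: eq_bigr => h _.
by rewrite mcoeffD mulrDl monalgUD.
Qed.

Fact galg_mulDr : right_distributive galg_mul +%R.
Proof. by move=> x y z; rewrite galg_mulC galg_mulDl ![galg_mul _ x]galg_mulC. Qed.

Fact galg_mul0 x : galg_mul 0 x = 0.
Proof. by rewrite /galg_mul msupp0 big_seq_fset0. Qed.

Fact galg_mulr0 x : galg_mul x 0 = 0.
Proof. by rewrite galg_mulC galg_mul0. Qed.

Lemma galg_mulUU a b g h : galg_mul (U a g) (U b h) = U (a * b) (g + h).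
Proof.
by rewrite (galg_mulw msuppU_le msuppU_le) !big_seq_fset1 !mcoeffUU.
Qed.

Lemma galg_mul_suml (I : Type) (s : seq I) (f : I -> galg) x :
  galg_mul (\sum_(i <- s) f i) x = \sum_(i <- s) galg_mul (f i) x.
Proof. exact: (big_morph (galg_mul^~ x) (fun a b => galg_mulDl a b x) (galg_mul0 x)). Qed.

Lemma galg_mul_sumr (I : Type) (s : seq I) (f : I -> galg) x :
  galg_mul x (\sum_(i <- s) f i) = \sum_(i <- s) galg_mul x (f i).
Proof. by rewrite galg_mulC galg_mul_suml; apply: eq_bigr => i _; rewrite galg_mulC. Qed.

Fact galg_mul1 : left_id galg_one galg_mul.
Proof.
move=> x; rewrite [in LHS](monalgE x) galg_mul_sumr [RHS]monalgE.
by apply: eq_bigr => g _; rewrite galg_mulUU mul1r add0r.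
Qed.

Fact galg_mulA : associative galg_mul.
Proof.
have sum1 (P : galg -> Prop) : P 0 -> (forall a b, P a -> P b -> P (a + b)) ->
    (forall a g, P (U a g)) -> forall x, P x.
  by move=> P0 PD PU x; rewrite (monalgE x); apply: big_ind.
move=> x y z; elim/sum1: x => [|a b ea eb|a g]; rewrite ?galg_mul0 //.
  by rewrite !galg_mulDl ea eb.
elim/sum1: y => [|b c eb ec|b h]; rewrite ?(galg_mul0, galg_mulr0) //.
  by rewrite !(galg_mulDl, galg_mulDr) eb ec.
elim/sum1: z => [|c d ec ed|c k]; rewrite ?galg_mulr0 //.
  by rewrite !galg_mulDr ec ed.
by rewrite !galg_mulUU mulrA addrA.
Qed.

Fact galg_one_neq0 : galg_one != 0.
Proof. by rewrite /galg_one monalgU_eq0 oner_eq0. Qed.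

HB.instance Definition _ := GRing.Zmodule_isComNzRing.Build galg
  galg_mulA galg_mulC galg_mul1 galg_mulDl galg_one_neq0.

End GroupAlgebra.

(** With P_g = {f : mu f >= g} and P_g^+ = {f : mu f > g}, the graded algebra
    (+)_g P_g / P_g^+ is obtained as the quotient of the Rees algebra
    (+)_g P_g t^g by its ideal (+)_g P_g^+ t^g, both taken inside the group
    algebra. Degrees g outside the value group of mu contribute P_g / P_g^+ = 0. *)
Section GradedAlgebra.
Variables (R : comNzRingType) (G : oagType) (mu : valuation R G).

Definition in_rees : {pred galg G R} :=
  [pred x | all (fun g => fin g <= mu x@_g) (msupp x)].

Lemma in_reesP (x : galg G R) :
  reflect (forall g, fin g <= mu x@_g) (x \in in_rees).
Proof.
apply: (iffP allP) => [h g|h g _]; last exact: h.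
have [/h //|gx] := boolP (g \in msupp x).
by rewrite mcoeff_outdom // val_zero ext_lex_infty.
Qed.

Lemma galg_coefM (x y : galg G R) k : (x * y)@_k =
  \sum_(g <- msupp x) \sum_(h <- msupp y) (x@_g * y@_h) *+ (g + h == k).
Proof.
rewrite [x * y]/(galg_mul x y) /galg_mul raddf_sum /=; apply: eq_bigr => g _.
by rewrite raddf_sum /=; apply: eq_bigr => h _; rewrite mcoeffU.
Qed.

Fact in_rees_subring : subring_closed in_rees.
Proof.
split=> [|x y|x y].
- apply/in_reesP => g; rewrite [1]/(galg_one G R) mcoeffU.
  have [<-|_] := eqVneq; first by rewrite val_one.
  by rewrite val_zero ext_lex_infty.
- move=> /in_reesP hx /in_reesP hy; apply/in_reesP => g.
  by rewrite mcoeffB; apply: val_leD; rewrite ?val_opp.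
move=> /in_reesP hx /in_reesP hy; apply/in_reesP => k.
rewrite galg_coefM; apply: val_le_sum => g; apply: val_le_sum => h.
have [<-|_] := eqVneq; last by rewrite mulr0n val_zero ext_lex_infty.
by rewrite mulr1n val_mul; apply: (@ext_leD G (fin g) _ (fin h)).
Qed.
HB.instance Definition _ :=
  GRing.isSubringClosed.Build (galg G R) in_rees in_rees_subring.

Record rees := Rees { rees_val : galg G R; _ : rees_val \in in_rees }.
HB.instance Definition _ := [isSub for rees_val].
HB.instance Definition _ := [Choice of rees by <:].
HB.instance Definition _ := [SubChoice_isSubComNzRing of rees by <:].

Definition rees_plus : {pred rees} :=
  [pred x | all (fun g => fin g < mu (rees_val x)@_g) (msupp (rees_val x))].

Lemma rees_plusP (x : rees) :
  reflect (forall g, fin g < mu (rees_val x)@_g) (x \in rees_plus).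
Proof.
apply: (iffP allP) => [h g|h g _]; last exact: h.
have [/h //|gx] := boolP (g \in msupp (rees_val x)).
by rewrite mcoeff_outdom // val_zero ext_lt_infty.
Qed.

Fact rees_plus_ideal : idealr_closed rees_plus.
Proof.
split.
- by apply/rees_plusP => g; rewrite [rees_val 0](_ : _ = 0) // mcoeff0 val_zero ext_lt_infty.
- apply/negP => /rees_plusP /(_ 0);
  by rewrite [rees_val 1](_ : _ = galg_one G R) // mcoeffUU val_one ltxx.
move=> a u v /rees_plusP hu /rees_plusP hv; apply/rees_plusP => k.
have -> : rees_val (a * u + v) = rees_val a * rees_val u + rees_val v by [].
rewrite mcoeffD; apply: val_ltD => //.
rewrite galg_coefM; apply: val_lt_sum => g; apply: val_lt_sum => h.
have [<-|_] := eqVneq; last by rewrite mulr0n val_zero ext_lt_infty.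
rewrite mulr1n val_mul; apply: ext_ltD => //.
by apply: in_reesP; case: (a).
Qed.
HB.instance Definition _ := isIdealr.Build rees rees_plus rees_plus_ideal.

Definition graded : Type := {ideal_quot rees_plus}.
HB.instance Definition _ := GRing.ComNzRing.on graded.

(** The image of f in P_g / P_g^+, of interest when mu f >= g. *)
Definition initial_at (g : G) (f : R) : graded :=
  \pi_({ideal_quot rees_plus})%qT (insubd (0 : rees) << f *g g >>).

Definition initial (f : R) : graded :=
  if mu f is Some g then initial_at g f else 0.

End GradedAlgebra.

Definition principal_ideal (A : comNzRingType) (a : A) : A -> Prop :=
  fun x => exists b, x = a * b.

(** [I] is meant to be an ideal already. *)
Definition is_prime_ideal (A : comNzRingType) (I : A -> Prop) : Prop :=
  ~ I 1 /\ forall a b, I (a * b) -> I a \/ I b.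

Section KeyPolynomials.
Variables (K : fieldType) (G : oagType) (v : valuation K G).
Local Notation polyval := (valuation {poly K} G).
Implicit Types (mu nu : polyval) (phi f g : {poly K}) (gamma : extg G).

Definition extends_base mu : Prop := forall a : K, mu a%:P = v a.

Definition val_le mu nu : Prop := forall f, mu f <= nu f.
Definition val_lt mu nu : Prop := val_le mu nu /\ exists f, mu f <> nu f.

Definition key_ideal mu phi : graded mu -> Prop :=
  principal_ideal (initial mu phi).
Arguments key_ideal mu phi x : clear implicits.

Definition minimal_poly_for mu phi : Prop :=
  forall f, f != 0 -> (size f < size phi)%N -> ~ key_ideal mu phi (initial mu f).

Definition key_polynomial mu phi : Prop :=
  [/\ phi \is monic, minimal_poly_for mu phi, initial mu phi != 0
    & is_prime_ideal (key_ideal mu phi)].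

(** deg(mu) = d, with [size] being one more than the degree. *)
Definition val_degree mu (d : nat) : Prop :=
  (exists phi, key_polynomial mu phi /\ size phi = d.+1) /\
  (forall phi, key_polynomial mu phi -> (d < size phi)%N).

Definition initial_augmentation phi gamma mu : Prop :=
  [/\ phi \is monic, size phi = 2, gamma <> infty &
    forall s : seq K,
      mu (\sum_(n < size s) (s`_n)%:P * phi ^+ n) =
      \big[Order.min/infty]_(n < size s) (v s`_n + gamma *+ n)].

Definition ordinary_augmentation mu phi gamma nu : Prop :=
  [/\ key_polynomial mu phi, mu phi < gamma &
    forall s : seq {poly K},
      (forall n, (n < size s)%N -> (size (s`_n)%R < size phi)%N) ->
      nu (\sum_(n < size s) s`_n * phi ^+ n) =
      \big[Order.min/infty]_(n < size s) (mu s`_n + gamma *+ n)].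

Section Families.
Variables (d : Order.disp_t) (I : orderType d) (rho : I -> polyval).

Definition increasing_family : Prop :=
  [/\ well_founded (fun i j : I => (i < j)%O),
      ~ (exists s : seq I, forall i, i \in s),
      forall i, extends_base (rho i),
      forall i j, (i < j)%O -> val_lt (rho i) (rho j)
    & exists e, forall i, val_degree (rho i) e].

Definition unstable g : Prop := forall i j, (i < j)%O -> rho i g < rho j g.

Definition stable_value g (c : extg G) : Prop :=
  exists i, forall j, (i <= j)%O -> rho j g = c.

Definition limit_key_polynomial phi : Prop :=
  [/\ phi \is monic, unstable phi &
    forall g, g \is monic -> unstable g -> (size phi <= size g)%N].

Definition limit_augmentation phi gamma nu : Prop :=
  [/\ limit_key_polynomial phi, forall i, rho i phi < gamma &
    forall (s : seq {poly K}) (c : nat -> extg G),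
      (forall n, (n < size s)%N ->
        (size (s`_n)%R < size phi)%N /\ stable_value s`_n (c n)) ->
      nu (\sum_(n < size s) s`_n * phi ^+ n) =
      \big[Order.min/infty]_(n < size s) (c n + gamma *+ n)].

Definition first_valuation mu : Prop :=
  exists i0, (forall i, (i0 <= i)%O) /\ rho i0 =1 mu.

End Families.

Definition limit_step mu phi gamma nu : Prop :=
  exists (d : Order.disp_t) (I : orderType d) (rho : I -> polyval),
    [/\ increasing_family rho, first_valuation rho mu
      & limit_augmentation rho phi gamma nu].

Definition MLV_chain (F : {poly K}) (vF : {poly K} -> extg G) (r : nat)
    (phi : nat -> {poly K}) (gamma : nat -> extg G) (mu : nat -> polyval) : Prop :=
  [/\ forall i, (i <= r)%N -> extends_base (mu i),
      initial_augmentation (phi 0) (gamma 0) (mu 0),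
      forall i, (i < r)%N ->
        ordinary_augmentation (mu i) (phi i.+1) (gamma i.+1) (mu i.+1) \/
        limit_step (mu i) (phi i.+1) (gamma i.+1) (mu i.+1),
      [/\ phi r = F, gamma r = infty & mu r =1 vF]
    & forall i, (i < r)%N ->
        (size (phi i) < size (phi i.+1))%N /\ vF (phi i) = gamma i].

(** In an MLV chain the values involved are finite for i < r. *)
Definition secondary_slope (phi : nat -> {poly K}) (gamma : nat -> extg G)
    (mu : nat -> polyval) (i : nat) : G :=
  if i is j.+1 then fin_part (gamma i) - fin_part (mu j (phi i))
  else fin_part (gamma 0).

End KeyPolynomials.

(** Below, A and B are subfields of an ambient field E, given as predicates. *)
Section Extensions.
Variable E : fieldType.
Implicit Types (A B : E -> Prop) (x y : E) (p : {poly E}).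

(** [B : A] = n *)
Definition ext_degree A B (n : nat) : Prop :=
  exists b : 'I_n -> E, (forall i, B (b i)) /\
    forall x, B x ->
      exists! c : {ffun 'I_n -> E}, (forall i, A (c i)) /\ x = \sum_i c i * b i.

Definition is_minpoly A x p : Prop :=
  [/\ p \is monic, forall i, A p`_i, root p x &
    forall q : {poly E},
      q != 0 -> (forall i, A q`_i) -> root q x -> (size p <= size q)%N].

Definition separable_ext A B : Prop :=
  forall x, B x -> exists2 p, is_minpoly A x p & separable_poly p.

Variables (G : oagType) (w : valuation E G).

Definition in_value_group A (g : G) : Prop := exists2 x, A x & w x = fin g.

(** The residue field of (A, w|A), inside that of (E, w). *)
Definition residue_subfield A (y : residue w) : Prop :=
  exists x, [/\ A x, fin 0 <= w x & y = res w x].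

Definition ramification_index A B (e : nat) : Prop :=
  exists c : 'I_e -> G, (forall i, in_value_group B (c i)) /\
    forall g, in_value_group B g -> exists! i, in_value_group A (g - c i).

End Extensions.

Arguments residue_subfield {E G} w A y.

Section Tameness.
Variables (E : fieldType) (G : oagType) (w : valuation E G).
Implicit Types A B : E -> Prop.

Definition inertia_degree A B (f : nat) : Prop :=
  ext_degree (residue_subfield w A) (residue_subfield w B) f.

Definition defect A B (d : nat) : Prop :=
  exists n e f, [/\ ext_degree A B n, ramification_index w A B e,
    inertia_degree A B f & n = (e * f * d)%N].

Definition defectless A B : Prop := defect A B 1.

(** Subfields have the same characteristic as the ambient residue field. *)
Definition tame_ext A B : Prop :=
  [/\ separable_ext A B, defectless A B,
      separable_ext (residue_subfield w A) (residue_subfield w B)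
    & forall e p, ramification_index w A B e -> p \in [pchar residue w] ->
        ~~ (p %| e)%N].

End Tameness.

(** [w] extends [v] up to equivalence of valuations. *)
Definition lies_over (K L : fieldType) (G H : oagType) (j : {rmorphism K -> L})
    (v : valuation K G) (w : valuation L H) : Prop :=
  forall a, (fin 0 <= w (j a)) = (fin 0 <= v a).

(** [v] extends uniquely, up to equivalence, to every algebraic extension. *)
Definition henselian (K : fieldType) (G : oagType) (v : valuation K G) : Prop :=
  forall (L : fieldType) (j : {rmorphism K -> L}),
    (forall x, algebraicOver j x) ->
    forall (H1 H2 : oagType) (w1 : valuation L H1) (w2 : valuation L H2),
      lies_over j v w1 -> lies_over j v w2 ->
      forall x, (fin 0 <= w1 x) = (fin 0 <= w2 x).

Section AlgebraicElements.
Variables (K Kbar : fieldType) (iota : {rmorphism K -> Kbar}).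
Variables (G : oagType) (vbar : valuation Kbar G).
Implicit Types alpha theta beta : Kbar.

Definition base_field : Kbar -> Prop := fun x => exists a, x = iota a.

Definition adjoin alpha : Kbar -> Prop := fun x =>
  exists g h : {poly K}, (map_poly iota h).[alpha] != 0 /\
    x = (map_poly iota g).[alpha] / (map_poly iota h).[alpha].

(** [K(alpha) : K] = n *)
Definition elt_degree alpha (n : nat) : Prop :=
  ext_degree base_field (adjoin alpha) n.

Definition separable_elt alpha : Prop :=
  separable_ext base_field (adjoin alpha).

Definition tame_elt alpha : Prop := tame_ext vbar base_field (adjoin alpha).

(** [alpha 0, ..., alpha r] is an Okutsu sequence of [theta], of degrees [m i]. *)
Definition okutsu_sequence theta (r : nat) (alpha : nat -> Kbar)
    (m : nat -> nat) : Prop :=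
  [/\ alpha r = theta,
      forall i, (i <= r)%N -> elt_degree (alpha i) (m i),
      m 0%N = 1%N,
      forall i, (i < r)%N -> (m i < m i.+1)%N
    & forall i, (i < r)%N -> forall beta d, elt_degree beta d ->
        ((d < m i.+1)%N -> vbar (theta - beta) <= vbar (theta - alpha i)) /\
        ((d < m i)%N -> vbar (theta - beta) < vbar (theta - alpha i))].

Definition eval_valuation theta (g : {poly K}) : extg G :=
  vbar (map_poly iota g).[theta].

End AlgebraicElements.

(* Main.v *)
(** Let [w] be the valuation of the algebraic closure and [W_d] the Gauss valuation of centre [theta] and radius
    [d]: for monic [f], [W_d f] is the sum of [min (d, w (theta - z))] over the roots [z] of [f], so it differs
    from [v_F f] exactly when [f] has a root in the open ball [w (theta - z) > d]. Inductively, [mu_i = W_(delta_i)]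
    and [deg phi_i = m_i].

    Tameness enters once: a polynomial over K of degree [m_(i+1)] has at most one root in the ball of radius
    [delta_i]. Indeed, if this ball has N conjugates, they all contain the same number of roots; and the average of
    the conjugates of [theta] in the ball, with integral weights whose sum is a unit, lies in the ball and has degree
    at most N, whence [m_(i+1) <= N]. So when [d] grows from [delta_i] to [delta_(i+1)], only one term of
    [W_d phi_(i+1)] varies, and its variation is the slope [lambda_(i+1)].

    Limit steps do not occur: the valuations of the family all have degree [m_i], and the minimal polynomial of
    [alpha_i], which maximizes [v_F] among the monic polynomials of degree [m_i], would be unstable. *)
Require Import Defs.
From Stdlib Require Import ClassicalEpsilon.
From HB Require Import structures.
From mathcomp Require Import all_boot all_order all_algebra all_fingroup all_field.
From mathcomp Require Import generic_quotient finmap ring zify.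
From mathcomp.multinomials Require Import monalg.

Set Implicit Arguments.
Unset Strict Implicit.
Unset Printing Implicit Defensive.

Import Order.TTheory GRing.Theory Num.Theory.
Local Open Scope ring_scope.

(** * Values with infinity *)

(** The chain is known only through augmentations, whose key polynomials are defined by prime ideals
    of graded algebras, while radii and root counts belong to the Gauss valuations. The bridge is a
    pair of valuations [mu <= nu]: a monic polynomial of least degree on which they differ is a key
    polynomial for [mu], and [nu] has no key polynomial of smaller degree. This makes the members of
    a continuous family agree below their common degree, and [mu_i] agree with [v_F] below the
    degree of [phi_i]; the degrees of the [phi_i] can then be compared with the [m_i] through roots
    in balls.

    A plain average of the N conjugates in a ball would require N to be a unit, which tameness does
    not give: a residue degree may be divisible by the residue characteristic. The weights are
    therefore conjugates of an integral element of [K(theta)] of unit trace, which exists because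
    the residue extension is separable and the ramification index is invertible in the residue
    field. Henselianity makes the Galois group act by isometries. *)

Section ExtendedGroupTheory.
Variable G : oagType.
Implicit Types (a b : G) (x y z t : extg G).

Lemma ext_finP x : x <> infty -> exists a, x = fin a.
Proof. by case: x => // a _; exists a. Qed.

Lemma fin_add a b : fin (a + b) = fin a + fin b.
Proof. by []. Qed.

Lemma fin0E : fin (0 : G) = 0.
Proof. by []. Qed.

Lemma fin_mulrn a n : fin (a *+ n) = fin a *+ n.
Proof. by elim: n => [|n IH]; rewrite ?mulr0n // !mulrS -IH. Qed.

Lemma ext_leD2l a x y : (fin a + x <= fin a + y) = (x <= y).
Proof.
case: x y => [b|] [c|] //; apply: etrans (_ : (a + b <= a + c) = _) _ => //.
by rewrite ![a + _]addrC oag_leD2rE.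
Qed.

Lemma ext_ltD2l a x y : (fin a + x < fin a + y) = (x < y).
Proof. by rewrite !ltNge ext_leD2l. Qed.

Lemma ext_lt_fin x y : x < y -> exists a, x = fin a.
Proof. by case: x => [a|]; [exists a | case: y]. Qed.

Lemma ext_le_fin x a : x <= fin a -> exists b, x = fin b.
Proof. by case: x => [b|//]; exists b. Qed.

Lemma ext_leltD x y z t : x <= y -> z < t -> x < infty -> x + z < y + t.
Proof.
move=> xy zt /ext_lt_fin[a xa]; have [b zb] := ext_lt_fin zt.
by rewrite xa zb in xy zt *; apply: ext_ltD.
Qed.

Lemma ext_ltleD x y z t : x < y -> z <= t -> z < infty -> x + z < y + t.
Proof. by move=> xy zt zf; rewrite ![_ + z]addrC ![_ + t]addrC ext_leltD. Qed.

Lemma ext_add_fin x y a : x + y = fin a ->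
  exists b c, [/\ x = fin b, y = fin c & b + c = a].
Proof. by case: x y => [b|] [c|] // []; exists b, c. Qed.

Lemma ext_add_infty x y : x + y = infty -> y != infty -> x = infty.
Proof. by case: x y => [a|] [b|]. Qed.

Lemma ext_addy x : x + infty = infty.
Proof. by case: x. Qed.

Lemma ext_leDr_sub (a : G) (x y : extg G) : (x <= y + fin a) = (x + fin (- a) <= y).
Proof.
by rewrite -(ext_leD2l (- a)) ![fin _ + _]addrC -addrA -fin_add subrr fin0E addr0.
Qed.

Lemma ext_ltDr_sub (a : G) (x y : extg G) : (x < y + fin a) = (x + fin (- a) < y).
Proof.
by rewrite -(ext_ltD2l (- a)) ![fin _ + _]addrC -addrA -fin_add subrr fin0E addr0.
Qed.

End ExtendedGroupTheory.

Section ValuationArithmetic.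
Variables (R : comNzRingType) (G : oagType) (mu : valuation R G).
Implicit Types x y : R.

Lemma val_addl x y : mu x < mu y -> mu (x + y) = mu x.
Proof.
move=> xy; have le : mu x <= mu (x + y) by rewrite val_leD // ltW.
apply: le_anti; rewrite le andbT leNgt; apply/negP => lt.
suff : mu x < mu (x + y - y) by rewrite addrK ltxx.
have [a xa] := ext_lt_fin xy; rewrite xa in xy lt *.
by apply: val_ltD; rewrite ?val_opp.
Qed.

End ValuationArithmetic.

(** * Initial forms and key polynomials *)

Section GradedAlgebraTheory.
Variables (R : comNzRingType) (G : oagType) (mu : valuation R G).
Implicit Types (f a b c : R) (g h k : G) (x y : rees mu).

Local Notation pi x := (\pi_({ideal_quot (rees_plus (mu := mu))})%qT x).
Local Notation hom f g := (insubd (0 : rees mu) << f *g g >>).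

Lemma rees_valM x y : rees_val (x * y) = rees_val x * rees_val y.
Proof. by []. Qed.

Lemma rees_valB x y : rees_val (x - y) = rees_val x - rees_val y.
Proof. by []. Qed.

Lemma rees_val_hom f g : fin g <= mu f -> rees_val (hom f g) = << f *g g >>.
Proof.
move=> gf; apply: insubdK; apply/in_reesP => h; rewrite mcoeffU.
by have [<-|_] := eqVneq; rewrite ?mulr1n ?mulr0n // val_zero ext_lex_infty.
Qed.

Lemma graded_eqP x y :
  pi x = pi y <-> forall k, fin k < mu ((rees_val x)@_k - (rees_val y)@_k).
Proof.
split=> [/eqP|h].
  rewrite -Quotient.idealrBE => /rees_plusP h k.
  by have := h k; rewrite rees_valB mcoeffB.
apply/eqP; rewrite -Quotient.idealrBE; apply/rees_plusP => k.
by rewrite rees_valB mcoeffB.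
Qed.

Lemma galg_coefUM f g (y : galg G R) k : ((<< f *g g >> : galg G R) * y)@_k = f * y@_(k - g).
Proof.
rewrite [_ * y](galg_mulw msuppU_le (fsubset_refl (msupp y))).
rewrite big_seq_fset1 mcoeffUU raddf_sum /=.
have gE h : (g + h == k) = (h == k - g) by rewrite [in RHS]eq_sym subr_eq addrC eq_sym.
have [kg|kg] := boolP (k - g \in msupp y).
  rewrite (big_fsetD1 _ kg) /= mcoeffU gE eqxx mulr1n big1_fset ?addr0 //.
  by move=> h; rewrite !inE => /andP[hk _] _; rewrite mcoeffU gE (negPf hk) mulr0n.
rewrite mcoeff_outdom // mulr0 big1_fset // => h hy _; rewrite mcoeffU gE.
by have [e|] := eqVneq; [rewrite -e hy in kg | rewrite mulr0n].
Qed.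

(** Membership of the class of [f] in the degree-[k] part of the ideal generated by the initial form of [phi],
    with [mu phi = g]. *)
Definition initial_dvd (phi : R) (g k : G) (f : R) : Prop :=
  exists c, fin (k - g) <= mu c /\ fin k < mu (f - phi * c).

(** Multiplication by the homogeneous element [initial mu phi] shifts degrees by [g], so membership
    in its ideal is decided degree by degree; only the finitely many degrees in the support of [x]
    need a cofactor. *)
Lemma principal_initialP phi g x : mu phi = fin g ->
  principal_ideal (initial mu phi) (pi x) <->
  forall k, initial_dvd phi g k (rees_val x)@_k.
Proof.
move=> phig; rewrite /principal_ideal /initial phig /initial_at.
have hphi : rees_val (hom phi g) = << phi *g g >> by rewrite rees_val_hom ?phig.
split=> [[b]|h].
  have -> : b = pi (repr b) by rewrite reprK.
  set y := repr b; rewrite -rmorphM => /graded_eqP e k.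
  exists (rees_val y)@_(k - g); split; first by apply: in_reesP; case: (y).
  by have := e k; rewrite rees_valM hphi galg_coefUM.
pose c k := proj1_sig (constructive_indefinite_description _ (h k)).
have cP k : fin (k - g) <= mu (c k) /\ fin k < mu ((rees_val x)@_k - phi * c k).
  exact: (proj2_sig (constructive_indefinite_description _ (h k))).
pose y := \sum_(k <- msupp (rees_val x)) hom (c k) (k - g).
have yE k : (rees_val y)@_(k - g) = c k *+ (k \in msupp (rees_val x)).
  have -> : rees_val y = \sum_(k <- msupp (rees_val x)) rees_val (hom (c k) (k - g)).
    rewrite /y; elim/big_rec2: _ => // i a b _ <-; by [].
  rewrite raddf_sum /=.
  have [kx|kx] := boolP (k \in msupp (rees_val x)).
    rewrite (big_fsetD1 _ kx) /= rees_val_hom ?(proj1 (cP k)) // mcoeffUU.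
    rewrite big1_fset ?addr0 // => j; rewrite !inE => /andP[jk _] _.
    rewrite rees_val_hom ?(proj1 (cP j)) // mcoeffU.
    by rewrite (inj_eq (addIr _)) (negPf jk).
  rewrite big1_fset // => j jx _.
  rewrite rees_val_hom ?(proj1 (cP j)) // mcoeffU (inj_eq (addIr _)).
  by have [e|] := eqVneq j k; [rewrite e (negPf kx) in jx | rewrite mulr0n].
exists (pi y); rewrite -rmorphM; apply/graded_eqP => k.
rewrite rees_valM hphi galg_coefUM yE.
have [kx|kx] := boolP (k \in msupp (rees_val x)); first by rewrite (proj2 (cP k)).
by rewrite mcoeff_outdom // mulr0 subrr val_zero ext_lt_infty.
Qed.


Section InitialDivisibility.
Variables (phi : R) (g : G).
Local Notation dvd := (initial_dvd phi g).

Lemma initial_dvd0 k f : fin k < mu f -> dvd k f.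
Proof.
by move=> kf; exists 0; rewrite val_zero mulr0 subr0 kf ext_lex_infty.
Qed.

Lemma initial_dvdD k a b : dvd k a -> dvd k b -> dvd k (a + b).
Proof.
move=> [c [c1 c2]] [d [d1 d2]]; exists (c + d); split; first exact: val_leD.
by rewrite mulrDr opprD addrACA val_ltD.
Qed.

Lemma initial_dvdN k a : dvd k a -> dvd k (- a).
Proof.
move=> [c [c1 c2]]; exists (- c); split; first by rewrite val_opp.
by rewrite mulrN -opprD val_opp.
Qed.

Lemma initial_dvdMl k h a b : fin h <= mu b -> dvd k a -> dvd (h + k) (b * a).
Proof.
move=> hb [c [c1 c2]]; exists (b * c); split.
  by rewrite -addrA fin_add val_mul ext_leD.
by rewrite mulrCA -mulrBr val_mul ext_ltD.
Qed.

Lemma initial_dvd_sum (I : eqType) (r : seq I) (F : I -> R) k :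
  (forall i, i \in r -> dvd k (F i)) -> dvd k (\sum_(i <- r) F i).
Proof.
elim: r => [|i r IH] h.
  by rewrite big_nil; apply: initial_dvd0; rewrite val_zero ext_lt_infty.
rewrite big_cons; apply: initial_dvdD; first by apply: h; rewrite mem_head.
by apply: IH => j jr; apply: h; rewrite inE jr orbT.
Qed.

Lemma seq_maximal (s : seq G) (P : G -> Prop) : (exists2 k, k \in s & P k) ->
  exists k, [/\ k \in s, P k & forall j, j \in s -> P j -> j <= k].
Proof.
elim: s => [[k]//|i s IH] [k].
have [/IH [k' [k's Pk' k'max]] _ _|nex] := classic (exists2 k, k \in s & P k).
  have [Pi|nPi] := classic (P i); last first.
    exists k'; split; rewrite ?inE ?k's ?orbT // => j.
    by rewrite inE => /orP[/eqP ->|/k'max //] /nPi.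
  have [ik|ki] := leP i k'.
    exists k'; split; rewrite ?inE ?k's ?orbT // => j.
    by rewrite inE => /orP[/eqP -> //|/k'max //].
  exists i; split; rewrite ?mem_head // => j; rewrite inE => /orP[/eqP -> //|js Pj].
  exact: le_trans (k'max _ js Pj) (ltW ki).
rewrite inE => /orP[/eqP -> Pi|ks Pk]; last by case: nex; exists k.
exists i; split; rewrite ?mem_head // => j.
by rewrite inE => /orP[/eqP -> //|js Pj]; case: nex; exists j.
Qed.

(* Compare the leading components not divisible by [phi] of the two factors. *)
Lemma principal_initial_prime : mu phi = fin g ->
  (forall k h a b, fin k <= mu a -> fin h <= mu b ->
     dvd (k + h) (a * b) -> dvd k a \/ dvd h b) ->
  forall A B : graded mu, principal_ideal (initial mu phi) (A * B) ->
    principal_ideal (initial mu phi) A \/ principal_ideal (initial mu phi) B.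
Proof.
move=> phig prime A B.
have -> : A = pi (repr A) by rewrite reprK.
have -> : B = pi (repr B) by rewrite reprK.
set x := repr A; set y := repr B; rewrite -rmorphM.
move=> /(principal_initialP _ phig) dxy.
have out (z : rees mu) k : ~ dvd k (rees_val z)@_k -> k \in msupp (rees_val z).
  move=> nd; apply/negPn/negP => kz; apply: nd; apply: initial_dvd0.
  by rewrite mcoeff_outdom // val_zero ext_lt_infty.
have top (z : rees mu) : ~ principal_ideal (initial mu phi) (pi z) ->
    exists k, ~ dvd k (rees_val z)@_k /\
      forall j, ~ dvd j (rees_val z)@_j -> j <= k.
  move=> nz; have [|k [kz nk kmax]] := @seq_maximal (msupp (rees_val z))
      (fun k => ~ dvd k (rees_val z)@_k).
    apply: NNPP => nex; apply: nz; apply/(principal_initialP _ phig) => k.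
    by apply: NNPP => nk; apply: nex; exists k => //; apply: out.
  by exists k; split=> // j nj; apply: kmax => //; apply: out.
apply: NNPP => /not_or_and[/top[k [nk kmax]] /top[h [nh hmax]]].
have le (z : rees mu) j : fin j <= mu (rees_val z)@_j.
  by case: z => z /= /in_reesP.
suff : dvd k (rees_val x)@_k \/ dvd h (rees_val y)@_h by case=> [/nk|/nh].
apply: prime (le x k) (le y h) _.
have := dxy (k + h); rewrite rees_valM galg_coefM.
rewrite (big_fsetD1 k (out _ _ nk)) /= (big_fsetD1 h (out _ _ nh)) /= eqxx mulr1n.
rewrite -addrA; set rest := (X in dvd _ (_ + X)) => d1.
suff d2 : dvd (k + h) rest.
  by have := initial_dvdD d1 (initial_dvdN d2); rewrite addrK.
have term i j : i + j = k + h -> (i != k) || (j != h) ->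
    dvd (k + h) ((rees_val x)@_i * (rees_val y)@_j).
  move=> e ne; have [ki|ik] := ltP k i.
    rewrite mulrC -e addrC; apply: initial_dvdMl (le _ _) _.
    by apply: NNPP => /kmax; rewrite leNgt ki.
  rewrite -e; apply: initial_dvdMl (le _ _) _.
  apply: NNPP => /hmax jh.
  have : i + j < k + h \/ i = k.
    case: (ltgtP i k) ik => // [lik _|-> _]; last by right.
    by left; rewrite addrC [k + h]addrC oag_ltD.
  case=> [|eik]; first by rewrite e ltxx.
  by move: e ne; rewrite eik => /addrI ->; rewrite !eqxx.
rewrite /rest; apply: initial_dvdD.
  apply: initial_dvd_sum => j; rewrite !inE => /andP[jh _].
  have [e|_] := eqVneq; last by apply: initial_dvd0; rewrite val_zero ext_lt_infty.
  by apply: term; rewrite ?jh ?orbT.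
apply: initial_dvd_sum => i; rewrite !inE => /andP[ik _].
apply: initial_dvd_sum => j _.
have [e|_] := eqVneq; last by apply: initial_dvd0; rewrite val_zero ext_lt_infty.
by apply: term; rewrite ?ik.
Qed.

End InitialDivisibility.

Lemma initial_dvdP phi g k f : mu phi = fin g -> mu f = fin k ->
  principal_ideal (initial mu phi) (initial mu f) <-> initial_dvd phi g k f.
Proof.
move=> phig fk; rewrite [X in principal_ideal _ X]/initial fk.
have fE : rees_val (hom f k) = << f *g k >> by rewrite rees_val_hom ?fk.
split=> [/(principal_initialP _ phig) /(_ k)|d]; first by rewrite fE mcoeffUU.
apply/(principal_initialP _ phig) => j; rewrite fE mcoeffU.
have [<- //|_] := eqVneq; apply: initial_dvd0.
by rewrite mulr0n val_zero ext_lt_infty.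
Qed.

Lemma initial1 : initial mu 1 = 1.
Proof.
rewrite /initial val_one; apply: etrans (rmorph1 _).
apply/graded_eqP => k; rewrite rees_val_hom ?val_one // subrr val_zero.
exact: ext_lt_infty.
Qed.

Lemma initial_neq0 f k : mu f = fin k -> initial mu f != 0.
Proof.
move=> fk; rewrite /initial fk; apply/negP => /eqP e.
have : pi (hom f k) = pi 0 by rewrite [RHS]rmorph0.
move/graded_eqP/(_ k).
by rewrite rees_val_hom ?fk // mcoeffUU [rees_val 0](_ : _ = 0) // mcoeff0 subr0 fk ltxx.
Qed.

End GradedAlgebraTheory.

Lemma ex_least (P : nat -> Prop) : (exists n, P n) ->
  exists n, P n /\ forall m, P m -> (n <= m)%N.
Proof.
move=> [n]; have [k] := ubnP n; elim: k n => // k IH n nk Pn.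
have [[m [mn Pm]]|nex] := classic (exists m, (m < n)%N /\ P m).
  by apply: IH Pm; apply: leq_trans mn _.
by exists n; split=> // m Pm; rewrite leqNgt; apply/negP => mn; apply: nex; exists m.
Qed.

Lemma val_const_fin (K : fieldType) (G : oagType) (rho : valuation {poly K} G) (c : K) :
  c != 0 -> exists x, rho c%:P = fin x.
Proof.
move=> c0; apply: ext_finP => e; have := val_one rho.
by rewrite -[1](polyC1 K) -(mulfV c0) polyCM val_mul e.
Qed.

(** * Comparable valuations and the polynomials on which they first differ *)

Section MinimalGap.
Variables (K : fieldType) (G : oagType) (mu nu : valuation {poly K} G).
Hypothesis mu_le_nu : forall f, mu f <= nu f.
Implicit Types (f h a b c phi : {poly K}).

(** The inequality at [c^-1] reverses the one at [c]. *)
Lemma val_le_const (c : K) : mu c%:P = nu c%:P.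
Proof.
have [->|c0] := eqVneq c 0; first by rewrite polyC0 !val_zero.
apply: le_anti; rewrite mu_le_nu /=.
have inv (rho : valuation {poly K} G) : rho c%:P + rho c^-1%:P = fin 0.
  by rewrite -val_mul -polyCM divff // val_one.
have [x [y [mx my xy]]] := ext_add_fin (inv mu).
have [z [t [nz nt zt]]] := ext_add_fin (inv nu).
have := mu_le_nu c^-1%:P; rewrite my nt mx nz !ext_leE => yt.
by rewrite -(oag_leD2rE (y + t)) [x + _]addrA xy [y + t]addrC addrA zt !add0r.
Qed.

(** In Mac Lane's theory, these [phi] form the tangent direction of [mu] determined by [nu]. *)
Definition minimal_gap phi : Prop :=
  [/\ phi \is monic, mu phi < nu phi &
    forall f, (size f < size phi)%N -> mu f = nu f].

Lemma minimal_gap_size phi f : minimal_gap phi -> mu f < nu f ->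
  (size phi <= size f)%N.
Proof.
move=> [_ _ eq]; rewrite leqNgt => lt; apply/negP => /eq e.
by rewrite e ltxx in lt.
Qed.

Lemma ex_minimal_gap f : mu f < nu f -> exists phi, minimal_gap phi.
Proof.
move=> lt; have [|n [[phi [phin philt]] nmin]] :=
  @ex_least (fun n => exists f, size f = n /\ mu f < nu f); first by exists (size f), f.
have phi0 : phi != 0 by apply/eqP => e; rewrite e !val_zero ltxx in philt.
have lc0 : (lead_coef phi)^-1 != 0 by rewrite invr_eq0 lead_coef_eq0.
have [x xE] := val_const_fin nu lc0.
exists ((lead_coef phi)^-1 *: phi); split.
- by rewrite monicE lead_coefZ mulVf ?lead_coef_eq0.
- by rewrite -mul_polyC !val_mul val_le_const xE ext_ltD2l.
move=> g; rewrite size_scale // phin => gn; apply: le_anti.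
by rewrite mu_le_nu leNgt /=; apply/negP => lt'; have := nmin _ (ex_intro _ g (conj erefl lt')); rewrite leqNgt gn.
Qed.

(* If [mu] had a nontrivial support, it would induce a valuation of a field, which has no proper majorant. *)
Lemma gap_support f h : mu f < nu f -> h != 0 -> mu h < infty.
Proof.
move=> lt h0; rewrite lt_def ext_lex_infty andbT; apply/eqP => /esym hinf.
have [|n [[p [pn p0 pinf]] nmin]] :=
  @ex_least (fun n => exists h, [/\ size h = n, h != 0 & mu h = infty]).
  by exists (size h), h.
move: p pn p0 pinf => {h h0 hinf} h hn h0 hinf.
have [d hd] : exists d, h = d * gcdp f h by have /dvdpP := dvdp_gcdr f h.
have g0 : gcdp f h != 0 by rewrite gcdp_eq0 negb_and h0 orbT.
have d0 : d != 0 by apply: contraNneq h0 => d0; rewrite hd d0 mul0r.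
have [muinf|mufin] := eqVneq (mu (gcdp f h)) infty.
  have /dvdpP[e fe] := dvdp_gcdl f h.
  by move: lt; rewrite fe val_mul muinf ext_addy ltNge ext_lex_infty.
have dinf : mu d = infty.
  by apply: ext_add_infty mufin; rewrite -val_mul -hd.
have : (size h <= size d)%N by rewrite hn; apply: nmin; exists d.
rewrite [in size h]hd size_mul // => le.
have : coprimep f h.
  rewrite coprimep_def eqn_leq size_poly_gt0 g0 andbT.
  rewrite -(leq_add2l (size d)) addn1. rewrite (leq_trans (leqSpred _)) // ltnS.
move/Bezout_coprimepP => [[u v] /= /eqpP [[c1 c2] /= /andP[c10 c20] e]].
have ec : (c1 *: u) * f = c2%:P - (c1 *: v) * h.
  by rewrite -!scalerAl -[c2%:P]alg_polyC -e scalerDr addrK.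
have fu (rho : valuation {poly K} G) : rho h = infty -> rho (c1 *: u * f) = rho c2%:P.
  move=> rinf; rewrite ec val_addl // val_opp val_mul rinf ext_addy.
  by have [x ->] := val_const_fin rho c20; apply: ext_lt_infty.
have nuinf : nu h = infty.
  by apply: le_anti; rewrite ext_lex_infty -hinf mu_le_nu.
have [x cx] := val_const_fin nu c20.
have := fu nu nuinf; have := fu mu hinf; rewrite val_le_const cx !val_mul.
move=> /ext_add_fin[a [b [ma mb ab]]] /ext_add_fin[a' [b' [na nb ab']]].
have := mu_le_nu (c1 *: u); rewrite ma na ext_leE => aa'.
move: lt; rewrite mb nb ext_ltE => /(oag_ltD aa'); by rewrite ab ab' ltxx.
Qed.

Section Gap.
Variables (phi : {poly K}) (g : G).
Hypotheses (gap : minimal_gap phi) (phig : mu phi = fin g).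

(** Both conditions describe the kernel, in degree [k], of the natural map from the graded algebra
    of [mu] to that of [nu]. Divide [a] by [phi]: the remainder [r] has the same value for both
    valuations. If [mu r <= k < nu a], the multiple of [phi] has the same [nu]-value as [r], hence a
    smaller [mu]-value, and [mu a < k]. *)
Lemma gap_initial_dvd k a : fin k <= mu a ->
  initial_dvd mu phi g k a <-> fin k < nu a.
Proof.
case: (gap) => mon lt eq ka; split=> [[c [c1 c2]]|kn].
  rewrite -[a](subrK (phi * c)); apply: val_ltD.
    exact: lt_le_trans c2 (mu_le_nu _).
  rewrite mulrC val_mul -[k](subrK g); apply: ext_ltD; last by rewrite -phig.
  exact: le_trans c1 (mu_le_nu _).
have [kma|mak] := ltP (fin k) (mu a); first exact: initial_dvd0.
have {ka mak} mak : mu a = fin k by apply: le_anti; rewrite ka mak.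
have phi0 := monic_neq0 mon.
pose c := a %/ phi; pose r := a %% phi.
have aE : a = phi * c + r by rewrite mulrC -divp_eq.
have rE : mu r = nu r by apply: eq; rewrite ltn_modp.
have c0 : c != 0.
  apply/eqP => c0; move: kn; rewrite -mak aE c0 mulr0 add0r rE; by rewrite ltxx.
have cfin := gap_support lt c0.
have mlt : mu (phi * c) < nu (phi * c).
  by rewrite !val_mul; apply: ext_ltleD => //; apply: mu_le_nu.
have kr : fin k < mu r.
  rewrite ltNge; apply/negP => rk.
  have e : nu (phi * c) = nu r.
    have -> : phi * c = - r + a by rewrite aE addrC addrK.
    by rewrite val_addl val_opp // -rE (le_lt_trans rk).
  rewrite e -rE in mlt.
  have := lt_le_trans mlt rk; rewrite -mak.
  by rewrite [in X in _ < X -> _]aE val_addl // ltxx.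
have : mu (phi * c) = fin k.
  have -> : phi * c = a - r by rewrite aE addrK.
  by rewrite val_addl ?mak // val_opp.
rewrite val_mul phig => /ext_add_fin[x [y [[xg] cy xy]]].
exists c; split; last by rewrite aE addrAC subrr add0r.
by rewrite cy -xy -xg addrAC subrr add0r.
Qed.

(** Primeness is inherited from the graded algebra of [nu], a domain: a product whose value
    increases from [mu] to [nu] has a factor whose value does. *)
Lemma gap_key_polynomial : key_polynomial mu phi.
Proof.
case: (gap) => mon lt eq.
split=> //.
- move=> f f0 szf If; have [k fk] := ext_lt_fin (gap_support lt f0).
  have /(initial_dvdP phig fk) : principal_ideal (initial mu phi) (initial mu f) by [].
  by rewrite gap_initial_dvd ?fk // -eq // fk ltxx.
- exact: initial_neq0 phig.
split=> [|A B].
  rewrite -(initial1 mu) => /(initial_dvdP phig (val_one mu)).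
  by rewrite gap_initial_dvd val_one // ltxx.
apply: (principal_initial_prime phig) => k h a b ka hb.
rewrite !gap_initial_dvd //; last by rewrite val_mul fin_add; apply: ext_leD.
rewrite val_mul => lt'; have [|ak] := ltP (fin k) (nu a); first by left.
right; rewrite ltNge; apply/negP => bh; move: lt'.
by rewrite ltNge fin_add ext_leD.
Qed.
End Gap.

Lemma gap_key phi : minimal_gap phi -> key_polynomial mu phi.
Proof. by move=> gap; have [_ /ext_lt_fin[g phig] _] := gap; apply: gap_key_polynomial phig. Qed.

End MinimalGap.

(* The relation on the right does not involve [nu]. *)
Lemma minimal_gap_ltP (K : fieldType) (G : oagType) (mu nu : valuation {poly K} G)
    (phi f : {poly K}) g :
  (forall f, mu f <= nu f) -> minimal_gap mu nu phi -> mu phi = fin g ->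
  mu f < nu f <-> exists k, mu f = fin k /\ initial_dvd mu phi g k f.
Proof.
move=> le gap phig; split=> [lt|[k [fk]]].
  have [k fk] := ext_lt_fin lt; exists k; split=> //.
  by apply/(gap_initial_dvd le gap phig); rewrite -?fk.
by move/(gap_initial_dvd le gap phig); rewrite fk; apply.
Qed.

(** The initial forms of [a] and [b] are inverse to each other, so the ideal of [a] contains 1. *)
Lemma unit_not_key (K : fieldType) (G : oagType) (mu : valuation {poly K} G) (a b : {poly K}) :
  fin 0 < mu (a * b - 1) -> ~ key_polynomial mu a.
Proof.
move=> ab [_ _ _ [n1 _]]; apply: n1.
have : mu (a * b) = fin 0.
  by rewrite -[a * b](subrK 1) addrC val_addl val_one.
rewrite val_mul => /ext_add_fin[g [h [ag bh gh]]].
rewrite -(initial1 mu); apply/(initial_dvdP ag (val_one mu)).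
exists b; split; last by rewrite -val_opp opprB.
by rewrite bh sub0r -(addr0 (- g)) -gh addKr.
Qed.

(* Polynomials of degree smaller than [deg phi] are prime to [phi], so their initial forms are units. *)
Lemma augmented_key_size (K : fieldType) (G : oagType) (nu : valuation {poly K} G)
    (phi a : {poly K}) :
  phi != 0 ->
  (forall s : seq {poly K}, (forall f : {poly K}, f \in s -> (size f < size phi)%N) ->
    exists rho : valuation {poly K} G,
      (forall f : {poly K}, f \in s -> rho f = nu f) /\ rho phi < nu phi) ->
  a != 0 -> key_polynomial nu a -> (size phi <= size a)%N.
Proof.
move=> phi0 approx a0; apply: contraPT; rewrite -ltnNge => szs.
have cop : coprimep a phi.
  rewrite coprimep_def eqn_leq size_poly_gt0 gcdp_eq0 negb_and a0 andbT leqNgt.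
  apply/negP => szd; have [e phie] : exists e, phi = e * gcdp a phi.
    by have /dvdpP := dvdp_gcdr a phi.
  have e0 : e != 0 by apply: contraNneq phi0 => e0; rewrite phie e0 mul0r.
  have d0 : gcdp a phi != 0 by rewrite gcdp_eq0 negb_and a0.
  (* A proper factorisation of [phi] would make [rho] and [nu] agree on [phi]. *)
  have [|rho [eq]] := approx [:: e; gcdp a phi].
    move=> f; rewrite !inE => /orP[] /eqP ->.
      rewrite [in X in (_ < X)%N]phie size_mul //.
      by move: szd; case: (size (gcdp a phi)) => [|[|y]] // _; rewrite !addnS /= ltnS leq_addr.
    exact: leq_ltn_trans (leq_gcdpl _ a0) szs.
  by rewrite phie !val_mul !eq ?inE ?eqxx ?orbT // ltxx.
have /Bezout_coprimepP[[u v] /= /eqpP[[c1 c2] /= /andP[c10 c20] e1]] := cop.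
(* [b] is the inverse of [a] modulo [phi]; then [a * b = 1 - c * phi], with [a], [b] and [c] all of
   smaller degree than [phi]. *)
pose b := (c2^-1 * c1) *: u %% phi; pose c := (1 - a * b) %/ phi.
have ab : a * b = 1 - c * phi.
  have dv : phi %| 1 - a * b.
    have -> : 1 - a * b = (c2^-1 * c1) *: v * phi + a * ((c2^-1 * c1) *: u %/ phi) * phi.
      have -> : 1 = (c2^-1 * c1) *: (u * a + v * phi).
        by rewrite -scalerA e1 scalerA mulVf // scale1r.
      rewrite scalerDr scalerAl scalerAl [(c2^-1 * c1) *: u in LHS](divp_eq _ phi) -/b.
      by ring.
    by rewrite dvdp_add // dvdp_mull.
  by rewrite /c divpK // opprB addrC subrK.
have szb : (size b < size phi)%N by rewrite ltn_modp.
have szc : (size c < size phi)%N.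
  have [->|c0] := eqVneq c 0; first by rewrite size_poly0 size_poly_gt0.
  have arith (x y z p m : nat) : (x < p -> y < p -> 0 < x -> m <= (x + y).-1 ->
    (z + p).-1 <= maxn 1 m -> z < p)%N by lia.
  apply: (arith _ _ _ _ (size (a * b)) szs szb); rewrite ?size_poly_gt0 ?size_polyMleq //.
  have cE : c * phi = 1 - a * b by rewrite ab opprB addrC subrK.
  rewrite -size_mul // cE; apply: leq_trans (size_polyD _ _) _.
  by rewrite size_polyN size_poly1.
have [|rho [eq lt]] := approx [:: a; b; c].
  by move=> f; rewrite !inE => /or3P[] /eqP ->.
(* If [nu (c * phi) <= 0], then [rho (a * b) = rho (c * phi) < nu (c * phi) <= nu (a * b)], although
   [rho] and [nu] agree on [a * b]. *)
apply: (@unit_not_key _ _ nu a b); rewrite ab addrAC subrr add0r val_opp ltNge.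
apply/negP => le0.
have cfin : rho c < infty.
  have [x] := ext_le_fin le0; rewrite val_mul => /ext_add_fin[y [z [cy _ _]]].
  by rewrite eq ?inE ?eqxx ?orbT // cy ext_lt_infty.
have lt1 : rho (c * phi) < nu (c * phi).
  by rewrite !val_mul; apply: ext_leltD => //; rewrite eq ?inE ?eqxx ?orbT.
have abeq : rho (a * b) = nu (a * b).
  by rewrite !val_mul !eq ?inE ?eqxx ?orbT.
have : nu (c * phi) <= nu (a * b).
  by rewrite ab val_leD ?val_opp // val_one.
by rewrite -abeq ab addrC val_addl val_opp ?val_one ?(lt_le_trans lt1) // leNgt lt1.
Qed.

(** * Augmentations *)

Lemma size_monic_sub (R : nzRingType) (f g : {poly R}) : f \is monic -> g \is monic ->
  size f = size g -> (size (f - g)%R < size f)%N.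
Proof.
move=> monf mong sz; have f0 : (0 < size f)%N by rewrite size_poly_gt0 monic_neq0.
rewrite -(ltn_predK f0) ltnS; apply/leq_sizeP => j; rewrite leq_eqVlt coefB.
case/orP => [/eqP <-|].
  by have := monicP monf; have := monicP mong; rewrite !lead_coefE sz => -> ->; rewrite subrr.
rewrite (ltn_predK f0) => fj.
by rewrite !nth_default ?subrr // -?sz.
Qed.

Lemma bigmin1 (G : oagType) (F : nat -> extg G) : \big[Order.min/infty]_(n < 1) F n = F 0%N.
Proof. by rewrite big_ord_recl big_ord0; apply/min_idPl; apply: ext_lex_infty. Qed.

Section Augmentations.
Variables (K : fieldType) (G : oagType) (v : valuation K G).
Local Notation polyval := (valuation {poly K} G).
Implicit Types (mu nu rho eta : polyval) (f g a phi psi : {poly K}) (gamma : extg G).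

(** Finite lists suit limit augmentations, where the index from which a smaller polynomial has its
    stable value depends on the polynomial. *)
Definition approximated nu phi : Prop :=
  forall s : seq {poly K}, (forall f : {poly K}, f \in s -> (size f < size phi)%N) ->
    exists rho : polyval, (forall f : {poly K}, f \in s -> rho f = nu f) /\ rho phi < nu phi.

Lemma approximated_eq nu nu' phi : nu =1 nu' -> approximated nu phi -> approximated nu' phi.
Proof.
move=> e h s hs; have [rho [eq lt]] := h s hs; exists rho.
by split=> [f fs|]; rewrite -e // eq.
Qed.

Definition key_degree_ge nu (d : nat) : Prop :=
  forall a, a != 0 -> key_polynomial nu a -> (d <= size a)%N.

Lemma approximated_key_degree nu phi : phi != 0 -> approximated nu phi ->
  key_degree_ge nu (size phi).
Proof. by move=> phi0 app a; apply: augmented_key_size. Qed.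

Lemma key_degree_ge2 nu : key_degree_ge nu 2.
Proof.
move=> a a0; apply: contraPT; rewrite -ltnNge => sza.
have [c aE] : exists c, a = c%:P by exists a`_0; apply: size1_polyC.
rewrite aE polyC_eq0 in a0 *; apply: (@unit_not_key _ _ _ _ c^-1%:P).
by rewrite -polyCM divff // subrr val_zero ext_lt_infty.
Qed.

(** * Increasing families of constant degree and their limit augmentations *)

Section Family.
Variables (d : Order.disp_t) (I : orderType d) (rho : I -> polyval) (e : nat).
Hypotheses (rho_lt : forall i j, (i < j)%O -> val_lt (rho i) (rho j))
           (rho_deg : forall i, val_degree (rho i) e).

Lemma family_le i j f : (i <= j)%O -> rho i f <= rho j f.
Proof. by rewrite le_eqVlt => /orP[/eqP -> //|/rho_lt[le _]]; apply: le. Qed.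

(** A minimal gap is a key polynomial for [rho i], so its degree is at least [e]. Conversely,
    [rho i] agrees with [rho j] below that degree, so the key polynomials of [rho j], one of which
    has degree [e], cannot be smaller. *)
Lemma family_gap i j : (i < j)%O ->
  exists f, minimal_gap (rho i) (rho j) f /\ size f = e.+1.
Proof.
move=> ij; have [le [f /eqP ne]] := rho_lt ij.
have lt : rho i f < rho j f by rewrite lt_def eq_sym ne; apply: le.
have [phi gap] := ex_minimal_gap le lt; exists phi; split=> //.
apply/eqP; rewrite eqn_leq andbC; apply/andP; split.
  by have [_ min] := rho_deg i; apply: min; apply: gap_key le _ gap.
have [[Q [keyQ <-]] _] := rho_deg j; have [monQ _ _ _] := keyQ.
have [mon lt' eq] := gap; apply: augmented_key_size keyQ; rewrite ?monic_neq0 //.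
by move=> s hs; exists (rho i); split=> // h /hs /eq.
Qed.

Lemma family_low i j f : (size f <= e)%N -> rho i f = rho j f.
Proof.
move=> szf; wlog ij : i j / (i < j)%O => [wl|].
  by case: (ltgtP i j) => [/wl//|/wl //|-> //].
by have [phi [[_ _ eq] szphi]] := family_gap ij; apply: eq; rewrite szphi.
Qed.

(** By [minimal_gap_ltP], whether the value of [f] increases after [i] depends on divisibility by a
    single initial form over [rho i]: the same polynomial is a minimal gap towards [j] and towards
    every later index. *)
Lemma family_stable i j f : (i < j)%O -> rho i f = rho j f ->
  forall k, (i <= k)%O -> rho k f = rho i f.
Proof.
move=> ij fij k; rewrite le_eqVlt => /orP[/eqP -> //|ik].
have [kj|jk] := leP k j.
  by apply: le_anti; rewrite (family_le f (ltW ik)) fij family_le.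
have [phi [gap szphi]] := family_gap ij; have [mon lt eq] := gap.
have gapk : minimal_gap (rho i) (rho k) phi.
  split=> //; first exact: lt_le_trans lt (family_le _ (ltW jk)).
  by move=> h szh; apply: family_low; rewrite -ltnS -szphi.
have [g phig] := ext_lt_fin lt.
apply/eqP; apply: contraT => ne.
have lt' : rho i f < rho k f by rewrite lt_def ne family_le // ltW.
have := (minimal_gap_ltP _ (fun h => family_le h (ltW ik)) gapk phig).1 lt'.
move/(minimal_gap_ltP _ (fun h => family_le h (ltW ij)) gap phig).2.
by rewrite fij ltxx.
Qed.

Lemma not_unstable_stable f : ~ unstable rho f ->
  exists i j, [/\ (i < j)%O, rho i f = rho j f & forall k, (i <= k)%O -> rho k f = rho i f].
Proof.
move=> nu; apply: NNPP => nex; apply: nu => i j ij.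
rewrite lt_def family_le ?(ltW ij) // andbT; apply/eqP => /esym fij; apply: nex.
by exists i, j; split=> //; apply: family_stable fij.
Qed.

Section Limit.
Variables (i0 : I) (phi : {poly K}) (gamma : extg G) (nu : polyval).
Hypotheses (aug : limit_augmentation rho phi gamma nu) (szphi : (1 < size phi)%N).

Lemma limit_stable_value f c : (size f < size phi)%N -> stable_value rho f c ->
  nu f = c.
Proof.
move=> szf fc; have [_ _ form] := aug.
have := form [:: f] (fun _ => c); rewrite big_ord1 expr0 mulr1 => ->.
  by rewrite (bigmin1 (fun n => c + gamma *+ n)) mulr0n addr0.
by case.
Qed.

Lemma limit_value : nu phi = gamma.
Proof.
have [_ _ form] := aug.
have := form [:: 0; 1] (fun n => if n is 0 then infty else fin 0).
rewrite !big_ord_recl !big_ord0 /= mul0r add0r addr0 mul1r expr1 => ->; last first.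
  case=> [|[|//]] _; rewrite ?size_poly0 ?size_poly1; split=> //; last first.
  - by exists i0 => k _; rewrite val_one.
  - by exists i0 => k _; rewrite val_zero.
  - exact: ltnW.
have -> : fin 0 + gamma *+ bump 0 0 = gamma by rewrite fin0E add0r mulr1n.
case: gamma => [a|] //=; rewrite mulr0n addr0; apply: le_anti;
  by rewrite ?ge_min ?le_min ?lexx ?ext_lex_infty ?orbT.
Qed.

Lemma limit_small_stable f : (size f < size phi)%N ->
  exists i, forall k, (i <= k)%O -> rho k f = nu f.
Proof.
move=> szf; have [[mon _ min] _ _] := aug.
suff [c [i ic]] : exists c, stable_value rho f c.
  by exists i => k ik; rewrite ic // (@limit_stable_value f c) //; exists i.
have [->|f0] := eqVneq f 0.
  by exists infty; exists i0 => k _; rewrite val_zero.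
have [|i [j [_ _ st]]] := @not_unstable_stable f; last by exists (rho i f), i.
move=> unst; suff : (size phi <= size f)%N by rewrite leqNgt szf.
(* Limit key polynomials are minimal among monic unstable polynomials; rescaling preserves
   instability because constants have the same value throughout the family. *)
have lc0 : (lead_coef f)^-1 != 0 by rewrite invr_eq0 lead_coef_eq0.
rewrite -(size_scale f lc0); apply: min.
  by rewrite monicE lead_coefZ mulVf ?lead_coef_eq0.
move=> i j ij; rewrite -mul_polyC !val_mul.
have [x xE] := val_const_fin (rho i) lc0.
by rewrite -(val_le_const (rho_lt ij).1) xE ext_ltD2l unst.
Qed.

Lemma limit_approximated : approximated nu phi.
Proof.
move=> s hs.
suff [i si] : exists i, forall k, (i <= k)%O -> forall f, f \in s -> rho k f = nu f.
  exists (rho i); split; first by apply: si.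
  by rewrite limit_value; have [_ ->] := aug.
elim: s hs => [|f s IH] hs; first by exists i0.
have [i hi] := limit_small_stable (hs f (mem_head _ _)).
have [|j hj] := IH; first by move=> g gs; apply: hs; rewrite inE gs orbT.
exists (Order.max i j) => k; rewrite ge_max => /andP[ik jk] g.
by rewrite inE => /orP[/eqP ->|/(hj _ jk)//]; apply: hi.
Qed.

Lemma limit_ge f i : (size f < size phi)%N -> rho i f <= nu f.
Proof.
move=> /limit_small_stable[j st]; have [ij|ji] := leP i j.
  by rewrite -(st j) // family_le.
by rewrite -(st i) // ltW.
Qed.

Lemma limit_low f i : (size f < size phi)%N -> (size f <= e)%N -> nu f = rho i f.
Proof.
move=> szf fe; have [j st] := limit_small_stable szf.
by rewrite -(st j) //; apply: family_low.
Qed.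

(* A maximal [g] would be unstable, while its degree is less than that of the limit key polynomial. *)
Lemma limit_no_maximum g : g \is monic -> size g = e.+1 -> (size g < size phi)%N ->
  exists f, [/\ f \is monic, size f = e.+1 & nu g < nu f].
Proof.
move=> mong szg ltg; have [[_ _ min] _ _] := aug.
have [unst|i [j [ij gij st]]] := @not_unstable_stable g.
  by have := min _ mong unst; rewrite leqNgt ltg.
have [f [[monf lt eq] szf]] := family_gap ij; exists f; split=> //.
have [k stk] := limit_small_stable ltg.
have -> : nu g = rho i g.
  have := stk (Order.max i k); rewrite le_max lexx orbT => <- //.
  by apply: st; rewrite le_max lexx.
suff le : rho i g <= rho i f.
  by apply: le_lt_trans le (lt_le_trans lt _); apply: limit_ge; rewrite szf -szg.
(* Otherwise the value of [f - g] would increase from [i] to [j], as that of [f] does while [g] has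
   a larger, stable one; but [f - g] has degree less than [e]. *)
rewrite leNgt; apply/negP => fg.
have szd : (size (f - g)%R <= e)%N.
  by rewrite -ltnS -szf; apply: size_monic_sub; rewrite ?szf.
have := family_low i j szd; rewrite val_addl ?val_opp // => e1.
have [x fx] := ext_lt_fin lt.
suff : fin x < rho j (f - g) by rewrite -e1 fx ltxx.
by apply: val_ltD; rewrite ?val_opp -fx // -gij.
Qed.

End Limit.
End Family.

Lemma ordinary_small mu phi gamma nu f : ordinary_augmentation mu phi gamma nu ->
  (size f < size phi)%N -> nu f = mu f.
Proof.
move=> [_ _ form] szf; have := form [:: f]; rewrite big_ord1 expr0 mulr1 => ->.
  by rewrite (bigmin1 (fun n => mu [:: f]`_n + gamma *+ n)) mulr0n addr0.
by case.
Qed.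

Lemma ordinary_value mu phi gamma nu : ordinary_augmentation mu phi gamma nu ->
  (1 < size phi)%N -> nu phi = gamma.
Proof.
move=> [_ _ form] szphi; have := form [:: 0; 1].
rewrite !big_ord_recl !big_ord0 /= mul0r add0r addr0 mul1r expr1 => ->; last first.
  by case=> [|[|//]] _; rewrite ?size_poly0 ?size_poly1 // ltnW.
rewrite val_zero val_one; have -> : fin 0 + gamma *+ bump 0 0 = gamma by rewrite fin0E add0r mulr1n.
clear form; case: gamma => [a|] //=; rewrite mulr0n addr0; apply: le_anti;
  by rewrite ?ge_min ?le_min ?lexx ?ext_lex_infty ?orbT.
Qed.

Lemma ordinary_approximated mu phi gamma nu : ordinary_augmentation mu phi gamma nu ->
  (1 < size phi)%N -> approximated nu phi.
Proof.
move=> aug szphi s hs; exists mu; split=> [f /hs szf|].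
  by rewrite (ordinary_small aug).
by rewrite (ordinary_value aug) //; case: aug.
Qed.

Definition augmentation_step mu phi gamma nu : Prop :=
  ordinary_augmentation mu phi gamma nu \/ limit_step v mu phi gamma nu.

Lemma step_approximated mu phi gamma nu : augmentation_step mu phi gamma nu ->
  (1 < size phi)%N -> approximated nu phi.
Proof.
move=> [aug|[d [I [rho [[_ _ _ lt [e deg]] [i0 _] aug]]]]] szphi.
  exact: ordinary_approximated aug szphi.
exact (@limit_approximated _ _ rho e lt deg i0 _ _ _ aug szphi).
Qed.

(** In a limit step the first member of the family has a key polynomial of size [e.+1], so
    [d <= e.+1] and [f] lies below the common degree [e], where all members agree. *)
Lemma step_low mu phi gamma nu d f : augmentation_step mu phi gamma nu ->
  (forall rho, rho =1 mu -> key_degree_ge rho d) ->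
  (1 < size phi)%N -> (size f < d)%N -> (size f < size phi)%N -> nu f = mu f.
Proof.
move=> [aug|[dI [I [rho [[_ _ _ lt [e deg]] [i0 [_ mu0]] aug]]]]] low szphi szd szf.
  exact: ordinary_small aug szf.
have [[Q [keyQ szQ]] _] := deg i0; have [monQ _ _ _] := keyQ.
have := low _ mu0 Q (monic_neq0 monQ) keyQ; rewrite szQ => de.
rewrite -mu0; apply: (limit_low lt deg i0 aug) => //.
by rewrite -ltnS; apply: leq_trans de.
Qed.

(** [eta] and [psi] serve to locate the degree of the family: a minimal gap from [mu] to [eta] is a
    key polynomial of degree at most that of [psi], and the bound on key degrees gives the other
    inequality. Then [limit_no_maximum] applies in that degree. *)
Lemma limit_step_no_maximum mu phi gamma nu eta psi g : limit_step v mu phi gamma nu ->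
  (forall rho, rho =1 mu -> key_degree_ge rho (size psi)) ->
  (forall f, mu f <= eta f) -> mu psi < eta psi ->
  (1 < size phi)%N -> g \is monic -> size g = size psi -> (size g < size phi)%N ->
  exists f, [/\ f \is monic, size f = size psi & nu g < nu f].
Proof.
move=> [dI [I [rho [[_ _ _ lt [e deg]] [i0 [_ mu0]] aug]]]] low le ltpsi szphi mong szg ltg.
have [[Q [keyQ szQ]] min] := deg i0; have [monQ _ _ _] := keyQ.
have e1 := low _ mu0 Q (monic_neq0 monQ) keyQ.
have le0 f : rho i0 f <= eta f by rewrite mu0.
rewrite -mu0 in ltpsi; have [f gap] := ex_minimal_gap le0 ltpsi.
have e2 := min _ (gap_key le0 gap).
have /eqP szpsi : size psi == e.+1.
  by rewrite eqn_leq -{1}szQ e1 (leq_trans e2) // (minimal_gap_size gap ltpsi).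
rewrite szpsi in szg *.
exact: (limit_no_maximum lt deg i0 aug mong szg ltg).
Qed.

(** * Key degrees and stable values along a chain *)

Section Chain.
Variables (F : {poly K}) (vF : {poly K} -> extg G) (r : nat).
Variables (phi : nat -> {poly K}) (gamma : nat -> extg G) (mu : nat -> polyval).
Hypothesis chain : MLV_chain v F vF r phi gamma mu.

Lemma chain_size i : (i <= r)%N -> (1 < size (phi i))%N.
Proof.
have [_ [_ sz0 _ _] _ _ grow] := chain.
elim: i => [|i IH] ir; first by rewrite sz0.
by have [lt _] := grow _ ir; apply: leq_trans (IH (ltnW ir)) (ltnW lt).
Qed.

(** Stated up to pointwise equality, because the first valuation of a continuous family is only
    pointwise equal to [mu i]. *)
Lemma chain_key_degree i rho : (i <= r)%N -> rho =1 mu i -> key_degree_ge rho (size (phi i)).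
Proof.
have [_ [_ sz0 _ _] steps _ _] := chain.
case: i => [|i] ir e; first by rewrite sz0; apply: key_degree_ge2.
have sz := chain_size ir; apply: approximated_key_degree.
  by rewrite -size_poly_gt0 ltnW.
have := step_approximated (steps _ ir) sz; apply: approximated_eq.
by move=> x; rewrite e.
Qed.

(** Descending induction from [mu r = vF]: the step from [mu k] to [mu k.+1] does not change the
    values of polynomials smaller than [phi k]. *)
Lemma chain_stable k f : (k <= r)%N -> (size f < size (phi k))%N -> mu k f = vF f.
Proof.
have [_ _ steps [_ _ muF] grow] := chain.
have [n rk] := ubnP (r - k); elim: n => // n IH in k rk *.
rewrite leq_eqVlt => /orP[/eqP -> _|kr szf]; first exact: muF.
have [lt _] := grow _ kr; have szf' := ltn_trans szf lt.
rewrite -(IH k.+1) //; last by lia.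
apply/esym; apply: (step_low (steps _ kr) _ (chain_size kr) szf szf').
by move=> rho; apply: chain_key_degree (ltnW kr).
Qed.

End Chain.
End Augmentations.

(** * Gauss valuations *)

Lemma val_fin_neq0 (E : fieldType) (G : oagType) (w : valuation E G) x :
  x != 0 -> exists a, w x = fin a.
Proof.
move=> x0; apply: ext_finP => e; have := val_one w.
by rewrite -(mulfV x0) val_mul e.
Qed.

Section GaussValuation.
Variables (E : fieldType) (G : oagType) (w : valuation E G).
Implicit Types (c z : E) (d V : G) (f g : {poly E}).

(** The value of the [j]-th term of the Taylor expansion of [f] at [c] when [X - c] is given the
    value [d]. *)
Definition gauss_term c d f (j : nat) : extg G :=
  w (f \Po ('X + c%:P))`_j + fin (d *+ j).

Definition gauss c d f : extg G :=
  \big[Order.min/infty]_(j < size (f \Po ('X + c%:P))) gauss_term c d f j.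

Lemma gauss_geP c d f (V : extg G) :
  (forall j, V <= gauss_term c d f j) <-> V <= gauss c d f.
Proof.
split=> [h|h j].
  by rewrite /gauss; elim/big_ind: _ => // [|x y]; rewrite ?ext_lex_infty ?le_min // => -> ->.
apply: le_trans h _; have [jsz|szj] := ltnP j (size (f \Po ('X + c%:P))).
  by rewrite /gauss (bigD1 (Ordinal jsz)) //= ge_min lexx.
by rewrite /gauss_term nth_default // val_zero ext_lex_infty.
Qed.

Lemma gauss_le_term c d f j : gauss c d f <= gauss_term c d f j.
Proof. by move: j; apply/gauss_geP. Qed.

(* By [gauss_at_prod], [k] is the number of roots of [f] in the open ball of centre [c] and radius [d]. *)
Definition gauss_at c d f V (k : nat) : Prop :=
  [/\ forall j, fin V <= gauss_term c d f j, gauss_term c d f k = fin V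
    & forall j, (j < k)%N -> fin V < gauss_term c d f j].

Lemma gauss_atE c d f V k : gauss_at c d f V k -> gauss c d f = fin V.
Proof.
move=> [h1 h2 _]; apply: le_anti; apply/andP; split; last exact/gauss_geP.
by rewrite -h2 gauss_le_term.
Qed.

Lemma gauss0 c d : gauss c d 0 = infty.
Proof.
apply: le_anti; rewrite ext_lex_infty; apply/gauss_geP => j.
by rewrite /gauss_term comp_poly0 coef0 val_zero.
Qed.

Lemma gauss_term0 c d f : gauss_term c d f 0 = w f.[c].
Proof.
rewrite /gauss_term mulr0n fin0E addr0 -horner_coef0 horner_comp.
by rewrite !hornerE.
Qed.

Lemma gauss_le_horner c d f : gauss c d f <= w f.[c].
Proof. by rewrite -(gauss_term0 c d) gauss_le_term. Qed.

Lemma gaussD c d f g : Order.min (gauss c d f) (gauss c d g) <= gauss c d (f + g).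
Proof.
apply/gauss_geP => j; rewrite /gauss_term comp_polyD coefD ext_leDr_sub.
apply: val_leD; rewrite -ext_leDr_sub ge_min; apply/orP.
  by left; apply: gauss_le_term.
by right; apply: gauss_le_term.
Qed.

Lemma gaussN c d f : gauss c d (- f) = gauss c d f.
Proof.
rewrite /gauss /gauss_term !raddfN /= size_polyN.
by apply: eq_bigr => j _; rewrite coefN val_opp.
Qed.

Lemma gaussDl c d f g : gauss c d f < gauss c d g -> gauss c d (f + g) = gauss c d f.
Proof.
move=> fg; have le : gauss c d f <= gauss c d (f + g).
  by apply: le_trans (gaussD c d f g); rewrite le_min lexx ltW.
apply: le_anti; rewrite le andbT leNgt; apply/negP => lt.
suff : gauss c d f < gauss c d (f + g - g) by rewrite addrK ltxx.
by apply: lt_le_trans (gaussD c d (f + g) (- g)); rewrite lt_min lt gaussN.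
Qed.

(** In the Cauchy product, every pair of indices of sum [k + k'] other than [(k, k')] has an entry
    before the first minimal index of its factor, so the minimal term is not cancelled; for smaller
    sums all pairs have such an entry. *)
Lemma gauss_at_mul c d f g V V' k k' :
  gauss_at c d f V k -> gauss_at c d g V' k' ->
  gauss_at c d (f * g) (V + V') (k + k').
Proof.
move=> [f1 f2 f3] [g1 g2 g3].
have termE n (i : 'I_n.+1) :
    w ((f \Po ('X + c%:P))`_i * (g \Po ('X + c%:P))`_(n - i)) + fin (d *+ n) =
    gauss_term c d f i + gauss_term c d g (n - i).
  rewrite val_mul /gauss_term addrACA -fin_add -mulrnDr subnKC //.
  by rewrite -ltnS.
have lt n (i : 'I_n.+1) : ((i < k) || (n - i < k'))%N ->
    fin (V + V') < gauss_term c d f i + gauss_term c d g (n - i).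
  case/orP => h; last exact: ext_ltD (f1 _) (g3 _ h).
  by rewrite addrC [X in _ < X]addrC; apply: ext_ltD (g1 _) (f3 _ h).
split=> [j||j jk].
- rewrite /gauss_term comp_polyM coefM ext_leDr_sub; apply: val_le_sum => i.
  by rewrite -ext_leDr_sub termE fin_add; apply: ext_leD.
- have kk : (k < (k + k').+1)%N by rewrite ltnS leq_addr.
  rewrite /gauss_term comp_polyM coefM (bigD1 (Ordinal kk)) //=.
  have main := termE _ (Ordinal kk); rewrite /= addKn f2 g2 -fin_add in main.
  rewrite addKn; rewrite -main; congr (_ + _); apply: val_addl.
  have -> : w ((f \Po ('X + c%:P))`_k * (g \Po ('X + c%:P))`_k') =
      fin (V + V') + fin (- (d *+ (k + k'))).
    by rewrite -main -addrA -fin_add subrr fin0E addr0.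
  rewrite -fin_add; elim/big_ind: _ => [|x y|i ik]; rewrite ?val_zero ?ext_lt_infty //.
    exact: val_ltD.
  rewrite fin_add -ext_ltDr_sub termE; apply: lt.
  have := ltn_ord i; move: ik; rewrite -val_eqE /=; clear; lia.
rewrite /gauss_term comp_polyM coefM ext_ltDr_sub -fin_add; apply: val_lt_sum => i.
rewrite fin_add -ext_ltDr_sub termE; apply: lt.
have := ltn_ord i; move: jk; clear; lia.
Qed.

Lemma gauss_at_index c d f V V' k k' :
  gauss_at c d f V k -> gauss_at c d f V' k' -> k = k'.
Proof.
move=> h h'; have [e] : fin V = fin V' by rewrite -(gauss_atE h) (gauss_atE h').
case: h h' => [_ h1 h2] [_ h1' h2'].
case: (ltngtP k k') => // lt; first by move: (h2' _ lt); rewrite h1 e ltxx.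
by move: (h2 _ lt); rewrite h1' e ltxx.
Qed.

Lemma gauss_atC c d (a : E) V : w a = fin V -> gauss_at c d a%:P V 0.
Proof.
move=> aV; have t0 : gauss_term c d a%:P 0 = fin V.
  by rewrite /gauss_term comp_polyC coefC aV mulr0n fin0E addr0.
split=> // -[|j] //; first by rewrite t0.
by rewrite /gauss_term comp_polyC coefC val_zero ext_lex_infty.
Qed.

Lemma comp_XsubC c z : ('X - z%:P) \Po ('X + c%:P) = 'X + (c - z)%:P.
Proof. by rewrite comp_polyB comp_polyX comp_polyC polyCB addrA. Qed.

Lemma gauss_term_XsubC c d z j : gauss_term c d ('X - z%:P) j =
  if j is j'.+1 then if j' is 0 then fin d else infty else w (c - z).
Proof.
rewrite /gauss_term comp_XsubC coefD coefX coefC.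
case: j => [|[|j]]; rewrite ?add0r ?addr0 ?mulr0n ?fin0E ?addr0 //.
  by rewrite val_one fin0E add0r mulr1n.
by rewrite val_zero.
Qed.

Lemma gauss_at_XsubC c d z :
  exists V, gauss_at c d ('X - z%:P) V (fin d < w (c - z))%R.
Proof.
have [dz|zd] := ltP (fin d) (w (c - z)).
  exists d; split=> [[|[|j]]||[|j]] //=; rewrite ?gauss_term_XsubC ?ext_lex_infty //.
  exact: ltW.
have [V zV] := ext_le_fin zd; rewrite zV in zd; exists V.
by split=> [[|[|j]]||[|j]] //=; rewrite ?gauss_term_XsubC ?ext_lex_infty // zV.
Qed.

Definition nroots c d (rs : seq E) := count (fun z => fin d < w (c - z)) rs.

Lemma gauss_at_prod c d a (rs : seq E) : a != 0 ->
  exists V, gauss_at c d (a *: \prod_(z <- rs) ('X - z%:P)) V (nroots c d rs).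
Proof.
move=> a0; rewrite -mul_polyC; elim: rs => [|z rs [V IH]].
  rewrite big_nil mulr1; have [V aV] := val_fin_neq0 w a0.
  by exists V; apply: gauss_atC.
have [V' zV] := gauss_at_XsubC c d z.
by exists (V' + V); rewrite big_cons mulrCA; apply: gauss_at_mul.
Qed.

Lemma gauss_XsubC c d z : gauss c d ('X - z%:P) = Order.min (fin d) (w (c - z)).
Proof.
apply: le_anti; apply/andP; split; last first.
  apply/gauss_geP => j; rewrite gauss_term_XsubC ge_min.
  by case: j => [|[|j]]; rewrite ?lexx ?orbT ?ext_lex_infty.
rewrite le_min; apply/andP; split.
  by have := gauss_le_term c d ('X - z%:P) 1; rewrite gauss_term_XsubC.
by have := gauss_le_term c d ('X - z%:P) 0; rewrite gauss_term_XsubC.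
Qed.

Lemma gaussC c d a : gauss c d a%:P = w a.
Proof.
have [->|a0] := eqVneq a 0; first by rewrite polyC0 gauss0 val_zero.
by have [V aV] := val_fin_neq0 w a0; rewrite aV; apply: gauss_atE (gauss_atC _ _ aV).
Qed.

(** By [dominant_prod] this holds when no root lies in the closed ball [w (c - z) >= d], whereas
    index 0 in [gauss_at] only excludes roots in the open ball. *)
Definition dominant c d f : Prop :=
  f != 0 /\ forall j, (0 < j)%N -> gauss_term c d f 0 < gauss_term c d f j.

Lemma dominant_at c d f : dominant c d f -> exists V, gauss_at c d f V 0.
Proof.
move=> [f0 dom]; have [V V0] := ext_lt_fin (dom 1%N erefl).
exists V; split=> // j; rewrite -V0.
by case: j => [|j]; rewrite ?lexx // ltW // dom.
Qed.

Lemma dominantM c d f g : dominant c d f -> dominant c d g -> dominant c d (f * g).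
Proof.
move=> df dg; have [f0 domf] := df; have [g0 domg] := dg.
have [V atf] := dominant_at df; have [V' atg] := dominant_at dg.
split; first by rewrite mulf_neq0.
move=> n n0; have [_ -> _] := gauss_at_mul atf atg.
rewrite /gauss_term comp_polyM coefM ext_ltDr_sub -fin_add; apply: val_lt_sum => i.
rewrite fin_add -ext_ltDr_sub val_mul.
have -> : fin (d *+ n) = fin (d *+ i) + fin (d *+ (n - i)).
  by rewrite -fin_add -mulrnDr subnKC // -ltnS.
rewrite addrACA -/(gauss_term c d f i) -/(gauss_term c d g (n - i)).
have [lef ef _] := atf; have [leg eg _] := atg.
have [i0|i0] := posnP i.
  by apply: ext_ltD (lef i) _; rewrite -eg; apply: domg; rewrite i0 subn0.
rewrite [V + V']addrC [X in _ < X]addrC; apply: ext_ltD (leg _) _.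
by rewrite -ef; apply: domf.
Qed.

Lemma dominantC c d a : a != 0 -> dominant c d a%:P.
Proof.
move=> a0; split=> [|[|j] // _]; first by rewrite polyC_eq0.
rewrite gauss_term0 hornerC /gauss_term comp_polyC coefC val_zero.
by have [V ->] := val_fin_neq0 w a0; apply: ext_lt_infty.
Qed.

Lemma dominant_XsubC c d z : w (c - z) < fin d -> dominant c d ('X - z%:P).
Proof.
move=> zd; split=> [|j j0]; first by rewrite polyXsubC_eq0.
rewrite !gauss_term_XsubC; case: j j0 => [|[|j]] // _.
exact: lt_trans zd (ext_lt_infty _).
Qed.

Lemma dominant_prod c d a (rs : seq E) : a != 0 ->
  (forall z, z \in rs -> w (c - z) < fin d) ->
  dominant c d (a *: \prod_(z <- rs) ('X - z%:P)).
Proof.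
move=> a0; rewrite -mul_polyC; elim: rs => [|z rs IH] h.
  by rewrite big_nil mulr1; apply: dominantC.
rewrite big_cons mulrCA; apply: dominantM.
  by apply: dominant_XsubC; apply: h; rewrite mem_head.
by apply: IH => y ys; apply: h; rewrite inE ys orbT.
Qed.

Lemma dominantXn c d f n : dominant c d f -> dominant c d (f ^+ n).
Proof.
move=> df; elim: n => [|n IH]; last by rewrite exprS; apply: dominantM.
by rewrite expr0; apply: dominantC; apply: oner_neq0.
Qed.

End GaussValuation.

Section GaussClosed.
Variables (E : closedFieldType) (G : oagType) (w : valuation E G).
Implicit Types (c z : E) (d V : G) (f g : {poly E}).
Local Notation gauss := (gauss w).

Lemma gauss_atP c d f : f != 0 ->
  exists V (rs : seq E), f = lead_coef f *: \prod_(z <- rs) ('X - z%:P) /\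
    gauss_at w c d f V (nroots w c d rs).
Proof.
move=> f0; have [rs fE] := closed_field_poly_normal f.
have lc0 : lead_coef f != 0 by rewrite lead_coef_eq0.
by have [V h] := gauss_at_prod w c d rs lc0; rewrite -fE in h; exists V, rs.
Qed.

Lemma gaussM c d f g : gauss c d (f * g) = gauss c d f + gauss c d g.
Proof.
have [->|f0] := eqVneq f 0; first by rewrite mul0r !gauss0.
have [->|g0] := eqVneq g 0; first by rewrite mulr0 !gauss0 ext_addy.
have [V [rs [_ h]]] := gauss_atP c d f0; have [V' [rs' [_ h']]] := gauss_atP c d g0.
by rewrite (gauss_atE h) (gauss_atE h') (gauss_atE (gauss_at_mul h h')).
Qed.

Lemma gaussXn c d f n : gauss c d (f ^+ n) = gauss c d f *+ n.
Proof.
elim: n => [|n IH]; last by rewrite exprS gaussM IH mulrS.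
by rewrite expr0 gaussC val_one mulr0n.
Qed.

Lemma gauss_center c c' d f : fin d <= w (c - c') -> gauss c d f = gauss c' d f.
Proof.
move=> cc'; have [rs ->] := closed_field_poly_normal f.
rewrite -mul_polyC !gaussM !gaussC; congr (_ + _).
elim: rs => [|z rs IH]; first by rewrite !big_nil !gaussC.
rewrite !big_cons !gaussM IH; congr (_ + _); rewrite !gauss_XsubC.
wlog le : c c' cc' {IH} / w (c - z) <= w (c' - z) => [wl|].
  case: (leP (w (c - z)) (w (c' - z))) => [/wl ->//|/ltW /wl -> //].
  by rewrite -val_opp opprB.
have [zd|dz] := ltP (w (c - z)) (fin d); last first.
  by rewrite !min_l // (le_trans dz).
have -> : c' - z = (c - z) + - (c - c') by ring.
suff e : w (c - z + - (c - c')) = w (c - z) by rewrite e min_r // ltW.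
by apply: val_addl; rewrite val_opp (lt_le_trans zd).
Qed.

(** This is the formula of an augmentation, for a Gauss valuation. Let [n0] attain the minimum and
    read the Taylor coefficient of order [n0] at [beta]: terms with [n > n0] vanish there to higher
    order, the term [n0] contributes the constant coefficient of a dominant polynomial, of exactly
    the right value, and terms with [n < n0] contribute nonconstant coefficients of dominant
    polynomials, of strictly larger value. *)
Lemma gauss_expansion d (beta : E) psi (s : seq {poly E}) :
  dominant w beta d psi ->
  (forall n, (n < size s)%N -> s`_n = 0 \/ dominant w beta d s`_n) ->
  let phi := ('X - beta%:P) * psi in
  gauss beta d (\sum_(n < size s) s`_n * phi ^+ n) =
  \big[Order.min/infty]_(n < size s) (gauss beta d s`_n + gauss beta d phi *+ n).
Proof.
move=> dpsi doms phi.
have phiE : gauss beta d phi = fin d + gauss beta d psi.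
  rewrite gaussM gauss_XsubC subrr val_zero; congr (_ + _).
have termE n : gauss beta d (s`_n * phi ^+ n) = gauss beta d s`_n + gauss beta d phi *+ n.
  by rewrite gaussM gaussXn.
apply: le_anti; apply/andP; split; last first.
  elim/big_ind2: _ => [|f V g V' fV gV|n _]; first by rewrite gauss0.
    apply: le_trans (gaussD w beta d f g).
    by rewrite le_min !ge_min fV gV orbT.
  by rewrite termE.
case: (posnP (size s)) => [->|s0]; first by rewrite !big_ord0 gauss0.
have [n0 _ minE] := @eq_bigmin _ _ _ infty (Ordinal s0) predT
  (fun n : 'I_(size s) => gauss beta d s`_n + gauss beta d phi *+ n) erefl
  (fun n _ => ext_lex_infty _).
have min_le (n : 'I_(size s)) :
    gauss beta d s`_n0 + gauss beta d phi *+ n0 <= gauss beta d s`_n + gauss beta d phi *+ n.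
  by rewrite -minE (bigD1 n) //= ge_min lexx.
rewrite {}minE; case: (doms n0 (ltn_ord n0)) => [->|domn].
  by rewrite gauss0 ext_lex_infty.
apply: le_trans (gauss_le_term w beta d _ n0) _.
have phi_comp n : phi ^+ n \Po ('X + beta%:P) = (psi ^+ n \Po ('X + beta%:P)) * 'X^n.
  rewrite exprMn comp_polyM mulrC; congr (_ * _).
  by rewrite rmorphXn /= comp_XsubC subrr polyC0 addr0.
have coefE n : ((s`_n * phi ^+ n) \Po ('X + beta%:P))`_n0 =
    if (n0 < n)%N then 0 else ((s`_n * psi ^+ n) \Po ('X + beta%:P))`_(n0 - n).
  by rewrite comp_polyM phi_comp mulrA -comp_polyM coefMXn.
have domE n : dominant w beta d s`_n -> dominant w beta d (s`_n * psi ^+ n).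
  by move=> h; apply: dominantM h (dominantXn n dpsi).
have gE n : gauss beta d s`_n + gauss beta d phi *+ n =
    gauss beta d (s`_n * psi ^+ n) + fin (d *+ n).
  by rewrite gaussM gaussXn phiE mulrnDl fin_mulrn addrA addrAC.
have [V V0] := dominant_at (domE _ domn).
have VE := gauss_atE V0; have [_ V0t _] := V0.
rewrite gE VE -fin_add in min_le *.
have main : w ((s`_n0 * phi ^+ n0) \Po ('X + beta%:P))`_n0 = fin V.
  rewrite coefE ltnn subnn -V0t /gauss_term mulr0n fin0E addr0; by [].
suff e : w ((\sum_(n < size s) s`_n * phi ^+ n) \Po ('X + beta%:P))`_n0 = fin V.
  by rewrite /gauss_term e -fin_add.
rewrite rmorph_sum /= coef_sum (bigD1 n0) //= -[RHS]main; apply: val_addl.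
rewrite main.
elim/big_ind: _ => [|x y|n nn0]; rewrite ?val_zero ?ext_lt_infty //.
  exact: val_ltD.
rewrite coefE; case: (ltngtP n0 n) nn0 => [_ _|nlt _|/val_inj ->]; last by rewrite eqxx.
  by rewrite val_zero ext_lt_infty.
case: (doms n (ltn_ord n)) => [->|domn'].
  by rewrite mul0r comp_poly0 coef0 val_zero ext_lt_infty.
have [V' V'0] := dominant_at (domE _ domn'); have [_ V'0t _] := V'0.
have [_ /(_ (n0 - n)%N)] := domE _ domn'; rewrite subn_gt0 nlt V'0t => /(_ isT).
rewrite /gauss_term ext_ltDr_sub -fin_add; apply: le_lt_trans.
have := min_le n; rewrite gE (gauss_atE V'0) -fin_add !ext_leE => le.
rewrite -(oag_leD2rE (d *+ n0)); apply: le_trans le _; rewrite -addrA.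
have -> : - (d *+ (n0 - n)) + d *+ n0 = d *+ n; last exact: lexx.
by rewrite -{2}(subnK (ltnW nlt)) mulrnDr addKr.
Qed.
End GaussClosed.

(** * Degrees and minimal polynomials *)

Section Degrees.
Variables (F E : fieldType) (iota : {rmorphism F -> E}) (A : E -> Prop).
Hypothesis AP : forall x, A x <-> exists a, x = iota a.
Local Notation "p ^i" := (map_poly iota p) (at level 2, format "p ^i").
Implicit Types (p q g h : {poly F}) (beta : E).

(** By uniqueness of coordinates, the two change-of-basis matrices, pulled back to [F], satisfy
    [M *m N = 1]. *)
Lemma ext_degree_coord (B : E -> Prop) n m (b : 'I_n -> E) (b' : 'I_m -> E) :
  (forall i, B (b i)) -> (forall j, B (b' j)) ->
  (forall x, B x -> exists! c : {ffun 'I_n -> E}, (forall i, A (c i)) /\ x = \sum_i c i * b i) ->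
  (forall x, B x -> exists! c : {ffun 'I_m -> E}, (forall i, A (c i)) /\ x = \sum_i c i * b' i) ->
  (n <= m)%N.
Proof.
move=> Bb Bb' hb hb'.
have ex k (e : 'I_k -> E) x :
    (exists! c : {ffun 'I_k -> E}, (forall i, A (c i)) /\ x = \sum_i c i * e i) ->
    exists c : 'I_k -> F, x = \sum_i iota (c i) * e i.
  move=> [c [[Ac ->] _]].
  have ch i : exists a, c i = iota a by apply/AP.
  exists (fun i => proj1_sig (constructive_indefinite_description _ (ch i))).
  apply: eq_bigr => i _; congr (_ * _).
  exact: (proj2_sig (constructive_indefinite_description _ (ch i))).
have C j : exists c : 'I_n -> F, b' j = \sum_i iota (c i) * b i by apply/ex/hb.
have D i : exists c : 'I_m -> F, b i = \sum_j iota (c j) * b' j by apply/ex/hb'.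
pose M := \matrix_(i < n, j < m) proj1_sig (constructive_indefinite_description _ (D i)) j.
pose N := \matrix_(j < m, i < n) proj1_sig (constructive_indefinite_description _ (C j)) i.
have ME i : b i = \sum_j iota (M i j) * b' j.
  rewrite [LHS](proj2_sig (constructive_indefinite_description _ (D i))).
  by apply: eq_bigr => j _; rewrite mxE.
have NE j : b' j = \sum_i iota (N j i) * b i.
  rewrite [LHS](proj2_sig (constructive_indefinite_description _ (C j))).
  by apply: eq_bigr => i _; rewrite mxE.
apply: (@mulmx1_min _ _ _ M N); apply/matrixP => i k.
have [c [_ uniq]] := hb _ (Bb i).
have /(congr1 (fun f : {ffun 'I_n -> E} => f k)) : [ffun l => iota ((M *m N) i l)] =
    [ffun l => iota ((1%:M : 'M_n) i l)].
  transitivity c; first symmetry; apply: uniq; split=> [l|].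
  - by rewrite ffunE; apply/AP; eexists.
  - rewrite [LHS]ME; under eq_bigr => j _ do rewrite NE mulr_sumr.
    rewrite exchange_big; apply: eq_bigr => l _; rewrite ffunE mxE rmorph_sum mulr_suml.
    by apply: eq_bigr => j _; rewrite rmorphM mulrA.
  - by rewrite ffunE; apply/AP; eexists.
  rewrite (bigD1 i) //= ffunE !mxE eqxx rmorph1 mul1r big1 ?addr0 // => l li.
  by rewrite ffunE mxE eq_sym (negPf li) rmorph0 mul0r.
by rewrite !ffunE => /fmorph_inj.
Qed.

Lemma ext_degree_uniq (B : E -> Prop) n m :
  ext_degree A B n -> ext_degree A B m -> n = m.
Proof.
move=> [b [Bb hb]] [b' [Bb' hb']]; apply/eqP; rewrite eqn_leq.
by rewrite (ext_degree_coord Bb Bb' hb hb') (ext_degree_coord Bb' Bb hb' hb).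
Qed.

Definition minimal_polynomial beta q : Prop :=
  q \is monic /\ forall p, root p^i beta <-> q %| p.

Lemma ex_minimal_polynomial beta p : p != 0 -> root p^i beta ->
  exists q, minimal_polynomial beta q.
Proof.
move=> p0 rp; have [|n [[q [qn q0 rq]] nmin]] :=
  @ex_least (fun n => exists q, [/\ size q = n, q != 0 & root q^i beta]).
  by exists (size p), p.
have lc0 : (lead_coef q)^-1 != 0 by rewrite invr_eq0 lead_coef_eq0.
exists ((lead_coef q)^-1 *: q); split.
  by rewrite monicE lead_coefZ mulVf ?lead_coef_eq0.
move=> g; rewrite dvdpZl //; split=> [rg|/dvdpP[h ->]]; last first.
  by rewrite rmorphM rootM rq orbT.
rewrite /dvdp; apply/negPn/negP => m0.
have := nmin (size (g %% q)) (ex_intro _ (g %% q) _).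
rewrite leqNgt -qn ltn_modp q0 /= => H; suff : false by []; apply: H; split=> //.
have : root (g %/ q * q + g %% q)^i beta by rewrite -divp_eq.
by rewrite rmorphD rmorphM /root hornerD hornerM (eqP rq) mulr0 add0r.
Qed.

Section MinimalPolynomial.
Variables (beta : E) (q : {poly F}).
Hypothesis minq : minimal_polynomial beta q.

Lemma minimal_polynomial_root : root q^i beta.
Proof. by apply/minq.2. Qed.

Lemma minimal_polynomial_size_gt1 : (1 < size q)%N.
Proof.
rewrite ltnNge; apply/negP => /size1_polyC qE.
have := minimal_polynomial_root; have := minq.1.
rewrite qE map_polyC /root hornerC /= fmorph_eq0 => /monic_neq0.
by rewrite polyC_eq0 => /negPf ->.
Qed.

Lemma minimal_polynomial_irreducible : irreducible_poly q.
Proof.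
split; first exact: minimal_polynomial_size_gt1.
move=> h h1 hq; have q0 := monic_neq0 minq.1.
have /dvdpP[g qE] := hq.
have h0 : h != 0 by apply: contraNneq q0 => h0; rewrite qE h0 mulr0.
have g0 : g != 0 by apply: contraNneq q0 => g0; rewrite qE g0 mul0r.
have : root q^i beta by apply: minimal_polynomial_root.
rewrite qE rmorphM rootM => /orP[]/(minq.2 _).1; last by rewrite -qE /eqp hq => ->.
move=> /(dvdp_leq g0); rewrite [in (size q <= _)%N]qE size_mul //.
have arith (a b : nat) : (0 < a -> b != 1 -> 0 < b -> (a + b).-1 <= a -> false)%N by lia.
by move/(arith _ _ _ h1); rewrite !size_poly_gt0 => /(_ g0 h0).
Qed.

Lemma minimal_polynomial_ext_degree :
  ext_degree A (fun x => exists g, x = g^i.[beta]) (size q).-1.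
Proof.
have q0 := monic_neq0 minq.1; have qn : (size q).-1.+1 = size q.
  by rewrite prednK // size_poly_gt0.
exists (fun i => beta ^+ i); split=> [i|x [g ->]].
  by exists 'X^i; rewrite map_polyXn hornerXn.
pose r := g %% q; have rg : r^i.[beta] = g^i.[beta].
  rewrite [in RHS](divp_eq g q) rmorphD rmorphM hornerD hornerM.
  by rewrite (eqP minimal_polynomial_root) mulr0 add0r.
have szr : (size r <= (size q).-1)%N by rewrite -ltnS qn ltn_modp.
exists [ffun i : 'I_(size q).-1 => iota r`_i]; split.
  split=> [i|]; first by rewrite ffunE; apply/AP; eexists.
  rewrite -rg (@horner_coef_wide _ (size q).-1) ?size_map_poly //.
  by apply: eq_bigr => i _; rewrite ffunE coef_map.
move=> c [Ac ce]; apply/ffunP => i; rewrite ffunE.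
have ch j : exists a, c j = iota a by apply/AP.
pose a j := proj1_sig (constructive_indefinite_description _ (ch j)).
have aE j : c j = iota (a j) := proj2_sig (constructive_indefinite_description _ (ch j)).
pose p := \sum_(j < (size q).-1) a j *: 'X^j.
have pE (j : 'I_(size q).-1) : p`_j = a j.
  rewrite /p coef_sum (bigD1 j) //= coefZ coefXn eqxx mulr1 big1 ?addr0 // => k kj.
  by rewrite coefZ coefXn eq_sym (inj_eq val_inj) (negPf kj) mulr0.
have szp : (size p <= (size q).-1)%N.
  apply: leq_trans (size_sum _ _ _) _; apply/bigmax_leqP => j _.
  by apply: leq_trans (size_scale_leq _ _) _; rewrite size_polyXn.
have : q %| r - p.
  apply/minq.2; rewrite /root rmorphB hornerD hornerN rg ce.
  rewrite (@horner_coef_wide _ (size q).-1 p^i) ?size_map_poly //.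
  by rewrite subr_eq0; apply/eqP/eq_bigr => j _; rewrite coef_map pE aE.
move=> /dvdp_leq le; have : r - p == 0.
  apply/negPn/negP => /le; rewrite leqNgt -qn ltnS (leq_trans (size_polyD _ _)) //.
  by rewrite size_polyN geq_max szr szp.
by rewrite subr_eq0 => /eqP ->; rewrite pE aE.
Qed.

End MinimalPolynomial.
End Degrees.
Lemma ext_degree_eq (E : fieldType) (A B B' : E -> Prop) n :
  (forall x, B x <-> B' x) -> ext_degree A B n -> ext_degree A B' n.
Proof.
move=> e [b [Bb h]]; exists b; split=> [i|x /e]; first exact/e.
exact: h.
Qed.

Section ElementDegree.
Variables (F E : fieldType) (iota : {rmorphism F -> E}).
Implicit Types (p q g : {poly F}) (beta : E).

Lemma base_fieldP x : base_field iota x <-> exists a, x = iota a.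
Proof. by []. Qed.

Lemma minimal_polynomial_adjoin beta q : minimal_polynomial iota beta q ->
  forall x, adjoin iota beta x <-> exists g, x = (map_poly iota g).[beta].
Proof.
move=> minq x; split=> [[g [h [h0 ->]]]|[g ->]]; last first.
  by exists g, 1; rewrite rmorph1 hornerC oner_neq0 divr1.
have [q1 irr] := minimal_polynomial_irreducible minq.
have cop : coprimep q h.
  rewrite /coprimep; apply/negPn/negP => /irr /(_ (dvdp_gcdl _ _)) /eqp_dvdl e.
  have : q %| h by rewrite -e dvdp_gcdr.
  by move/minq.2; rewrite /root (negPf h0).
have /Bezout_eq1_coprimepP[[u t] /= e] := cop.
exists (g * t); have := congr1 (fun f => (map_poly iota f).[beta]) e.
rewrite /= rmorphD !rmorphM rmorph1 /= !hornerE (eqP (minimal_polynomial_root minq)) mulr0 add0r.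
by move=> th; rewrite -[LHS]mulr1 -th; field.
Qed.

Lemma minimal_polynomial_elt_degree beta q d : minimal_polynomial iota beta q ->
  elt_degree iota beta d <-> size q = d.+1.
Proof.
move=> minq; have := minimal_polynomial_ext_degree base_fieldP minq.
have q0 : (0 < size q)%N by rewrite size_poly_gt0 monic_neq0 // minq.1.
move/(ext_degree_eq (fun x => iff_sym (minimal_polynomial_adjoin minq x))) => deg.
split=> [deg'|sz]; last by rewrite sz in deg.
by rewrite (ext_degree_uniq base_fieldP deg' deg) prednK.
Qed.

Lemma root_elt_degree beta p : p != 0 -> root (map_poly iota p) beta ->
  exists d, elt_degree iota beta d /\ (d < size p)%N.
Proof.
move=> p0 rp; have [q minq] := ex_minimal_polynomial p0 rp.
have q0 : (0 < size q)%N by rewrite size_poly_gt0 monic_neq0 // minq.1.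
exists (size q).-1; split; first by apply/(minimal_polynomial_elt_degree _ minq); rewrite prednK.
by rewrite prednK //; apply: dvdp_leq p0 _; apply/minq.2.
Qed.

Lemma elt_degree_minimal_polynomial beta d : algebraicOver iota beta ->
  elt_degree iota beta d -> exists q, minimal_polynomial iota beta q /\ size q = d.+1.
Proof.
move=> [p p0 rp] deg; have [q minq] := ex_minimal_polynomial p0 rp.
by exists q; split=> //; apply/(minimal_polynomial_elt_degree _ minq).
Qed.

Lemma is_minpoly_minimal beta p : p != 0 ->
  is_minpoly (base_field iota) beta (map_poly iota p) -> minimal_polynomial iota beta p.
Proof.
move=> p0 [mon _ rp min]; have [q minq] := ex_minimal_polynomial p0 rp.
have monp : p \is monic by rewrite map_monic in mon.
have q0 := monic_neq0 minq.1.
have qp : q %| p by apply/minq.2.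
suff -> : p = q by [].
apply/eqP; rewrite -eqp_monic //; last exact: minq.1.
rewrite eqp_sym -dvdp_size_eqp // eqn_leq dvdp_leq //=.
have := min (map_poly iota q); rewrite map_poly_eq0 q0 !size_map_poly.
apply=> // [i|]; last exact: minimal_polynomial_root.
by rewrite coef_map; eexists.
Qed.

End ElementDegree.

(** * Galois conjugates over a Henselian field *)

Section Embedded.
Variables (F E : fieldType) (iota : {rmorphism F -> E}).

(** Gives access to the Galois theory of finite extensions of [F] from within [E], which need not be
    finite over [F]. The extension is built by adjoining one element at a time. *)
Lemma ex_embedded_extension (s : seq E) : (forall x, x \in s -> algebraicOver iota x) ->
  exists (L : fieldExtType F) (j : {rmorphism L -> E}),
    (forall a, j a%:A = iota a) /\ forall x, x \in s -> exists y, j y = x.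
Proof.
elim: s => [|x s IH] alg.
  exists F^o, iota; split=> // a.
  by congr (iota _); rewrite [LHS]mulr1.
have [|L [j [jE js]]] := IH; first by move=> y ys; apply: alg; rewrite inE ys orbT.
have [p p0 rp] := alg x (mem_head _ _).
have [||q minq] := @ex_minimal_polynomial L E j x (map_poly (in_alg L) p).
- by rewrite map_poly_eq0.
- by rewrite -map_poly_comp (eq_map_poly (_ : _ =1 iota)) // => a; apply: jE.
have irr := minimal_polynomial_irreducible minq.
have rq := minimal_polynomial_root minq; have q0 := monic_neq0 minq.1.
pose M := SubFieldExtType rq irr.
pose jM : {rmorphism M -> E} := @subfx_inj _ _ j x q.
exists (baseFieldType M), jM; split=> [a|y].
  by rewrite -jE; apply: (@subfx_inj_base _ _ j x q rq q0).
rewrite inE => /orP[/eqP ->|/js[z <-]].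
  by exists (@subfx_root _ _ j x q); apply: (@subfx_inj_root _ _ j x q rq q0).
by exists (z%:A : M); apply: (@subfx_inj_base _ _ j x q rq q0).
Qed.
Lemma ex_embedded_splitting (p : {poly F}) (rs : seq E) :
  map_poly iota p %= \prod_(z <- rs) ('X - z%:P) ->
  exists (L : splittingFieldType F) (j : {rmorphism L -> E}) (zs : seq L),
    [/\ forall a, j a%:A = iota a, map j zs = rs,
        map_poly (in_alg L) p %= \prod_(z <- zs) ('X - z%:P)
      & <<1 & zs>>%VS = fullv].
Proof.
move=> pE; have p0 : p != 0.
  apply/eqP => p0; move: pE; rewrite p0 rmorph0 eqp_sym eqp0 => /eqP e.
  by have := monic_prod_XsubC rs predT id; rewrite e monicE lead_coef0 eq_sym oner_eq0.
have [|M [j [jE js]]] := @ex_embedded_extension rs.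
  by move=> x xrs; exists p => //; rewrite (eqp_root pE) root_prod_XsubC.
have [ys yE] : exists ys, map j ys = rs.
  elim: rs js {pE} => [|x rs IH] js; first by exists [::].
  have [|ys <-] := IH; first by move=> y yrs; apply: js; rewrite inE yrs orbT.
  by have [y <-] := js x (mem_head _ _); exists (y :: ys).
(* Cut [M] down to the subfield generated by the roots, which is a splitting field of [p]. *)
pose Lp := subvs_of <<1 & ys>>%VS; pose toM := linfun (vsval : Lp -> M).
pose zs : seq Lp := map (vsproj _) ys.
have zE : map vsval zs = ys.
  by rewrite -map_comp map_id_in // => y yy; rewrite /= vsprojK ?seqv_sub_adjoin.
pose jL : {rmorphism Lp -> E} := j \o vsval.
have jLE a : jL a%:A = iota a by rewrite /= algid1 jE.
have jzs : map jL zs = rs by rewrite -yE -[in RHS]zE -[RHS]map_comp.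
have pzs : map_poly (in_alg Lp) p %= \prod_(z <- zs) ('X - z%:P).
  rewrite -(eqp_map jL) -map_poly_comp (eq_map_poly (jLE : _ \o _ =1 _)) //.
  rewrite rmorph_prod /= (eq_bigr (fun z => 'X - (jL z)%:P)).
    by rewrite -(big_map jL predT (fun z => 'X - z%:P)) jzs.
  by move=> z _; rewrite rmorphB /= map_polyX map_polyC.
have gen : <<1 & zs>>%VS = fullv.
  apply/vspaceP=> u; rewrite memvf.
  have : val u \in (toM @: <<1 & zs>>)%VS.
    rewrite aimg_adjoin_seq aimg1 (eq_map (lfunE _)) zE; exact: (valP u).
  by case/memv_imgP=> v zv; rewrite lfunE => /val_inj ->.
have ax : splitting_field_axiom Lp.
  exists (map_poly (in_alg Lp) p); last by exists zs.
  by apply/polyOverP => i; rewrite coef_map memvZ ?mem1v.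
pose L : splittingFieldType F := HB.pack Lp (FieldExt_isSplittingField.Build F Lp ax).
by exists L, jL, zs.
Qed.
End Embedded.
Section PullBack.
Variables (R S : comNzRingType) (G : oagType) (f : {rmorphism R -> S}) (w : valuation S G).

Fact val_comp0 : w (f 0) = infty. Proof. by rewrite rmorph0 val_zero. Qed.
Fact val_comp1 : w (f 1) = fin 0. Proof. by rewrite rmorph1 val_one. Qed.
Fact val_compM x y : w (f (x * y)) = w (f x) + w (f y).
Proof. by rewrite rmorphM val_mul. Qed.
Fact val_compD x y : Order.min (w (f x)) (w (f y)) <= w (f (x + y)).
Proof. by rewrite rmorphD val_add. Qed.

Definition val_comp : valuation R G := Valuation val_comp0 val_comp1 val_compM val_compD.

End PullBack.

(** * The Galois group acts by isometries *)

Section HenselianGalois.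
Variables (K : fieldType) (Kbar : fieldType) (iota : {rmorphism K -> Kbar}).
Variables (G : oagType) (v : valuation K G) (vbar : valuation Kbar G).
Hypotheses (v_henselian : henselian v) (vbar_ext : forall a : K, vbar (iota a) = v a).
Variables (L : splittingFieldType K) (j : {rmorphism L -> Kbar}).
Hypothesis jE : forall a, j a%:A = iota a.
Implicit Types (s : gal_of {:L}) (x y : L).

(** As [s] fixes [K], the pullbacks of [vbar] along [j] and [j \o s] both lie over [v]. Henselianity
    equates their valuation rings; the equality of values still has to be deduced. *)
Lemma galois_vring s y : (fin 0 <= vbar (j (s y))) = (fin 0 <= vbar (j y)).
Proof.
pose js : {rmorphism L -> Kbar} := j \o s.
have alg x : algebraicOver (in_alg L) x.
  have /polyOver1P[p pE] := minPolyOver 1%AS x.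
  exists p; last by rewrite -pE root_minPoly.
  by rewrite -(map_poly_eq0 (in_alg L)) -pE monic_neq0 // monic_minPoly.
apply: (v_henselian alg (w1 := val_comp js vbar) (w2 := val_comp j vbar)) => a /=.
  have -> : s a%:A = a%:A by rewrite linearZ /= rmorph1.
  by rewrite jE vbar_ext.
by rewrite jE vbar_ext.
Qed.

Lemma gal_iter s n x : (s ^+ n)%g x = iter n s x.
Proof.
elim: n => [|n IH]; first by rewrite expg0 gal_id.
by rewrite expgSr galM ?memvf // IH.
Qed.

(* Otherwise the values would strictly decrease along the orbit of [x], which is finite. *)
Lemma galois_val_ge s x : vbar (j x) <= vbar (j (s x)).
Proof.
rewrite leNgt; apply/negP => lt.
have x0 : x != 0.
  by apply: contraTneq lt => ->; rewrite !rmorph0 val_zero ltxx.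
have dec k : vbar (j (iter k.+1 s x)) < vbar (j (iter k s x)).
  have neg : ~~ (fin 0 <= vbar (j (iter k s (s x / x)))).
    suff -> : (fin 0 <= vbar (j (iter k s (s x / x)))) = (fin 0 <= vbar (j (s x / x))).
      rewrite -ltNge; have [b bE] : exists b, vbar (j x) = fin b.
        by apply: val_fin_neq0; rewrite fmorph_eq0.
      rewrite -(ext_ltD2l b) -bE -val_mul -rmorphM mulrC divfK //.
      by rewrite fin0E addr0.
    by elim: k => //= k <-; apply: galois_vring.
  have itM : iter k s (s x / x) = iter k.+1 s x / iter k s x.
    by rewrite iterSr; elim: k {neg} => //= k ->; rewrite rmorphM fmorphV.
  have y0 : iter k s x != 0 by elim: k {neg itM} => //= k; rewrite fmorph_eq0.
  have [b bE] : exists b, vbar (j (iter k s x)) = fin b.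
    by apply: val_fin_neq0; rewrite fmorph_eq0.
  rewrite -ltNge itM -(ext_ltD2l b) -bE -val_mul -rmorphM mulrC divfK // in neg.
  by rewrite fin0E addr0 in neg.
have lt_iter k : vbar (j (iter k.+1 s x)) < vbar (j x).
  by elim: k => [|k IH]; [exact: lt | apply: lt_trans (dec k.+1) IH].
have := lt_iter #[s]%g.-1; rewrite prednK ?order_gt0 // -gal_iter expg_order gal_id.
by rewrite ltxx.
Qed.

Lemma galois_val s x : vbar (j (s x)) = vbar (j x).
Proof.
apply: le_anti; rewrite galois_val_ge andbT.
have := galois_val_ge s^-1%g (s x); rewrite -galM ?memvf // mulgV.
by rewrite gal_id.
Qed.

End HenselianGalois.

(** * Residue fields and the trace of a tame extension *)

Section ResidueTheory.
Variables (E : fieldType) (G : oagType) (w : valuation E G).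
Implicit Types (x y : E) (X Y : vring w).

Local Notation pi X := (\pi_({ideal_quot (vmax (w := w))})%qT X : residue w).

Lemma vring_ge0 X : fin 0 <= w (vring_val X).
Proof. by case: X. Qed.

Lemma resE X : res w (vring_val X) = pi X.
Proof. by rewrite /res; congr (pi _); apply: valKd. Qed.

Lemma vring_valB X Y : vring_val (X - Y) = vring_val X - vring_val Y.
Proof. by []. Qed.

Lemma vring_valM X Y : vring_val (X * Y) = vring_val X * vring_val Y.
Proof. by []. Qed.

Lemma vring_val1 : vring_val (1 : vring w) = 1.
Proof. by []. Qed.

Lemma ex_vring x : fin 0 <= w x -> exists X, vring_val X = x.
Proof. by move=> x0; exists (@VRing _ _ w x x0). Qed.

Lemma residue_eq0 X : (pi X == 0) = (fin 0 < w (vring_val X)).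
Proof.
have -> : 0 = pi 0 by rewrite rmorph0.
by rewrite -Quotient.idealrBE subr0.
Qed.

Lemma ex_residue (y : residue w) : exists X, y = pi X.
Proof. by exists (repr y); rewrite reprK. Qed.

End ResidueTheory.

Notation residue_pi w X := (\pi_({ideal_quot (vmax (w := w))})%qT X : residue w).

Lemma ex_residue_morphism (K Kbar : fieldType) (iota : {rmorphism K -> Kbar})
    (G : oagType) (v : valuation K G) (vbar : valuation Kbar G) :
  (forall a, vbar (iota a) = v a) ->
  exists rho : {rmorphism residue v -> residue vbar},
    forall (X : vring v) (Y : vring vbar), vring_val Y = iota (vring_val X) ->
      rho (residue_pi v X) = residue_pi vbar Y.
Proof.
move=> ext.
pose lift (X : vring v) : vring vbar := insubd 0 (iota (vring_val X)).
have liftE X : vring_val (lift X) = iota (vring_val X).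
  by apply: insubdK; rewrite inE ext vring_ge0.
pose rho (y : residue v) : residue vbar := residue_pi vbar (lift (repr y)).
have rhoE (X : vring v) (Y : vring vbar) : vring_val Y = iota (vring_val X) ->
    rho (residue_pi v X) = residue_pi vbar Y.
  move=> e; apply/eqP; rewrite /rho -Quotient.idealrBE inE.
  have -> : vring_val (lift (repr (residue_pi v X)) - Y) =
      iota (vring_val (repr (residue_pi v X) - X)).
    by rewrite !vring_valB liftE e rmorphB.
  have /eqP : residue_pi v (repr (residue_pi v X)) = residue_pi v X by rewrite reprK.
  by rewrite ext -Quotient.idealrBE.
have rhoB : zmod_morphism rho.
  move=> x y; have [X ->] := ex_residue x; have [Y ->] := ex_residue y.
  have e : vring_val (lift X - lift Y) = iota (vring_val (X - Y)).
    by rewrite !vring_valB !liftE rmorphB.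
  by rewrite -rmorphB (rhoE _ _ e) rmorphB !(rhoE _ _ (liftE _)).
have rhoM : monoid_morphism rho.
  split.
    have e1 : vring_val (1 : vring vbar) = iota (vring_val (1 : vring v)).
      by rewrite !vring_val1 rmorph1.
    by have := rhoE _ _ e1; rewrite !rmorph1.
  move=> x y; have [X ->] := ex_residue x; have [Y ->] := ex_residue y.
  have e : vring_val (lift X * lift Y) = iota (vring_val (X * Y)).
    by rewrite !vring_valM !liftE rmorphM.
  by rewrite -rmorphM (rhoE _ _ e) rmorphM !(rhoE _ _ (liftE _)).
pose rm : {rmorphism residue v -> residue vbar} := HB.pack rho
  (GRing.isZmodMorphism.Build _ _ rho rhoB) (GRing.isMonoidMorphism.Build _ _ rho rhoM).
by exists rm => X Y e; apply: rhoE.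
Qed.
Lemma irreducible_power (F E : fieldType) (rho : {rmorphism F -> E}) (p q : {poly F}) (rs : seq E) :
  p \is monic -> q \is monic -> irreducible_poly q ->
  map_poly rho p = \prod_(z <- rs) ('X - z%:P) ->
  (forall z, z \in rs -> root (map_poly rho q) z) -> exists e, p = q ^+ e.
Proof.
move=> monp monq irr pE qr.
have {pE} : map_poly rho p %| \prod_(z <- rs) ('X - z%:P) by rewrite pE.
have [n] := ubnP (size p); elim: n => // n IH in p monp * => szp pd.
have [szp1|szp1] := leqP (size p) 1.
  exists 0%N; rewrite expr0; apply/eqP.
  by rewrite -[_ == _](eqp_monic monp (monic1 _)) -size_poly_eq1 eqn_leq szp1 size_poly_gt0 monic_neq0.
have [z zp] : exists z, root (map_poly rho p) z.
  have [m mE] := dvdp_prod_XsubC pd.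
  case e : (mask m rs) mE => [|z s] mE.
    by move: (eqp_size mE); rewrite big_nil size_poly1 size_map_poly => e1; rewrite e1 in szp1.
  by exists z; rewrite (eqp_root mE) root_prod_XsubC mem_head.
have zrs : z \in rs.
  by rewrite -root_prod_XsubC; apply: root_dvdp pd zp.
have qp : q %| p.
  have [cop|ncop] := boolP (coprimep q p).
    rewrite -(coprimep_map rho) in cop.
    by have := coprimep_root cop (qr _ zrs); rewrite -/(root _ _) zp.
  by have := irr.2 _ ncop (dvdp_gcdl _ _) => /eqp_dvdl <-; apply: dvdp_gcdr.
have /dvdpP[p' pE] := qp.
have monp' : p' \is monic by rewrite -(monicMr _ monq) -pE.
have [||e p'E] := IH p' monp'.
- have := szp; rewrite ltnS pE size_proper_mul ?(monicP monp') ?(monicP monq) ?mulr1 ?oner_neq0 //.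
  have q1 := irr.1; have p'0 : (0 < size p')%N by rewrite size_poly_gt0 monic_neq0.
  move: q1 p'0; clear.
  have arith (a b m : nat) : (1 < b -> 0 < a -> (a + b).-1 <= m -> a < m)%N by lia.
  exact: arith.
- by apply: dvdp_trans pd; rewrite pE rmorphM dvdp_mulr.
by exists e.+1; rewrite pE p'E exprSr.
Qed.

Section PrimitiveElement.
Variables (F E : fieldType) (rho : {rmorphism F -> E}) (A B : E -> Prop).
Hypotheses (AP : forall x, A x <-> exists a, x = rho a) (AB : forall x, A x -> B x).
Hypotheses (BD : forall x y, B x -> B y -> B (x + y)) (BM : forall x y, B x -> B y -> B (x * y)).

Lemma is_minpoly_pull x p : is_minpoly A x p -> exists2 p0 : {poly F},
  p = map_poly rho p0 & p0 != 0.
Proof.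
move=> [mon Ap _ _].
pose a i := proj1_sig (constructive_indefinite_description _ ((AP _).1 (Ap i))).
have aE i : p`_i = rho (a i) := proj2_sig (constructive_indefinite_description _ ((AP _).1 (Ap i))).
have e : p = map_poly rho (\poly_(i < size p) a i).
  apply/polyP => i; rewrite coef_map coef_poly.
  case: ifP => ip; first exact: aE.
  by rewrite [RHS]rmorph0 nth_default // leqNgt ip.
exists (\poly_(i < size p) a i) => //.
by apply/eqP => e0; move: (monic_neq0 mon); rewrite e e0 rmorph0 eqxx.
Qed.

Lemma horner_closed x (p : {poly E}) : B x -> (forall i, B p`_i) -> B p.[x].
Proof.
move=> Bx; elim/poly_ind: p => [|p c IH] h.
  by rewrite horner0; apply/AB/AP; exists 0; rewrite rmorph0.
rewrite hornerMXaddC; apply: BD.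
  apply: BM => //; apply: IH => i.
  by have := h i.+1; rewrite coefD coefMX coefC /= addr0.
by have := h 0%N; rewrite coefD coefMX coefC /= add0r.
Qed.

(** The fields are mere predicates on [E]. The basis given by the degree consists of separable
    elements, so it is realised in a finite extension [M] of [F]; there a separable generator
    exists, and its image in [E] is [zeta]. *)
Lemma ex_primitive_element f : ext_degree A B f -> separable_ext A B ->
  exists zeta q, [/\ minimal_polynomial rho zeta q, separable_poly q, B zeta & size q = f.+1].
Proof.
move=> deg sep; have [b [Bb span]] := deg.
have sepb i : exists2 p : {poly F}, separable_poly p & root (map_poly rho p) (b i).
  have [p mp sp] := sep _ (Bb i); have [p0 pE _] := is_minpoly_pull mp.
  have [_ _ rp _] := mp.
  by exists p0; rewrite -?pE // -(separable_map rho) -pE.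
have [|M [j [jE js]]] := @ex_embedded_extension F E rho [seq b i | i <- enum 'I_f].
  move=> x /mapP[i _ ->]; have [p sp rp] := sepb i; exists p => //.
  exact: separable_poly_neq0 sp.
have pre i : exists y, j y = b i by apply: js; apply: map_f; rewrite mem_enum.
pose y i := proj1_sig (constructive_indefinite_description _ (pre i)).
have yE i : j (y i) = b i := proj2_sig (constructive_indefinite_description _ (pre i)).
pose ys := [seq y i | i <- enum 'I_f].
have sepE : separable 1 <<1 & ys>>%VS.
  apply: separable_Fadjoin_seq; apply/allP => _ /mapP[i _ ->].
  have [p sp rp] := sepb i; apply/separable_elementP; exists (map_poly (in_alg M) p); split.
  - by apply/polyOver1P; exists p.
  - rewrite -(fmorph_root j) -map_poly_comp (eq_map_poly (_ : _ =1 rho)) ?yE //.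
  - by rewrite separable_map.
have genE := eq_adjoin_separable_generator sepE (subv_adjoin_seq _ _).
set z := separable_generator _ _ in genE.
have polyz u : u \in <<1; z>>%VS -> exists g : {poly F}, j u = (map_poly rho g).[j z].
  move=> /Fadjoin1_polyP[g ->]; exists g; rewrite -horner_map -map_poly_comp.
  by rewrite (eq_map_poly (_ : _ =1 rho)) // => a; apply: jE.
have memB l u : (forall x, x \in l -> B (j x)) -> u \in <<1 & l>>%VS -> B (j u).
  elim/last_ind: l u => [|l x IH] u lB.
    rewrite Fadjoin_nil => /vlineP[a ->]; apply/AB/AP; exists a; exact: jE.
  rewrite adjoin_rcons => /Fadjoin_polyP[p /polyOverP pl ->]; rewrite -horner_map.
  apply: horner_closed => [|i]; first by apply: lB; rewrite mem_rcons mem_head.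
  rewrite coef_map; apply: IH (pl i) => y' yl; apply: lB.
  by rewrite mem_rcons inE yl orbT.
have zE : z \in <<1 & ys>>%VS by apply: separable_generator_mem.
have Bz : B (j z).
  by apply: memB zE => _ /mapP[i _ ->]; rewrite yE.
have [p sp rp] : exists2 p : {poly F}, separable_poly p & root (map_poly rho p) (j z).
  have /separable_elementP[p [p1 rp sp]] := separable_generatorP <<1 & ys>>%AS 1%AS.
  have /polyOver1P[p0 pE] := p1; exists p0; first by rewrite -(separable_map (in_alg M)) -pE.
  rewrite pE in rp; rewrite -(fmorph_root j) -map_poly_comp in rp.
  by rewrite (eq_map_poly (_ : _ =1 rho)) // in rp => a; apply: jE.
have [q minq] := ex_minimal_polynomial (separable_poly_neq0 sp) rp.
exists (j z), q; split=> //.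
  by apply: dvdp_separable sp; apply/minq.2.
have q0 : (0 < size q)%N by rewrite size_poly_gt0 monic_neq0 // minq.1.
have degq := minimal_polynomial_ext_degree AP minq.
suff BP x : (exists g, x = (map_poly rho g).[j z]) <-> B x.
  by rewrite (ext_degree_uniq AP deg (ext_degree_eq BP degq)) prednK.
split=> [[g ->]|Bx].
  by apply: horner_closed => // i; rewrite coef_map; apply/AB/AP; eexists.
have [c [[Ac ->] _]] := span x Bx.
have bg i : exists g, b i = (map_poly rho g).[j z].
  rewrite -yE; apply: polyz; rewrite -genE; apply: seqv_sub_adjoin.
  by apply: map_f; rewrite mem_enum.
elim/big_rec: _ => [|i x' _ [g' ->]]; first by exists 0; rewrite rmorph0 horner0.
have [g ->] := bg i; have [a ->] := (AP _).1 (Ac i).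
exists (a%:P * g + g'); rewrite rmorphD rmorphM /= map_polyC !hornerE; by [].
Qed.

End PrimitiveElement.

Lemma prod_XsubC_nseq (E : fieldType) (rs : seq E) e :
  \prod_(z <- flatten (nseq e rs)) ('X - z%:P) = (\prod_(z <- rs) ('X - z%:P)) ^+ e.
Proof. by elim: e => [|e IH]; rewrite /= ?big_nil // big_cat /= IH exprS. Qed.

Lemma sum_nseq (E : fieldType) (rs : seq E) (f : E -> E) e :
  \sum_(z <- flatten (nseq e rs)) f z = (\sum_(z <- rs) f z) *+ e.
Proof. by elim: e => [|e IH]; rewrite /= ?big_nil // big_cat /= IH mulrS. Qed.

(** Otherwise the values of every polynomial would sum to 0 over the list, in particular those of
    one vanishing at all its elements but one. This plays the part of the nonzero trace of a
    separable extension. *)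
Lemma power_sum_neq0 (E : fieldType) (rs : seq E) : uniq rs -> rs != [::] ->
  exists i, \sum_(z <- rs) z ^+ i != 0.
Proof.
case: rs => [//|y rs] /= /andP[yrs _] _; apply: NNPP => nex.
have sum0 i : \sum_(z <- y :: rs) z ^+ i = 0.
  by apply/eqP/negPn/negP => ne; apply: nex; exists i.
have hsum0 (h : {poly E}) : \sum_(z <- y :: rs) h.[z] = 0.
  under eq_bigr => z _ do rewrite horner_coef.
  rewrite exchange_big big1 // => i _ /=.
  by rewrite -mulr_sumr sum0 mulr0.
pose h := \prod_(z <- rs) ('X - z%:P).
have := hsum0 h; rewrite big_cons big1_seq ?addr0 => [/eqP|z /andP[_ zrs]].
  by rewrite -/(root h y) root_prod_XsubC (negPf yrs).
by apply/eqP; rewrite -/(root h z) root_prod_XsubC.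
Qed.

Lemma map_uniq_inj (T T' : eqType) (f : T -> T') (l : seq T) (a b : T) :
  uniq (map f l) -> a \in l -> b \in l -> f a = f b -> a = b.
Proof.
elim: l => //= c l IH /andP[cl ul]; rewrite !inE.
case/orP => [/eqP ->|al]; case/orP => [/eqP ->|bl] // e; last exact: IH.
- by move: cl; rewrite e map_f.
- by move: cl; rewrite -e map_f.
Qed.

Lemma sum_count_disjoint (T T' : eqType) (P : T -> pred T') (l : seq T) (rs : seq T') :
  uniq l -> (forall z x y, x \in l -> y \in l -> P x z -> P y z -> x = y) ->
  (\sum_(x <- l) count (P x) rs <= size rs)%N.
Proof.
move=> ul disj; elim: rs => [|z rs IH] /=; first by rewrite big1.
rewrite big_split /= -add1n leq_add //.
have -> : (\sum_(x <- l) P x z = count (P^~ z) l)%N.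
  by rewrite -sum1_count [RHS]big_mkcond /=; apply: eq_bigr => x _; case: (P x z).
rewrite -size_filter; case e : [seq x <- l | P x z] => [|x [|y s]] //.
have mem t : t \in [:: x, y & s] -> t \in l /\ P t z.
  by rewrite -e mem_filter => /andP[].
have [xl xz] := mem x (mem_head _ _); have [|yl yz] := mem y.
  by rewrite !inE eqxx orbT.
have := filter_uniq (P^~ z) ul; rewrite e (disj z x y) //= inE eqxx; by [].
Qed.

(** * Balls of conjugates and their weighted centres *)

Section Conjugates.
Variables (K Kbar : fieldType) (iota : {rmorphism K -> Kbar}).
Variables (G : oagType) (v : valuation K G) (vbar : valuation Kbar G).
Hypotheses (v_henselian : henselian v) (vbar_ext : forall a : K, vbar (iota a) = v a).
Variables (theta : Kbar) (F : {poly K}).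
Hypotheses (minF : minimal_polynomial iota theta F) (sepF : separable_poly F).
Variables (L : splittingFieldType K) (j : {rmorphism L -> Kbar}) (zs : seq L).
Hypotheses (jE : forall a, j a%:A = iota a).
Hypothesis Fzs : map_poly (in_alg L) F = \prod_(z <- zs) ('X - z%:P).
Hypothesis gen : <<1 & zs>>%VS = fullv.
Local Notation "h ^L" := (map_poly (in_alg L) h) (at level 2, format "h ^L").
Implicit Types (s : gal_of {:L}) (x y z : L) (g h : {poly K}).

Lemma conjugates_uniq : uniq zs.
Proof. by rewrite -separable_prod_XsubC -Fzs separable_map. Qed.

Lemma conjugates_galois : galois 1 {:L}.
Proof.
apply/splitting_galoisField; exists F^L; split.
- by apply/polyOver1P; exists F.
- by rewrite separable_map.
- by exists zs => //; rewrite Fzs eqpxx.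
Qed.

Lemma map_poly_j h x : j h^L.[x] = (map_poly iota h).[j x].
Proof.
rewrite -horner_map -map_poly_comp; congr (_.[_]).
by apply: eq_map_poly => a; apply: jE.
Qed.

Lemma gal_horner s h x : s h^L.[x] = h^L.[s x].
Proof.
rewrite -horner_map -map_poly_comp; congr (_.[_]).
by apply: eq_map_poly => a /=; rewrite linearZ /= rmorph1.
Qed.

Lemma conjugatesP z : z \in zs = root F^L z.
Proof. by rewrite Fzs root_prod_XsubC. Qed.

Lemma ex_theta : exists2 z, z \in zs & j z = theta.
Proof.
have := minimal_polynomial_root minF.
have -> : map_poly iota F = map_poly j F^L.
  by rewrite -map_poly_comp; apply: eq_map_poly => a; rewrite -jE.
rewrite Fzs rmorph_prod /= (eq_bigr (fun z => 'X - (j z)%:P)); last first.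
  by move=> z _; rewrite rmorphB /= map_polyX map_polyC.
rewrite -(big_map j predT (fun z : Kbar => 'X - z%:P)) root_prod_XsubC.
by case/mapP => z zzs ->; exists z.
Qed.

Lemma gal_conjugates s z : (s z \in zs) = (z \in zs).
Proof.
rewrite !conjugatesP /root -gal_horner fmorph_eq0; by [].
Qed.

Lemma gal_perm s : perm_eq (map s zs) zs.
Proof.
have u : uniq (map s zs) by rewrite map_inj_uniq ?conjugates_uniq //; apply: fmorph_inj.
apply: uniq_perm => //; first exact: conjugates_uniq.
have [] := uniq_min_size u (_ : {subset map s zs <= zs}); rewrite ?size_map //.
by move=> _ /mapP[z zz ->]; rewrite gal_conjugates.
Qed.

Lemma gal_transitive y z : y \in zs -> z \in zs -> exists s, s y = z.
Proof.
rewrite !conjugatesP => ry rz.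
have [_ _ norm] := and3P conjugates_galois.
have [|s _ <-] := normalField_root_minPoly (sub1v _) norm (memvf y) (b := z); last by exists s.
have /polyOver1P[p pE] := minPolyOver 1%AS y.
rewrite pE; suff : F %| p by move=> /dvdpP[q ->]; rewrite rmorphM rootM rz orbT.
have irr := minimal_polynomial_irreducible minF.
have p0 : p^L.[y] = 0 by rewrite -pE; apply/rootP/root_minPoly.
have [cop|ncop] := boolP (coprimep F p).
  have := cop; rewrite -(coprimep_map (in_alg L)) => /coprimep_root /(_ ry).
  by rewrite p0 eqxx.
by rewrite -(eqp_dvdl _ (irr.2 _ ncop (dvdp_gcdl _ _))) dvdp_gcdr.
Qed.

Lemma gal_fixed x : (forall s, s x = x) -> exists a, x = a%:A.
Proof.
move=> fix_x; suff : x \in 1%VS by move/vlineP.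
rewrite -[1%VS](galois_fixedField conjugates_galois).
by apply/fixedFieldP; rewrite ?memvf.
Qed.

Lemma gal_val s x : vbar (j (s x)) = vbar (j x).
Proof. exact: (galois_val v_henselian vbar_ext jE). Qed.

Lemma conj_val h y z : y \in zs -> z \in zs -> vbar (j h^L.[y]) = vbar (j h^L.[z]).
Proof. by move=> yz zz; have [s <-] := gal_transitive yz zz; rewrite -gal_horner gal_val. Qed.

(* The lifted characteristic polynomial of an element generating the residue extension reduces to a power
   of a separable irreducible polynomial, whose exponent is the ramification index. *)
Lemma ex_unit_trace : tame_elt iota vbar theta ->
  exists h, (forall z, z \in zs -> fin 0 <= vbar (j h^L.[z])) /\
    vbar (j (\sum_(z <- zs) h^L.[z])) = fin 0.
Proof.
move=> [_ [n [e [f [degn rame degf nef]]]] sepres notp].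
have [rho rhoE] := ex_residue_morphism vbar_ext.
pose A := residue_subfield vbar (base_field iota).
pose B := residue_subfield vbar (adjoin iota theta).
have adjP (x : Kbar) : adjoin iota theta x <-> exists g, x = (map_poly iota g).[theta].
  exact: (minimal_polynomial_adjoin minF).
have AP (y : residue vbar) : A y <-> exists a, y = rho a.
  split=> [[x [[a ->] a0 ->]]|[a ->]].
    have a0' := a0; rewrite vbar_ext in a0'.
    have [X XE] := ex_vring a0'; have [Y YE] := ex_vring a0.
    by exists (residue_pi v X); rewrite -YE resE (rhoE _ Y) // YE XE.
  have [X ->] := ex_residue a.
  have X0 : fin 0 <= vbar (iota (vring_val X)) by rewrite vbar_ext vring_ge0.
  have [Y YE] := ex_vring X0.
  exists (iota (vring_val X)); split=> //; first by exists (vring_val X).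
  by rewrite (rhoE _ _ YE) -YE resE.
have BE (y : residue vbar) : B y <->
    exists g (Y : vring vbar), vring_val Y = (map_poly iota g).[theta] /\ y = residue_pi vbar Y.
  split=> [[x [/adjP[g ->] x0 ->]]|[g [Y [YE ->]]]].
    by have [Y YE] := ex_vring x0; exists g, Y; rewrite -YE resE.
  by exists (vring_val Y); rewrite resE vring_ge0; split=> //; apply/adjP; exists g.
have AB (y : residue vbar) : A y -> B y.
  move=> [x [[a ->] a0 ->]]; exists (iota a); split=> //.
  by apply/adjP; exists a%:P; rewrite map_polyC hornerC.
have BD (x y : residue vbar) : B x -> B y -> B (x + y).
  move=> /BE[g [X [XE ->]]] /BE[h [Y [YE ->]]]; apply/BE; exists (g + h), (X + Y).
  by rewrite rmorphD hornerD -XE -YE rmorphD.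
have BM (x y : residue vbar) : B x -> B y -> B (x * y).
  move=> /BE[g [X [XE ->]]] /BE[h [Y [YE ->]]]; apply/BE; exists (g * h), (X * Y).
  by rewrite rmorphM hornerM -XE -YE rmorphM.
(* [zeta] generates the residue extension and [q] is its minimal polynomial; the value of [g] at
   [theta] lifts [zeta]. *)
have [zeta [q [minq sepq Bzeta szq]]] := ex_primitive_element AP AB BD BM degf sepres.
have [g [X [XE zetaE]]] := (BE _).1 Bzeta.
have [z0 z0zs jz0] := ex_theta.
have gint z : z \in zs -> fin 0 <= vbar (j g^L.[z]).
  by move=> zz; rewrite (conj_val _ zz z0zs) map_poly_j jz0 -XE vring_ge0.
pose pib : {rmorphism vring vbar -> residue vbar} := \pi_({ideal_quot (vmax (w := vbar))})%qT.
pose valb : {rmorphism vring vbar -> Kbar} := val.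
pose Z z : vring vbar := insubd 0 (j g^L.[z]).
have ZE z : z \in zs -> vring_val (Z z) = j g^L.[z].
  by move=> /gint zint; apply: insubdK.
pose etas := [seq pib (Z z) | z <- zs].
(* The characteristic polynomial of this lift is fixed by the Galois group, hence defined over
   [K]. *)
have [P0 P0E] : exists P0, \prod_(z <- zs) ('X - (g^L.[z])%:P) = P0^L.
  apply/polyOver1P/polyOverP => i; apply/vlineP; apply: gal_fixed => s.
  rewrite -coef_map; congr (_`_i); rewrite rmorph_prod /=.
  rewrite (eq_bigr (fun z => 'X - (g^L.[s z])%:P)) => [|z _]; last first.
    by rewrite rmorphB /= map_polyX map_polyC /= gal_horner.
  rewrite -(big_map s predT (fun z => 'X - (g^L.[z])%:P)).
  by rewrite (perm_big zs) //=; apply: gal_perm.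
pose PV := \prod_(z <- zs) ('X - (Z z)%:P).
have PVE : map_poly valb PV = map_poly iota P0.
  have -> : map_poly iota P0 = map_poly j P0^L.
    by rewrite -map_poly_comp; apply: eq_map_poly => a; rewrite -jE.
  rewrite -P0E (rmorph_prod (map_poly valb)) (rmorph_prod (map_poly j)).
  apply: eq_big_seq => z zz.
  by rewrite [LHS]map_polyXsubC [RHS]map_polyXsubC -(ZE z zz).
have coefV i : valb PV`_i = iota P0`_i by rewrite -!coef_map PVE.
have coef_int i : fin 0 <= v P0`_i.
  by rewrite -vbar_ext -coefV; apply: vring_ge0.
pose C i : vring v := insubd 0 P0`_i.
have CE i : vring_val (C i) = P0`_i by apply: insubdK; apply: coef_int.
pose Pbar : {poly residue v} := \poly_(i < size P0) residue_pi v (C i).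
have PbarE : map_poly rho Pbar = \prod_(eta <- etas) ('X - eta%:P).
  have -> : \prod_(eta <- etas) ('X - eta%:P) = map_poly pib PV.
    rewrite big_map rmorph_prod; apply: eq_bigr => z _.
    by rewrite rmorphB /= map_polyX map_polyC.
  apply/polyP => i; rewrite !coef_map coef_poly.
  have [ip|ip] := ltnP i (size P0).
    by apply: rhoE; rewrite CE -coefV.
  suff -> : PV`_i = 0 by rewrite [LHS]rmorph0 [RHS]rmorph0.
  by apply: val_inj; rewrite -[LHS]/(valb PV`_i) coefV nth_default // rmorph0.
(* A lift of [q] with integral coefficients, seen over [vring vbar] and, as [Q], over [K]. *)
pose QV : {poly vring vbar} := \poly_(i < size q) insubd 0 (iota (vring_val (repr q`_i))).
pose Q : {poly K} := \poly_(i < size q) vring_val (repr q`_i).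
have QVE i : vring_val (insubd (0 : vring vbar) (iota (vring_val (repr q`_i)))) =
    iota (vring_val (repr q`_i)).
  by apply: insubdK; rewrite inE vbar_ext vring_ge0.
have QVpi : map_poly pib QV = map_poly rho q.
  apply/polyP => i; rewrite !coef_map coef_poly.
  case: ifP => [_|iq]; last first.
    have -> : q`_i = 0 by rewrite nth_default // leqNgt iq.
    by rewrite [LHS]rmorph0 [RHS]rmorph0.
  have := rhoE _ _ (QVE i); rewrite reprK => rE; rewrite -[LHS]rE; exact: erefl.
have QVval : map_poly valb QV = map_poly iota Q.
  apply/polyP => i; rewrite !coef_map !coef_poly.
  case: ifP => [_|iq]; first exact: QVE.
  by rewrite [LHS]rmorph0 [RHS]rmorph0.
have rootQ (Y : vring vbar) : root (map_poly rho q) (pib Y) = (fin 0 < vbar (map_poly iota Q).[vring_val Y]).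
  rewrite -QVpi /root horner_map -QVval; rewrite residue_eq0.
  by rewrite -[vring_val Y]/(valb Y) horner_map.
(* At the lift of [zeta], [Q] has positive value; conjugates have equal values, so all the residues
   in [etas] are roots of [q]. *)
have etas_root (y : residue vbar) : y \in etas -> root (map_poly rho q) y.
  move=> /mapP[z zz ->]; rewrite rootQ (ZE z zz) map_poly_j.
  rewrite -horner_comp -map_comp_poly -map_poly_j (conj_val _ zz z0zs).
  rewrite map_poly_j jz0 map_comp_poly horner_comp -XE -rootQ.
  have := minimal_polynomial_root minq; by rewrite zetaE.
have irrq := minimal_polynomial_irreducible minq.
have monP : Pbar \is monic by rewrite -(map_monic rho) PbarE monic_prod_XsubC.
have [e' PqE] := irreducible_power monP minq.1 irrq PbarE etas_root.
have szF : size F = (size zs).+1.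
  by rewrite -(size_map_poly (in_alg L)) Fzs size_prod_XsubC.
have nzs : n = size zs.
  have := (minimal_polynomial_elt_degree n minF).1 degn.
  by rewrite szF => -[].
have zs0 : (0 < size zs)%N by case: (zs) z0zs.
have f0 : (0 < f)%N by have := minimal_polynomial_size_gt1 minq; rewrite szq.
(* Compare degrees: [f * e' = n], and [n = e * f] because the defect is 1. *)
have ee' : e' = e.
  have : size (map_poly rho Pbar) = (size etas).+1 by rewrite PbarE size_prod_XsubC.
  rewrite size_map_poly size_map PqE => szqe'.
  have := size_exp q e'; rewrite szq /= => szqe.
  move: szqe; rewrite szqe' /= -nzs nef muln1 mulnC => /eqP.
  by rewrite eqn_pmul2l // => /eqP.
rewrite {}ee' in PqE.
have e0 : (0 < e)%N by move: zs0; rewrite -nzs nef muln1 muln_gt0 => /andP[].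
have [ss qss] : exists ss, map_poly rho q = \prod_(z <- ss) ('X - z%:P).
  have : map_poly rho q %| \prod_(eta <- etas) ('X - eta%:P).
    by rewrite -PbarE PqE -(prednK e0) exprS rmorphM dvdp_mulr.
  case/dvdp_prod_XsubC => mm qE; exists (mask mm etas); apply/eqP.
  by rewrite -eqp_monic // ?map_monic ?monic_prod_XsubC ?minq.1.
have uss : uniq ss by rewrite -separable_prod_XsubC -qss separable_map.
have ss0 : ss != [::].
  apply: contraTneq f0 => ss0; have : size (map_poly rho q) = 1%N.
    by rewrite qss ss0 big_nil size_poly1.
  by rewrite size_map_poly szq => -[->].
have perm : perm_eq etas (flatten (nseq e ss)).
  apply: prod_XsubC_eq; rewrite prod_XsubC_nseq -PbarE PqE -qss.
  by rewrite rmorphXn.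
have [i si] := power_sum_neq0 uss ss0.
(* [etas] consists of the distinct roots of [q], each repeated [e] times, and [e] is nonzero in the
   residue field by tameness. *)
have eta_sum : \sum_(y <- etas) y ^+ i != 0.
  rewrite (perm_big _ perm) /= sum_nseq -mulr_natl mulf_neq0 //.
  apply/negP => eR0; have [p pch] := natf0_pchar e0 eR0.
  by have := notp e p rame pch; rewrite (dvdn_pcharf pch) eR0.
have hE z : z \in zs -> j (g ^+ i)^L.[z] = valb (Z z ^+ i).
  move=> zz; rewrite [RHS]rmorphXn (rmorphXn (map_poly (in_alg L))) horner_exp [LHS]rmorphXn.
  by rewrite -(ZE z zz).
exists (g ^+ i); split=> [z zz|].
  by rewrite hE //; apply: vring_ge0.
have -> : j (\sum_(z <- zs) (g ^+ i)^L.[z]) = valb (\sum_(z <- zs) Z z ^+ i).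
  by rewrite rmorph_sum [RHS]rmorph_sum; apply: eq_big_seq => z zz; apply: hE.
apply: le_anti; rewrite [_ && _]andbC vring_ge0 /= leNgt -residue_eq0.
apply: contraNN eta_sum => /eqP s0.
rewrite big_map (eq_bigr (fun z => pib (Z z ^+ i))) => [|z _]; last by rewrite rmorphXn.
by rewrite -rmorph_sum; apply/eqP.
Qed.

Definition near d x y := fin d < vbar (j (x - y)).

Lemma near_refl d x : near d x x.
Proof. by rewrite /near subrr rmorph0 val_zero ext_lt_infty. Qed.

Lemma near_sym d x y : near d x y = near d y x.
Proof. by rewrite /near -opprB rmorphN val_opp. Qed.

Lemma near_trans d x y z : near d x y -> near d y z -> near d x z.
Proof.
rewrite /near => xy yz; have -> : x - z = (x - y) + (y - z) by rewrite addrA subrK.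
by rewrite rmorphD val_ltD.
Qed.

Lemma near_gal d s x y : near d (s x) (s y) = near d x y.
Proof. by rewrite /near -rmorphB gal_val. Qed.

Definition ball d x := [seq z <- zs | near d x z].

Lemma ball_eq d x y : near d x y -> ball d x = ball d y.
Proof.
move=> xy; apply: eq_filter => z; apply/idP/idP; apply: near_trans => //.
by rewrite near_sym.
Qed.

Lemma gal_ball d s x : perm_eq (map s (ball d x)) (ball d (s x)).
Proof.
have -> : map s (ball d x) = [seq z <- map s zs | near d (s x) z].
  by rewrite filter_map; congr (map _ _); apply: eq_filter => z; rewrite /= near_gal.
exact: perm_filter (gal_perm s).
Qed.

Definition ball_trace d h x := \sum_(z <- ball d x) h^L.[z].

Lemma gal_ball_trace d h s x : s (ball_trace d h x) = ball_trace d h (s x).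
Proof.
rewrite /ball_trace rmorph_sum -(perm_big _ (gal_ball d s x)) /= big_map.
by apply: eq_bigr => z _; rewrite /= gal_horner.
Qed.

(** Conjugate balls have conjugate traces. If one of these had positive value, all would, and so
    would their sum over the partition of the conjugates into balls, which is the full trace. *)
Lemma ball_trace_unit d h x : (forall z, z \in zs -> fin 0 <= vbar (j h^L.[z])) ->
  vbar (j (\sum_(z <- zs) h^L.[z])) = fin 0 -> x \in zs ->
  vbar (j (ball_trace d h x)) = fin 0.
Proof.
move=> hint htr xzs; apply: le_anti; apply/andP; split; last first.
  rewrite /ball_trace rmorph_sum big_seq; elim/big_ind: _ => [|a b|z].
  - by rewrite val_zero ext_lex_infty.
  - exact: val_leD.
  - by rewrite mem_filter => /andP[_]; apply: hint.
rewrite leNgt; apply/negP => pos.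
have pos_all y : y \in zs -> fin 0 < vbar (j (ball_trace d h y)).
  by move=> yzs; have [s <-] := gal_transitive xzs yzs; rewrite -gal_ball_trace gal_val.
(* Induction over the sublists of [zs] that are unions of balls, removing the ball of the first
   element. *)
suff sumpos (l : seq L) : uniq l -> {subset l <= zs} ->
    (forall a b, a \in l -> b \in zs -> near d a b -> b \in l) ->
    fin 0 < vbar (j (\sum_(z <- l) h^L.[z])).
  by have := sumpos zs conjugates_uniq (fun _ => id) (fun _ _ _ bz _ => bz); rewrite htr ltxx.
have [n] := ubnP (size l); elim: n => // n IH in l *.
case: l => [|y l] szl ul lzs closed; first by rewrite big_nil rmorph0 val_zero ext_lt_infty.
rewrite (bigID (near d y)) /= rmorphD; apply: val_ltD.
  have yzs : y \in zs by apply: lzs; apply: mem_head.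
  suff -> : \sum_(z <- y :: l | near d y z) h^L.[z] = ball_trace d h y by apply: pos_all.
  rewrite -big_filter; apply: perm_big; apply: uniq_perm.
  - exact: filter_uniq.
  - by apply: filter_uniq; apply: conjugates_uniq.
  move=> z; rewrite !mem_filter; case yz: (near d y z) => //=.
  apply/idP/idP => [/lzs //|zzs]; apply: closed yz => //; exact: mem_head.
rewrite -big_filter; apply: IH.
- rewrite /= near_refl /=; have szl' : (size l < n)%N := szl.
  by apply: leq_ltn_trans szl'; rewrite size_filter count_size.
- exact: filter_uniq.
- by move=> z; rewrite mem_filter => /andP[_ /lzs].
move=> a b; rewrite !mem_filter => /andP[nya al] bzs ab; rewrite (closed a) // andbT.
by apply: contra nya => yb; apply: near_trans yb _; rewrite near_sym.
Qed.

(* [b] is the average of the conjugates lying in the ball of [x0], weighted by the values of a polynomial of unit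
   trace; it has at most one conjugate in each of the conjugate balls. *)
Lemma ex_center d x0 : tame_elt iota vbar theta -> x0 \in zs ->
  exists b (l : seq L), [/\ near d x0 b, uniq l, {subset l <= zs},
    forall x y, x \in l -> y \in l -> near d x y -> x = y
    & elt_degree iota (j b) (size l)].
Proof.
move=> tame x0zs; have [h [hint htr]] := ex_unit_trace tame.
have unit y : y \in zs -> vbar (j (ball_trace d h y)) = fin 0.
  exact: ball_trace_unit.
pose num y := ball_trace d (h * 'X) y.
pose b := num x0 / ball_trace d h x0.
have T0 : ball_trace d h x0 != 0.
  by apply/eqP => e; have := unit _ x0zs; rewrite e rmorph0 val_zero.
have bs s : s b = num (s x0) / ball_trace d h (s x0).
  by rewrite /b fmorph_div /= !gal_ball_trace.
(* [r] lists one automorphism for each conjugate of [b]; applied to [x0], these give the list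
   [l]. *)
have [r [_ ur minb]] := (galois_factors (sub1v _) conjugates_galois) b (memvf b).
exists b, [seq s x0 | s : gal_of {:L} <- r].
(* [s b] depends only on the ball of [s x0]. *)
have eqs s t : s \in r -> t \in r -> near d (s x0) (t x0) -> s = t.
  move=> sr tr st; apply: map_uniq_inj ur sr tr _.
  by rewrite /= !bs /num /ball_trace (ball_eq st).
split.
- rewrite near_sym /near; have -> : b - x0 = (num x0 - x0 * ball_trace d h x0) / ball_trace d h x0.
    by rewrite mulrBl mulfK.
  have -> : num x0 - x0 * ball_trace d h x0 = \sum_(z <- ball d x0) h^L.[z] * (z - x0).
    rewrite /num /ball_trace mulr_sumr -sumrB; apply: eq_bigr => z _.
    have -> : (h * 'X)^L.[z] = h^L.[z] * z by rewrite rmorphM /= map_polyX hornerM hornerX.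
    by rewrite mulrBr [x0 * _]mulrC.
  rewrite fmorph_div val_mul.
  have -> : vbar (j (ball_trace d h x0))^-1 = fin 0.
    have := val_mul vbar (j (ball_trace d h x0)) (j (ball_trace d h x0))^-1.
    by rewrite mulfV ?fmorph_eq0 // val_one unit // fin0E add0r.
  rewrite fin0E addr0 rmorph_sum big_seq; elim/big_ind: _ => [|a c|z].
  + by rewrite val_zero ext_lt_infty.
  + exact: val_ltD.
  rewrite mem_filter => /andP[nz zzs]; rewrite rmorphM val_mul.
  rewrite -[d]add0r; apply: ext_ltD; first exact: hint.
  by rewrite -/(near d z x0) near_sym.
- rewrite map_inj_in_uniq; first exact: map_uniq ur.
  by move=> s t sr tr e; apply: eqs => //; rewrite e near_refl.
- by move=> _ /mapP[s _ ->]; rewrite gal_conjugates.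
- by move=> _ _ /mapP[s sr ->] /mapP[t tr ->] /(eqs _ _ sr tr) ->.
have /polyOver1P[p pE] := minPolyOver 1%AS b.
suff minp : minimal_polynomial iota (j b) p.
  apply/(minimal_polynomial_elt_degree _ minp).
  by rewrite -(size_map_poly (in_alg L)) -pE minb size_prod_XsubC !size_map.
have rootE q : root (map_poly iota q) (j b) = root q^L b.
  by rewrite /root -map_poly_j fmorph_eq0.
split; first by rewrite -(map_monic (in_alg L)) -pE monic_minPoly.
move=> q; rewrite rootE -(dvdp_map (in_alg L)) -pE; split.
  by apply: minPoly_dvdp; apply/polyOver1P; exists q.
by move=> dv; apply: root_dvdp dv (root_minPoly _ _).
Qed.

Lemma gauss_term_conj d f s x k : 
  gauss_term vbar (j (s x)) d (map_poly iota f) k = gauss_term vbar (j x) d (map_poly iota f) k.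
Proof.
have e y : map_poly iota f \Po ('X + (j y)%:P) = map_poly j (f^L \Po ('X + y%:P)).
  rewrite map_comp_poly rmorphD /= map_polyX map_polyC -map_poly_comp.
  by congr (_ \Po _); apply: eq_map_poly => a; rewrite -jE.
have fs : map_poly s f^L = f^L.
  by rewrite -map_poly_comp; apply: eq_map_poly => a /=; rewrite linearZ /= rmorph1.
rewrite /gauss_term !e !coef_map; congr (_ + _); rewrite -[RHS](gal_val s).
congr (vbar (j _)); rewrite -[RHS]coef_map; congr (_`_k).
by rewrite map_comp_poly fs rmorphD /= map_polyX map_polyC.
Qed.

(** The roots of [f] may lie outside [L], so they are not permuted directly; instead [nroots] is the
    index read off the Gauss terms at the centre, which conjugation preserves. *)
Lemma nroots_conj d f a (rs : seq Kbar) y z : a != 0 ->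
  map_poly iota f = a *: \prod_(x <- rs) ('X - x%:P) -> y \in zs -> z \in zs ->
  nroots vbar (j y) d rs = nroots vbar (j z) d rs.
Proof.
move=> a0 fE yzs zzs; have [s <-] := gal_transitive yzs zzs.
have [V hV] := gauss_at_prod vbar (j y) d rs a0.
have [V' hV'] := gauss_at_prod vbar (j (s y)) d rs a0.
rewrite -fE in hV hV'; apply: (gauss_at_index hV); case: hV' => h1 h2 h3.
split=> [k||k]; rewrite -(gauss_term_conj _ _ s) //; exact: h3.
Qed.

End Conjugates.

Lemma tame_nroots (K : fieldType) (Kbar : closedFieldType) (iota : {rmorphism K -> Kbar})
    (G : oagType) (v : valuation K G) (vbar : valuation Kbar G)
    (theta : Kbar) (F : {poly K}) (d : G) (D : nat) :
  henselian v -> (forall a : K, vbar (iota a) = v a) ->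
  minimal_polynomial iota theta F -> tame_elt iota vbar theta ->
  (forall beta e, elt_degree iota beta e -> (e < D)%N -> vbar (theta - beta) <= fin d) ->
  forall (f : {poly K}) a (rs : seq Kbar), a != 0 ->
    map_poly iota f = a *: \prod_(x <- rs) ('X - x%:P) -> (size rs <= D)%N ->
    (nroots vbar theta d rs <= 1)%N.
Proof.
move=> hens ext minF tame far f a rs a0 fE szrs.
have sepF : separable_poly F.
  have [sep _ _ _] := tame; have [|p mp sp] := sep theta.
    exists 'X, 1; rewrite map_polyX rmorph1 hornerX hornerC divr1.
    by split=> //; apply: oner_neq0.
  have [p0 pE p00] := is_minpoly_pull (base_fieldP iota) mp.
  have [_ _ rp _] := mp; rewrite pE in rp sp.
  rewrite (separable_map iota) in sp.
  by apply: dvdp_separable sp; apply/minF.2.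
have [zs0 FE] := closed_field_poly_normal (map_poly iota F).
have lc0 : lead_coef (map_poly iota F) != 0.
  by rewrite lead_coef_eq0 map_poly_eq0 monic_neq0 // minF.1.
have [|L [j [zs [jE _ Fzs gen]]]] := @ex_embedded_splitting _ _ iota F zs0.
  by rewrite [X in X %= _]FE eqp_scale.
have {}Fzs : map_poly (in_alg L) F = \prod_(z <- zs) ('X - z%:P).
  by apply/eqP; rewrite -eqp_monic ?map_monic ?monic_prod_XsubC ?minF.1.
have [x0 x0zs jx0] := ex_theta minF jE Fzs.
have [b [l [nb ul lzs inj degb]]] := ex_center hens ext minF sepF jE Fzs gen d tame x0zs.
(* If [l] were shorter, [b] would have degree less than [D] and lie in the ball of [theta], against
   [far]. *)
have Dl : (D <= size l)%N.
  rewrite leqNgt; apply/negP => /(far _ _ degb).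
  by rewrite -jx0 -rmorphB leNgt -/(near vbar j d x0 b) nb.
have [l0|l0] := posnP (size l).
  have : size rs = 0%N by apply/eqP; rewrite -leqn0 -l0 (leq_trans szrs).
  by move/size0nil => ->.
pose P x : pred Kbar := fun z => fin d < vbar (j x - z).
have : (\sum_(x <- l) count (P x) rs <= size rs)%N.
  apply: sum_count_disjoint => // z x y xl yl xz yz; apply: inj => //.
  rewrite /near; have -> : j (x - y) = (j x - z) - (j y - z) by rewrite rmorphB opprB addrA subrK.
  by apply: val_ltD => //; rewrite val_opp.
have -> : (\sum_(x <- l) count (P x) rs = size l * nroots vbar theta d rs)%N.
  transitivity (\sum_(x <- l) nroots vbar theta d rs)%N.
    apply: eq_big_seq => x xl; rewrite -jx0.
    exact: (nroots_conj hens ext minF sepF jE Fzs gen d a0 fE (lzs _ xl) x0zs).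
  by rewrite big_const_seq count_predT iter_addn_0 mulnC.
move=> le; rewrite -(leq_pmul2l l0) muln1.
by apply: leq_trans le (leq_trans szrs Dl).
Qed.

(** * Okutsu sequences and Mac Lane-Vaquie chains *)

Lemma ex_expansion (K : fieldType) (phi f : {poly K}) : (1 < size phi)%N ->
  exists s : seq {poly K}, (forall n, (n < size s)%N -> (size (s`_n)%R < size phi)%N) /\
    f = \sum_(n < size s) s`_n * phi ^+ n.
Proof.
move=> phi1; have phi0 : phi != 0 by rewrite -size_poly_gt0 ltnW.
have [n] := ubnP (size f); elim: n => // n IH in f *; move=> szf.
have [->|f0] := eqVneq f 0; first by exists [::]; rewrite big_ord0.
have [|s [szs qE]] := IH (f %/ phi).
  rewrite size_divp //; have f1 : (0 < size f)%N by rewrite size_poly_gt0.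
  have arith (x y m : nat) : (x < m.+1 -> 1 < y -> 0 < x -> x - y.-1 < m)%N by lia.
  exact: arith.
exists (f %% phi :: s); split=> [[|k]|] /=; first by rewrite ltn_modp.
  exact: szs.
rewrite big_ord_recl expr0 mulr1 [LHS](divp_eq f phi) addrC; congr (_ + _).
rewrite {1}qE mulr_suml; apply: eq_bigr => i _.
by rewrite -mulrA -exprSr.
Qed.

Section Main.
Variables (K : fieldType) (Kbar : closedFieldType) (iota : {rmorphism K -> Kbar}).
Variables (G : oagType) (vbar : valuation Kbar G) (theta : Kbar).
Implicit Types (f g a : {poly K}) (d : G) (D : nat).

Local Notation "f ^i" := (map_poly iota f) (at level 2, format "f ^i").
Local Notation W d f := (gauss vbar theta d f^i).
Local Notation vF := (eval_valuation iota vbar theta).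

Lemma vF0 : vF 0 = infty.
Proof. by rewrite /eval_valuation rmorph0 horner0 val_zero. Qed.

Lemma gauss_far_roots d f :
  (forall z, root f^i z -> vbar (theta - z) <= fin d) -> W d f = vF f.
Proof.
move=> far; have [->|f0] := eqVneq f 0; first by rewrite rmorph0 gauss0 vF0.
have fi0 : f^i != 0 by rewrite map_poly_eq0.
have [V [rs [fE hV]]] := gauss_atP vbar theta d fi0.
have n0 : nroots vbar theta d rs = 0%N.
  apply/eqP; rewrite -leqn0 leqNgt -has_count; apply/hasPn => z zrs.
  rewrite -leNgt; apply: far; rewrite fE rootZ ?lead_coef_eq0 //.
  by rewrite root_prod_XsubC.
rewrite n0 in hV; rewrite (gauss_atE hV); have [_ <- _] := hV.
by rewrite gauss_term0.
Qed.

Lemma gauss_lt_near_root d f : W d f < vF f ->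
  exists z, root f^i z /\ fin d < vbar (theta - z).
Proof.
move=> lt; apply: NNPP => nex; move: lt; rewrite gauss_far_roots ?ltxx // => z rz.
by rewrite leNgt; apply/negP => dz; apply: nex; exists z.
Qed.

Lemma near_root_gauss_lt d f z : f != 0 -> root f^i z -> fin d < vbar (theta - z) ->
  W d f < vF f.
Proof.
move=> f0 rz dz; have fi0 : f^i != 0 by rewrite map_poly_eq0.
have [V [rs [fE hV]]] := gauss_atP vbar theta d fi0.
rewrite (gauss_atE hV) /eval_valuation -(gauss_term0 vbar theta d); case: hV => _ _; apply.
rewrite -has_count; apply/hasP; exists z => //.
by rewrite -root_prod_XsubC -(rootZ _ _ (_ : lead_coef f^i != 0)) -?fE ?lead_coef_eq0.
Qed.

(** * Polynomials of degree at most D and a ball around [theta] containing no element of degree less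
    than D *)

Section Ball.
Variables (d : G) (D : nat).
Hypothesis far : forall beta e, elt_degree iota beta e -> (e < D)%N ->
  vbar (theta - beta) <= fin d.
Hypothesis single : forall f (a : Kbar) (rs : seq Kbar), a != 0 ->
  f^i = a *: \prod_(x <- rs) ('X - x%:P) -> (size rs <= D)%N ->
  (nroots vbar theta d rs <= 1)%N.

Lemma small_far f z : f != 0 -> (size f <= D)%N -> root f^i z -> vbar (theta - z) <= fin d.
Proof.
move=> f0 szf rz; have [e [dege lte]] := root_elt_degree f0 rz.
exact: far dege (leq_trans lte szf).
Qed.

Lemma small_gauss f : (size f <= D)%N -> W d f = vF f.
Proof.
have [->|f0] := eqVneq f 0; first by rewrite rmorph0 gauss0 vF0.
by move=> szf; apply: gauss_far_roots => z; apply: small_far.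
Qed.

Lemma near_root_factor f z : f \is monic -> size f = D.+1 -> root f^i z ->
  fin d < vbar (theta - z) -> exists rs, f^i = ('X - z%:P) * \prod_(y <- rs) ('X - y%:P) /\
    forall y, y \in rs -> vbar (theta - y) <= fin d.
Proof.
move=> monf szf rz dz; have [rs fE] := closed_field_poly_normal f^i.
have lc1 : lead_coef f^i = 1 by apply/monicP; rewrite map_monic.
have zrs : z \in rs by move: rz; rewrite fE lc1 scale1r root_prod_XsubC.
have szrs : size rs = D.
  by apply: succn_inj; rewrite -szf -(size_map_poly iota) fE lc1 scale1r size_prod_XsubC.
exists (rem z rs); split; first by rewrite fE lc1 scale1r (big_rem z zrs).
have fE1 : f^i = 1 *: \prod_(y <- rs) ('X - y%:P) by rewrite fE lc1.
have := single (oner_neq0 _) fE1 (eq_leq szrs).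
rewrite /nroots (seq.permP (perm_to_rem zrs)) /= dz add1n ltnS leqn0 => /eqP n0.
move=> y yrs; rewrite leNgt; apply/negP => dy.
have : has (fun y => fin d < vbar (theta - y)) (rem z rs) by apply/hasP; exists y.
by rewrite has_count n0.
Qed.

(** Only the factor [X - z] has its root in the ball: its value at [theta] is [vbar (theta - z)],
    its Gauss value is [d]. Sums are used instead of differences because both sides are infinite
    when [z = theta]. *)
Lemma near_root_value f z : f \is monic -> size f = D.+1 -> root f^i z ->
  fin d < vbar (theta - z) -> vF f + fin d = vbar (theta - z) + W d f.
Proof.
move=> monf szf rz dz; have [rs [fE rsd]] := near_root_factor monf szf rz dz.
rewrite /eval_valuation fE hornerM !hornerE /= gaussM gauss_XsubC min_l ?(ltW dz) //.
have : gauss vbar theta d (\prod_(y <- rs) ('X - y%:P)) = vbar (\prod_(y <- rs) ('X - y%:P)).[theta].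
  elim: rs rsd {fE} => [|y rs IH] rsd; first by rewrite big_nil gaussC hornerC.
  rewrite big_cons gaussM hornerM val_mul gauss_XsubC !hornerE min_r; last first.
    by apply: rsd; apply: mem_head.
  by rewrite IH // => x xrs; apply: rsd; rewrite inE xrs orbT.
by move=> ->; rewrite val_mul -addrA [_ + fin d]addrC.
Qed.

Lemma vF_sub (x : extg G) f g : x < vF f -> x < vF g -> x < vF (f - g).
Proof.
move=> xf xg; have [a xa] := ext_lt_fin xf; rewrite xa in xf xg *.
by rewrite /eval_valuation rmorphB hornerD hornerN; apply: val_ltD; rewrite ?val_opp.
Qed.

(** [f - g] has degree less than [D], so its Gauss value is its value at [theta]. If
    [W d f < W d g], the Gauss value is [W d f], while both [f] and [g] take larger values at
    [theta]. *)
Lemma gauss_eq_near f g y z : f \is monic -> g \is monic -> size f = D.+1 -> size g = D.+1 ->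
  root f^i y -> fin d < vbar (theta - y) -> root g^i z -> fin d < vbar (theta - z) ->
  W d f = W d g.
Proof.
move=> monf mong szf szg ry dy rz dz.
wlog lt : f g y z monf mong szf szg ry dy rz dz / W d f < W d g.
  move=> wl; case: (ltgtP (W d f) (W d g)) => // lt; first exact: (wl f g y z).
  by apply/esym; apply: (wl g f z y).
have := small_gauss (f := f - g); rewrite -ltnS -szf size_monic_sub ?szf ?szg // => /(_ isT).
rewrite rmorphB gaussDl ?gaussN // => e.
have fl := near_root_gauss_lt (monic_neq0 monf) ry dy.
have gl := near_root_gauss_lt (monic_neq0 mong) rz dz.
by have := vF_sub fl (lt_trans lt gl); rewrite -e ltxx.
Qed.

(** If [f] has a root in the ball, [near_root_value] applies to both polynomials with the same Gauss
    value. If not, [W d f = vF f], and [vF g < vF f] would give [W d (g - f) = W d g < vF (g - f)],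
    impossible below degree [D]. *)
Lemma near_root_maximal f g z : f \is monic -> g \is monic -> size f = D.+1 -> size g = D.+1 ->
  root g^i z -> fin d < vbar (theta - z) ->
  (forall y, root f^i y -> vbar (theta - y) <= vbar (theta - z)) -> vF f <= vF g.
Proof.
move=> monf mong szf szg rz dz fz.
have gl := near_root_gauss_lt (monic_neq0 mong) rz dz.
have [[y [ry dy]]|nex] := classic (exists y, root f^i y /\ fin d < vbar (theta - y)).
  rewrite -(ext_leD2l d) addrC [X in _ <= X]addrC.
  rewrite (near_root_value monf szf ry dy) (near_root_value mong szg rz dz).
  by rewrite (gauss_eq_near monf mong szf szg ry dy rz dz) ext_leD // fz.
have fE : W d f = vF f.
  apply: gauss_far_roots => y ry; rewrite leNgt; apply/negP => dy; apply: nex.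
  by exists y.
rewrite leNgt; apply/negP => gf.
have := small_gauss (f := g - f); rewrite -ltnS -szg size_monic_sub ?szf ?szg // => /(_ isT).
rewrite rmorphB gaussDl ?gaussN ?fE ?(lt_trans gl) // => e.
by have := vF_sub gl (lt_trans gl gf); rewrite -e ltxx.
Qed.

End Ball.
End Main.
Lemma gauss_fin (E : closedFieldType) (G : oagType) (w : valuation E G) c d f :
  f != 0 -> exists V, gauss w c d f = fin V.
Proof. by move=> f0; have [V [rs [_ h]]] := gauss_atP w c d f0; exists V; apply: gauss_atE h. Qed.

Lemma val_eq_infty (E : fieldType) (G : oagType) (w : valuation E G) x : w x = infty -> x = 0.
Proof. by have [//|/(val_fin_neq0 w)[a ->]] := eqVneq x 0. Qed.

(** * Induction along the Okutsu sequence and the chain *)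

Section OkutsuChain.
Variables (K : fieldType) (Kbar : closedFieldType) (iota : {rmorphism K -> Kbar}).
Hypothesis iota_alg : forall x : Kbar, algebraicOver iota x.
Variables (G : oagType) (v : valuation K G) (vbar : valuation Kbar G).
Hypotheses (v_henselian : henselian v) (vbar_ext : forall a : K, vbar (iota a) = v a).
Variables (theta : Kbar) (F : {poly K}).
Hypotheses (theta_tame : tame_elt iota vbar theta) (minF : minimal_polynomial iota theta F).
Variables (r : nat) (alpha : nat -> Kbar) (m : nat -> nat).
Hypothesis alpha_okutsu : okutsu_sequence iota vbar theta r alpha m.
Variables (phi : nat -> {poly K}) (gamma : nat -> extg G) (mu : nat -> valuation {poly K} G).
Hypothesis mu_chain : MLV_chain v F (eval_valuation iota vbar theta) r phi gamma mu.
Implicit Types (f g : {poly K}) (d : G) (i : nat) (beta : Kbar).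

Local Notation "f ^i" := (map_poly iota f) (at level 2, format "f ^i").
Local Notation W d f := (gauss vbar theta d f^i).
Local Notation vF := (eval_valuation iota vbar theta).
Local Notation delta i := (vbar (theta - alpha i)).

Lemma okutsu_ltm i : (i < r)%N -> (m i < m i.+1)%N.
Proof. by move=> ir; have [_ _ _ h _] := alpha_okutsu; apply: h. Qed.

Lemma okutsu_le i beta e : (i < r)%N -> elt_degree iota beta e -> (e < m i.+1)%N ->
  vbar (theta - beta) <= delta i.
Proof. by move=> ir de lt; have [_ _ _ _ h] := alpha_okutsu; apply: (h i ir beta e de).1. Qed.

Lemma okutsu_lt i beta e : (i < r)%N -> elt_degree iota beta e -> (e < m i)%N ->
  vbar (theta - beta) < delta i.
Proof. by move=> ir de lt; have [_ _ _ _ h] := alpha_okutsu; apply: (h i ir beta e de).2. Qed.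

Lemma okutsu_degree i : (i <= r)%N -> elt_degree iota (alpha i) (m i).
Proof. by have [_ h _ _ _] := alpha_okutsu; apply: h. Qed.

Lemma delta_infty i : (i <= r)%N -> delta i = infty -> i = r.
Proof.
move=> ir /val_eq_infty /eqP; rewrite subr_eq0 => /eqP e.
have [thetar _ _ _ _] := alpha_okutsu.
have := okutsu_degree (leqnn r); rewrite thetar e => dr.
have mi := ext_degree_uniq (base_fieldP iota) (okutsu_degree ir) dr.
apply/eqP; move: ir; rewrite leq_eqVlt => /orP[//|ir].
suff incr k : (k <= r)%N -> (i < k)%N -> (m i < m k)%N.
  by have := incr r (leqnn r) ir; rewrite mi ltnn.
elim: k => // k IH kr ik.
move: ik; rewrite ltnS leq_eqVlt => /orP[/eqP ->|ik]; first exact: okutsu_ltm.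
exact: ltn_trans (IH (ltnW kr) ik) (okutsu_ltm kr).
Qed.

Lemma delta_fin i : (i < r)%N -> exists d, delta i = fin d.
Proof.
move=> ir; apply: ext_finP => /(delta_infty (ltnW ir)) e.
by rewrite e ltnn in ir.
Qed.

Lemma delta_lt i : (i < r)%N -> delta i < delta i.+1.
Proof.
move=> ir; have [lt|ge] := ltnP i.+1 r.
  exact: (okutsu_lt lt (okutsu_degree (ltnW ir)) (okutsu_ltm ir)).
have [d ->] := delta_fin ir; have [thetar _ _ _ _] := alpha_okutsu.
have -> : i.+1 = r by apply/eqP; rewrite eqn_leq ir.
by rewrite thetar subrr val_zero ext_lt_infty.
Qed.

Lemma alpha_minpoly i : (i <= r)%N ->
  exists g, minimal_polynomial iota (alpha i) g /\ size g = (m i).+1.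
Proof. by move=> ir; apply: elt_degree_minimal_polynomial (okutsu_degree ir). Qed.

Lemma root_le_delta i f z : (i < r)%N -> f != 0 -> root f^i z -> (size f <= m i.+1)%N ->
  vbar (theta - z) <= delta i.
Proof.
move=> ir f0 rz szf; have [e [de le]] := root_elt_degree f0 rz.
exact: okutsu_le ir de (leq_trans le szf).
Qed.

Lemma far_okutsu i d : (i < r)%N -> delta i = fin d -> forall beta e,
  elt_degree iota beta e -> (e < m i.+1)%N -> vbar (theta - beta) <= fin d.
Proof. by move=> ir <- beta e de; apply: okutsu_le. Qed.

(** No root of [f] is nearer to [theta] than [alpha i], so for [i > 0] [near_root_maximal] applies
    in the ball of radius [delta i.-1], with [D = m i]. In degree one there is no previous ball, but
    the value is the distance from [theta] to the only root. *)
Lemma alpha_maximal i f g : (i < r)%N -> minimal_polynomial iota (alpha i) g ->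
  size g = (m i).+1 -> f \is monic -> size f = (m i).+1 -> vF f <= vF g.
Proof.
move=> ir ming szg monf szf; have mong := ming.1.
have rg := minimal_polynomial_root ming.
have rootf y : root f^i y -> vbar (theta - y) <= delta i.
  move=> ry; have szf' : (size f <= m i.+1)%N by rewrite szf; apply: okutsu_ltm.
  exact: root_le_delta ir (monic_neq0 monf) ry szf'.
case: i => [|i] in ir ming szg szf rg rootf *.
  have linear h : h \is monic -> size h = (m 0).+1 ->
      exists b, (forall x, root h^i x = (x == b)) /\ vF h = vbar (theta - b).
    have [_ _ m0 _ _] := alpha_okutsu.
    rewrite m0 => monh szh; exists (- iota h`_0).
    have h1 : h`_1 = 1 by have := monicP monh; rewrite lead_coefE szh.
    have hE x : h^i.[x] = iota h`_0 + x.
      rewrite (@horner_coef_wide _ 2) ?size_map_poly ?szh //.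
      by rewrite !big_ord_recl big_ord0 !coef_map /= h1 rmorph1 expr0 mulr1 expr1 mul1r addr0.
    split=> [x|]; last by rewrite /eval_valuation hE opprK addrC.
    by rewrite /root hE addrC addr_eq0.
  have [b [rb ->]] := linear f monf szf; have [c [rc ->]] := linear g mong szg.
  by move: rg; rewrite rc => /eqP <-; apply: rootf; rewrite rb eqxx.
have ir' := ltnW ir; have [d dE] := delta_fin ir'.
apply: (near_root_maximal (far_okutsu ir' dE) _ monf mong szf szg rg) rootf.
  exact: (tame_nroots v_henselian vbar_ext minF theta_tame (far_okutsu ir' dE)).
by rewrite -dE; apply: delta_lt.
Qed.

Lemma chain_monic i : (i <= r)%N -> phi i \is monic.
Proof.
have [_ [mon0 _ _ _] steps _ _] := mu_chain.
case: i => [//|i] /steps[[[]] //|[dI [I [rho [_ _ [[]]]]]]]; done.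
Qed.

(** The radius is attained by a root [beta] of [phi i] instead of [alpha i]; [stage_delta]
    identifies [d] with [delta i] afterwards, by means of the step to [phi i.+1]. *)
Definition stage i : Prop := exists d beta,
  [/\ size (phi i) = (m i).+1, root (phi i)^i beta, vbar (theta - beta) = fin d,
      forall f, mu i f = W d f & d = \sum_(k < i.+1) secondary_slope phi gamma mu k].

Lemma chain_gamma i : (i <= r)%N -> vF (phi i) = gamma i.
Proof.
have [_ _ _ [phir gammar _] grow] := mu_chain.
rewrite leq_eqVlt => /orP[/eqP ->|/grow[]//].
rewrite phir gammar /eval_valuation.
by rewrite (eqP (minimal_polynomial_root minF)) val_zero.
Qed.

Lemma chain_vF i f : (i <= r)%N -> (size f < size (phi i))%N -> mu i f = vF f.
Proof. exact: (chain_stable mu_chain). Qed.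

Lemma stage_not_limit i : (i < r)%N -> stage i ->
  ~ limit_step v (mu i) (phi i.+1) (gamma i.+1) (mu i.+1).
Proof.
move=> ir [d [beta [szphi rb bd muE _]]] lim.
have [_ _ _ _ grow] := mu_chain; have [ltsz _] := grow _ ir.
have [g [ming szg]] := alpha_minpoly (ltnW ir).
(* Evaluation at [beta] provides [eta]: it majorises [W d], since [beta] may replace [theta] as
   centre, and it is infinite on [phi i]. *)
pose ev : {rmorphism {poly K} -> Kbar} := horner_eval beta \o map_poly iota.
have [|||||||f [monf szf lt]] := @limit_step_no_maximum _ _ _ _ _ _ _ (val_comp ev vbar) (phi i) g lim.
- by move=> rho; apply: (chain_key_degree mu_chain (ltnW ir)).
- move=> f; rewrite muE (gauss_center f^i (_ : fin d <= vbar (theta - beta))) ?bd //.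
  exact: gauss_le_horner.
- have phi0 : (phi i)^i != 0 by rewrite map_poly_eq0 monic_neq0 // chain_monic // ltnW.
  rewrite muE; have [V ->] := gauss_fin vbar theta d phi0.
  by rewrite /= horner_evalE (eqP rb) val_zero ext_lt_infty.
- exact: (chain_size mu_chain).
- exact: ming.1.
- by rewrite szg szphi.
- by rewrite szg -szphi.
have := alpha_maximal ir ming szg monf; rewrite szf szphi => /(_ erefl).
by rewrite -!(@chain_vF i.+1) ?szf ?szg -?szphi // leNgt lt.
Qed.

Section Step.
Variable i : nat.
Hypotheses (ir : (i < r)%N) (stage_i : stage i).

Lemma stage_ordinary : ordinary_augmentation (mu i) (phi i.+1) (gamma i.+1) (mu i.+1).
Proof.
have [_ _ steps _ _] := mu_chain.
by have [//|/(stage_not_limit ir stage_i)] := steps _ ir.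
Qed.

Lemma stage_small f d : (forall f, mu i f = W d f) -> (size f < size (phi i.+1))%N -> W d f = vF f.
Proof.
by move=> muE szf; rewrite -muE -(ordinary_small stage_ordinary) // chain_vF.
Qed.

(** The degree of [beta] is less than [m i.+1], hence [d <= delta i]. If this were strict, the
    minimal polynomial of [alpha i] would have a root in the open ball of radius [d], so [W d] and
    [vF] would differ on it, although its degree is less than that of [phi i.+1]. *)
Lemma stage_delta d beta : size (phi i) = (m i).+1 -> root (phi i)^i beta ->
  vbar (theta - beta) = fin d -> (forall f, mu i f = W d f) -> delta i = fin d.
Proof.
move=> szphi rb bd muE; apply: le_anti; apply/andP; split; last first.
  rewrite -bd; apply: root_le_delta ir _ rb _.
    by rewrite monic_neq0 // chain_monic // ltnW.
  by rewrite szphi; apply: okutsu_ltm.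
rewrite leNgt; apply/negP => dlt.
have [g [ming szg]] := alpha_minpoly (ltnW ir).
have [_ _ _ _ grow] := mu_chain; have [ltsz _] := grow _ ir.
have := near_root_gauss_lt (monic_neq0 ming.1) (minimal_polynomial_root ming) dlt.
by rewrite (stage_small muE) ?ltxx // szg -szphi.
Qed.

(** The step increases the value of [phi i.+1] beyond [W d], so [phi i.+1] has a root in the open
    ball, whence its degree is at least [m i.+1]. Conversely, [W d] and [vF] differ on the minimal
    polynomial of [alpha i.+1], while by [stage_small] they agree below the degree of [phi i.+1]. *)
Lemma stage_size d : delta i = fin d -> (forall f, mu i f = W d f) ->
  W d (phi i.+1) < vF (phi i.+1) /\ size (phi i.+1) = (m i.+1).+1.
Proof.
move=> dd muE; have lt : W d (phi i.+1) < vF (phi i.+1).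
  by rewrite -muE chain_gamma //; case: stage_ordinary.
split=> //; have phi0 : phi i.+1 != 0 by rewrite monic_neq0 // chain_monic.
apply/eqP; rewrite eqn_leq; apply/andP; split; last first.
  have [z [rz dz]] := gauss_lt_near_root lt.
  rewrite ltnNge; apply/negP => szm.
  by have := root_le_delta ir phi0 rz szm; rewrite dd leNgt dz.
rewrite leqNgt; apply/negP => szm.
have [g [ming szg]] := alpha_minpoly ir.
have near : fin d < delta i.+1 by rewrite -dd; apply: delta_lt.
have := near_root_gauss_lt (monic_neq0 ming.1) (minimal_polynomial_root ming) near.
by rewrite (stage_small muE) ?ltxx // szg.
Qed.

End Step.

Lemma center_lt d z y : vbar (theta - z) = fin d -> vbar (theta - y) < fin d ->
  vbar (z - y) < fin d.
Proof.
move=> zd yd; have -> : z - y = (theta - y) - (theta - z) by ring.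
by rewrite val_addl ?val_opp ?zd.
Qed.

(** [gauss_expansion] is centred at a root of the key polynomial; as [vbar (theta - z) = d], the
    centres [theta] and [z] define the same Gauss valuation. *)
Lemma gauss_phi_expansion d z (rs : seq Kbar) (psi : {poly K}) (s : seq {poly K}) :
  vbar (theta - z) = fin d ->
  psi^i = ('X - z%:P) * \prod_(y <- rs) ('X - y%:P) ->
  (forall y, y \in rs -> vbar (theta - y) < fin d) ->
  (forall n y, (n < size s)%N -> s`_n != 0 -> root (s`_n)^i y -> vbar (theta - y) < fin d) ->
  W d (\sum_(n < size s) s`_n * psi ^+ n) =
  \big[Order.min/infty]_(n < size s) (W d s`_n + W d psi *+ n).
Proof.
move=> zd psiE rsd sd.
have ctr (h : {poly Kbar}) : gauss vbar theta d h = gauss vbar z d h by apply: gauss_center; rewrite zd.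
pose S := [seq p^i | p : {poly K} <- s].
have SE n : (n < size s)%N -> S`_n = (s`_n)^i by move=> ns; rewrite (nth_map 0).
have domrs : dominant vbar z d (\prod_(y <- rs) ('X - y%:P)).
  rewrite -[X in dominant _ _ _ X]scale1r; apply: dominant_prod; first exact: oner_neq0.
  by move=> y yrs; apply: center_lt zd (rsd _ yrs).
have domS n : (n < size S)%N -> S`_n = 0 \/ dominant vbar z d S`_n.
  rewrite size_map => ns; rewrite SE //.
  have [->|sn0] := eqVneq s`_n 0; first by left; rewrite rmorph0.
  right; have [ts sE] := closed_field_poly_normal (s`_n)^i; rewrite sE.
  have lc0 : lead_coef (s`_n)^i != 0 by rewrite lead_coef_eq0 map_poly_eq0.
  apply: (dominant_prod lc0) => y yts; apply: center_lt zd (sd n y ns sn0 _).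
  rewrite sE. by rewrite rootZ // root_prod_XsubC.
have := gauss_expansion domrs domS; rewrite -psiE size_map => e.
transitivity (gauss vbar z d (\sum_(n < size s) S`_n * psi^i ^+ n)).
  rewrite ctr rmorph_sum; congr (gauss vbar z d _); apply: eq_bigr => n _.
  by rewrite SE // rmorphM rmorphXn.
by rewrite e; apply: eq_bigr => n _; rewrite SE // !ctr.
Qed.

Lemma stage_next i : (i.+1 < r)%N -> stage i -> stage i.+1.
Proof.
move=> ir1 si; have ir := ltnW ir1; have [d [beta0 [szphi0 rb0 bd0 muE dE]]] := si.
have dd := stage_delta ir si szphi0 rb0 bd0 muE.
have [lt szphi] := stage_size ir si dd muE.
have [z [rz dz]] := gauss_lt_near_root lt.
have mon := chain_monic ir; have phi0 := monic_neq0 mon.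
have far := far_okutsu ir dd.
have single := tame_nroots v_henselian vbar_ext minF theta_tame far.
(* The new radius is the distance from [theta] to the root of [phi i.+1] in the old ball; the bound
   by [delta i.+1] makes it finite. *)
have zle : vbar (theta - z) <= delta i.+1.
  by apply: (root_le_delta ir1 phi0 rz); rewrite szphi; apply: okutsu_ltm.
have [d' zd'] : exists d', vbar (theta - z) = fin d'.
  by have [d1 d1E] := delta_fin ir1; rewrite d1E in zle; apply: ext_le_fin zle.
have dd' : d < d' by rewrite -ext_ltE -zd'.
exists d', z; split=> //.
(* Polynomials smaller than [phi i.+1] have no root in the old open ball, so [W d], [W d'] and [vF]
   agree on them; and [W d'] takes the value [gamma i.+1] at [phi i.+1], none of whose roots is
   nearer to [theta] than [z]. *)
- move=> f; have [s [szs ->]] := ex_expansion f (chain_size mu_chain ir).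
  have [rs [psiE rsd]] := near_root_factor single mon szphi rz dz.
  have [_ _ ->] := stage_ordinary ir si; last exact: szs.
  have small g : (size g < size (phi i.+1))%N -> g != 0 -> forall y, root g^i y ->
      vbar (theta - y) <= fin d.
    move=> szg g0 y ry; rewrite -dd; apply: (root_le_delta ir g0 ry).
    by rewrite -ltnS -szphi.
  rewrite (gauss_phi_expansion zd' psiE).
  + apply: eq_bigr => n _; congr (_ + _ *+ _).
      rewrite muE; have [->|s0] := eqVneq s`_n 0; first by rewrite rmorph0 !gauss0.
      rewrite (stage_small ir si muE) ?szs //; apply/esym/gauss_far_roots => y ry.
      by apply: le_trans (small _ (szs _ (ltn_ord n)) s0 _ ry) _; rewrite ext_leE ltW.
    rewrite -chain_gamma //; apply/esym/gauss_far_roots => y.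
    rewrite psiE rootM root_XsubC root_prod_XsubC => /orP[/eqP ->|/rsd yd].
      by rewrite zd'.
    by apply: le_trans yd _; rewrite ext_leE ltW.
  + by move=> y /rsd yd; apply: le_lt_trans yd _; rewrite ext_ltE.
  + move=> n y ns s0 ry; apply: le_lt_trans (small _ (szs _ ns) s0 _ ry) _.
    by rewrite ext_ltE.
rewrite big_ord_recr /= -dE.
(* This reads [gamma i.+1 + d = d' + mu i (phi i.+1)]: the increase of the radius is the slope. *)
have := near_root_value single mon szphi rz dz.
rewrite chain_gamma // -muE zd'.
have [V phiV] : exists V, mu i (phi i.+1) = fin V.
  by rewrite muE; apply: gauss_fin; rewrite map_poly_eq0.
rewrite phiV; case: (gamma i.+1) => [c|//] [e] /=.
by rewrite addrA [d + c]addrC e addrK.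
Qed.

Lemma stage0 : (0 < r)%N -> stage 0.
Proof.
move=> r0; have [_ [mon0 sz0 g0 form] _ _ _] := mu_chain.
have [d dE] := ext_finP g0; have [_ _ m0 _ _] := alpha_okutsu.
have [a phiE] : exists a, phi 0 = 'X - a%:P.
  exists (- (phi 0)`_0); apply/polyP => i; rewrite polyCN opprK coefD coefX coefC.
  have lc : (phi 0)`_1 = 1 by have := monicP mon0; rewrite lead_coefE sz0.
  case: i => [|[|i]]; rewrite ?lc ?addr0 ?add0r //.
  by rewrite nth_default // sz0.
have phiiE : (phi 0)^i = ('X - (iota a)%:P) * \prod_(y <- [::]) ('X - y%:P).
  by rewrite big_nil mulr1 phiE map_polyXsubC.
have zd : vbar (theta - iota a) = fin d.
  rewrite -dE -(chain_gamma (leq0n r)) /eval_valuation phiiE big_nil mulr1.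
  by rewrite !hornerE.
exists d, (iota a); split=> //.
- by rewrite sz0 m0.
- by rewrite phiiE rootM root_XsubC eqxx.
- move=> f; have [s [szs fE]] := ex_expansion f (chain_size mu_chain (leq0n r)).
  have sC n : s`_n = ((s`_n)`_0)%:P.
    have [ns|ns] := ltnP n (size s); last by rewrite nth_default // coef0 polyC0.
    by apply: size1_polyC; have := szs n ns; rewrite sz0 ltnS.
  have fE' : f = \sum_(n < size [seq p`_0 | p : {poly K} <- s])
      ([seq p`_0 | p : {poly K} <- s]`_n)%:P * phi 0 ^+ n.
    rewrite size_map fE; apply: eq_bigr => n _.
    by rewrite (nth_map 0) // -sC.
  rewrite [in LHS]fE' form size_map [in RHS]fE (gauss_phi_expansion zd phiiE) //.
    apply: eq_bigr => n _; rewrite (nth_map 0) //; congr (_ + _ *+ _).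
      by rewrite sC map_polyC gaussC /= coefC vbar_ext.
    rewrite -(chain_gamma (leq0n r)); apply/esym/gauss_far_roots => y.
    by rewrite phiiE big_nil mulr1 root_XsubC => /eqP ->; rewrite zd.
  move=> n y ns s0; rewrite sC map_polyC rootC fmorph_eq0.
  by rewrite -polyC_eq0 -sC (negPf s0).
by rewrite big_ord_recl big_ord0 addr0 /= dE.
Qed.

Lemma okutsu_delta i : (i < r)%N ->
  delta i = fin (\sum_(k < i.+1) secondary_slope phi gamma mu k).
Proof.
move=> ir; have si : stage i.
  elim: i ir => [|i IH] ir; first exact: stage0.
  by apply: stage_next ir (IH (ltnW ir)).
have [d [beta [sz rb bd muE <-]]] := si.
exact: (stage_delta ir si sz rb bd muE).
Qed.

End OkutsuChain.

Theorem corollary4p7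
  (K : fieldType) (Kbar : closedFieldType) (iota : {rmorphism K -> Kbar})
  (iota_alg : forall x : Kbar, algebraicOver iota x)
  (G : oagType) (v : valuation K G) (vbar : valuation Kbar G)
  (v_henselian : henselian v)
  (vbar_ext : forall a : K, vbar (iota a) = v a)
  (vbar_surj : forall g : G, exists x : Kbar, vbar x = fin g)
  (theta : Kbar) (n : nat) (theta_deg : elt_degree iota theta n) (n_gt1 : (1 < n)%N)
  (theta_tame : tame_elt iota vbar theta)
  (F : {poly K}) (F_min : is_minpoly (base_field iota) theta (map_poly iota F))
  (r : nat) (alpha : nat -> Kbar) (m : nat -> nat)
  (alpha_okutsu : okutsu_sequence iota vbar theta r alpha m)
  (alpha_sep : forall i, (i < r)%N -> separable_elt iota (alpha i))
  (phi : nat -> {poly K}) (gamma : nat -> extg G)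
  (mu : nat -> valuation {poly K} G)
  (mu_chain : MLV_chain v F (eval_valuation iota vbar theta) r phi gamma mu) :
  forall i, (i < r)%N ->
    vbar (theta - alpha i) = fin (\sum_(j < i.+1) secondary_slope phi gamma mu j).
Proof.
have F0 : F != 0.
  by apply/eqP => e; have [/monic_neq0] := F_min; rewrite e rmorph0 eqxx.
exact: (okutsu_delta iota_alg v_henselian vbar_ext theta_tame (is_minpoly_minimal F0 F_min)
  alpha_okutsu mu_chain).
Qed.
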